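(* The category $\mathrm{Dbl}$ of (strict) double categories and strict double functors, with the (mixed) funny product $\Box$ as tensor product, is a biclosed monoidal category $(\mathrm{Dbl},\Box)$.
   Context: A double category has objects, horizontal 1-cells (1h-cells), vertical 1-cells (1v-cells) and squares (2-cells). $gf$ is the composite of 1h-cells; $[a|b]$ is horizontal composition of 2-cells ($a$ left), $a/b$ vertical composition ($a$ on top), also for 1v-cells; $1_A,1^A$ are horizontal and vertical identities, $\mathrm{Id}_f,\mathrm{Id}^u$ identity 2-cells. Funny product. For double categories $\mathbb A,\mathbb B$, $\mathbb A\Box\mathbb B$ is the double category generated by: objects $A\Box B$; 1h-cells $A\Box k$, $K\Box B$; 1v-cells $A\Box u$, $U\Box B$; 2-cells $A\Box\omega$, $\zeta\Box B$, squares $U\Box k$ (top $A\Box k$, bottom $\tilde A\Box k$, left $U\Box B$, right $U\Box B'$) and $K\Box u$ (top $K\Box B$, bottom $K\Box\tilde B$, left $A\Box u$, right $A'\Box u$), for objects $A\in\mathbb A$, $B\in\mathbb B$, 1h-cells $K:A\to A'$ in $\mathbb A$, $k:B\to B'$ in $\mathbb B$, 1v-cells $U:A\to\tilde A$ in $\mathbb A$, $u:B\to\tilde B$ in $\mathbb B$, 2-cells $\zeta$ in $\mathbb A$ (top $K$, bottom $L$, left $U$), $\omega$ in $\mathbb B$ (top $k$, bottom $l$, left $u$); subject to the relations: $A\Box-$ and $-\Box B$ are strict double functors (strictly preserve all compositions and identities); the two 1v-composites $(A\Box u)/(U\Box\tilde B)$ and $(U\Box B)/(\tilde A\Box u)$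 are equal (the 2-cell $U\Box u$ is an identity); $K\Box1^B=\mathrm{Id}_{K\Box B}$, $1^A\Box k=\mathrm{Id}_{A\Box k}$, $K\Box(u/u')=(K\Box u)/(K\Box u')$, $(U/U')\Box k=(U\Box k)/(U'\Box k)$, $1_A\Box u=\mathrm{Id}^{A\Box u}$, $U\Box1_B=\mathrm{Id}^{U\Box B}$, $(K'K)\Box u=[K\Box u|K'\Box u]$, $U\Box(k'k)=[U\Box k|U\Box k']$; and the naturality relations $(A\Box\omega)/(U\Box l)=(U\Box k)/(\tilde A\Box\omega)$ and $(K\Box u)/(\zeta\Box\tilde B)=(\zeta\Box B)/(L\Box u)$ (with the evident sides). On double functors, $(F\Box G)(a\Box b)=F(a)\Box G(b)$. The unit is the terminal double category. The corresponding inner hom is the double category $[\mathbb B,\mathbb C]$ whose objects are strict double functors $\mathbb B\to\mathbb C$; whose 1h-cells $F\to G$ are horizontal unnatural transformations: 1h-cells $\alpha(B):F(B)\to G(B)$ and squares $\alpha^u$ (top $\alpha(B)$, bottom $\alpha(\tilde B)$, left $F(u)$, right $G(u)$) with $\alpha^{u/v}=\alpha^u/\alpha^v$, $\alpha^{1^B}=\mathrm{Id}_{\alpha(B)}$ (no naturality with respect to 1h-cells); whose 1v-cells are vertical strict transformations: 1v-cells $\alpha_0(B)$ natural in 1v-cells and squares $(\alpha_0)_f$ (top $F(f)$, bottom $G(f)$), functorial in $f$ and natural with respect to 2-cells; and whose 2-cells are families of squares $\Theta_B$ (top $\alpha(B)$, bottom $\beta(B)$, left $\alpha_0(B)$, right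 $\beta_0(B)$) with $\alpha^u/\Theta_{\tilde B}=\Theta_B/\beta^u$ for all 1v-cells $u:B\to\tilde B$. Biclosed means that both $-\Box\mathbb B$ and $\mathbb B\Box-$ have right adjoints. *)

(* Defs.v *)
From Stdlib Require Import ssreflect.
From Stdlib Require Import FunctionalExtensionality PropExtensionality.
From Stdlib Require Import ProofIrrelevance IndefiniteDescription.

Set Implicit Arguments.
Unset Strict Implicit.
Unset Printing Implicit Defensive.

Record category := Category {
  obj :> Type;
  hom : obj -> obj -> Type;
  ident : forall X, hom X X;
  compose : forall X Y Z, hom Y Z -> hom X Y -> hom X Z;
  compose_idl : forall X Y (f : hom X Y), compose (ident Y) f = f;
  compose_idr : forall X Y (f : hom X Y), compose f (ident X) = f;
  compose_assoc : forall W X Y Z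
    (h : hom Y Z) (g : hom X Y) (f : hom W X),
    compose (compose h g) f = compose h (compose g f)
}.
Arguments ident {c} X.

Declare Scope cat_scope.
Notation "g \o f" := (compose g f) (at level 50, left associativity)
  : cat_scope.
Local Open Scope cat_scope.

Definition is_iso (C : category) (X Y : C) (f : hom X Y) : Prop :=
  exists g : hom Y X, g \o f = ident X /\ f \o g = ident Y.

Record functor (C D : category) := Functor {
  fobj :> C -> D;
  fmap : forall X Y, hom X Y -> hom (fobj X) (fobj Y);
  fmap_id : forall X, fmap (ident X) = ident (fobj X);
  fmap_comp : forall X Y Z (g : hom Y Z) (f : hom X Y),
    fmap (g \o f) = fmap g \o fmap f
}.
Arguments fmap {C D} f0 {X Y}.

(* [F] is left adjoint to [G]: a bijection of hom-sets, natural in both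
   variables. *)
Record adjunction (C D : category) (F : functor C D) (G : functor D C) :=
  Adjunction {
  adj : forall X Y, hom (F X) Y -> hom X (G Y);
  adj_inv : forall X Y, hom X (G Y) -> hom (F X) Y;
  adjK : forall X Y (h : hom (F X) Y), adj_inv (adj h) = h;
  adj_invK : forall X Y (h : hom X (G Y)), adj (adj_inv h) = h;
  adj_natural : forall X X' Y Y'
    (f : hom X' X) (h : hom (F X) Y) (g : hom Y Y'),
    adj (g \o h \o fmap F f) = fmap G g \o adj h \o f
}.

Definition has_right_adjoint (C D : category) (F : functor C D) : Prop :=
  exists G : functor D C, inhabited (adjunction F G).

Definition prod_category (C D : category) : category.
Proof.
refine (@Category (C * D)
  (fun X Y => (hom (fst X) (fst Y) * hom (snd X) (snd Y))%type)
  (fun X => (ident (fst X), ident (snd X)))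
  (fun X Y Z g f => (fst g \o fst f, snd g \o snd f)) _ _ _).
- by move=> X Y [f g] /=; rewrite !compose_idl.
- by move=> X Y [f g] /=; rewrite !compose_idr.
- by move=> W X Y Z h g f /=; rewrite !compose_assoc.
Defined.

Section Bifunctor.
Variables (C : category) (T : functor (prod_category C C) C).

Definition tensor (X Y : C) : C := T (X, Y).

Definition tensor_map (X X' Y Y' : C) (f : hom X X') (g : hom Y Y') :
    hom (tensor X Y) (tensor X' Y') :=
  fmap T (X := (X, Y)) (Y := (X', Y')) (f, g).

Lemma tensor_map_id (X Y : C) :
  tensor_map (ident X) (ident Y) = ident (tensor X Y).
Proof. exact: (fmap_id T (X, Y)). Qed.

Lemma tensor_map_comp (X X' X'' Y Y' Y'' : C)
    (f' : hom X' X'') (f : hom X X') (g' : hom Y' Y'') (g : hom Y Y') :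
  tensor_map (f' \o f) (g' \o g) = tensor_map f' g' \o tensor_map f g.
Proof.
exact: (@fmap_comp _ _ T (X, Y) (X', Y') (X'', Y'') (f', g') (f, g)).
Qed.

(* The functor [- (x) B]. *)
Definition tensor_right (B : C) : functor C C.
Proof.
refine (@Functor C C (fun X => tensor X B)
          (fun X Y f => tensor_map f (ident B)) _ _).
- by move=> X; apply: tensor_map_id.
- by move=> X Y Z g f; rewrite -tensor_map_comp compose_idl.
Defined.

(* The functor [B (x) -]. *)
Definition tensor_left (B : C) : functor C C.
Proof.
refine (@Functor C C (fun X => tensor B X)
          (fun X Y f => tensor_map (ident B) f) _ _).
- by move=> X; apply: tensor_map_id.
- by move=> X Y Z g f; rewrite -tensor_map_comp compose_idl.
Defined.

Record monoidal_structure (I : C) := MonoidalStructure {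
  assoc : forall X Y Z,
    hom (tensor (tensor X Y) Z) (tensor X (tensor Y Z));
  lunit : forall X, hom (tensor I X) X;
  runit : forall X, hom (tensor X I) X;
  assoc_iso : forall X Y Z, is_iso (assoc X Y Z);
  lunit_iso : forall X, is_iso (lunit X);
  runit_iso : forall X, is_iso (runit X);
  assoc_natural : forall X X' Y Y' Z Z'
    (f : hom X X') (g : hom Y Y') (h : hom Z Z'),
    assoc X' Y' Z' \o tensor_map (tensor_map f g) h
    = tensor_map f (tensor_map g h) \o assoc X Y Z;
  lunit_natural : forall X X' (f : hom X X'),
    lunit X' \o tensor_map (ident I) f = f \o lunit X;
  runit_natural : forall X X' (f : hom X X'),
    runit X' \o tensor_map f (ident I) = f \o runit X;
  pentagon : forall W X Y Z,
    assoc W X (tensor Y Z) \o assoc (tensor W X) Y Z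
    = tensor_map (ident W) (assoc X Y Z)
      \o assoc W (tensor X Y) Z
      \o tensor_map (assoc W X Y) (ident Z);
  triangle : forall X Y,
    tensor_map (ident X) (lunit Y) \o assoc X I Y
    = tensor_map (runit X) (ident Y)
}.

Definition biclosed : Prop :=
  (forall B, has_right_adjoint (tensor_right B)) /\
  (forall B, has_right_adjoint (tensor_left B)).

End Bifunctor.

(* A category with set of objects [O] and set of arrows [A].  The composite
   [cmp f g] is in diagrammatic order and takes a proof of composability;
   the laws quantify over all such proofs, so no transport is needed. *)
Record cat_on (O A : Type) := CatOn {
  src : A -> O;
  tgt : A -> O;
  idn : O -> A;
  cmp : forall f g : A, tgt f = src g -> A;
  src_idn : forall x, src (idn x) = x;
  tgt_idn : forall x, tgt (idn x) = x;
  src_cmp : forall f g e, src (@cmp f g e) = src f;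
  tgt_cmp : forall f g e, tgt (@cmp f g e) = tgt g;
  cmp_idl : forall f e, @cmp (idn (src f)) f e = f;
  cmp_idr : forall f e, @cmp f (idn (tgt f)) e = f;
  cmp_assoc : forall f g h (fg : tgt f = src g) (gh : tgt g = src h) e e',
    @cmp (cmp fg) h e = @cmp f (cmp gh) e'
}.

Record functor_on (O A P B : Type) (C : cat_on O A) (D : cat_on P B)
    (fO : O -> P) (fA : A -> B) : Prop := FunctorOn {
  f_src : forall f, src D (fA f) = fO (src C f);
  f_tgt : forall f, tgt D (fA f) = fO (tgt C f);
  f_idn : forall x, fA (idn C x) = idn D (fO x);
  f_cmp : forall f g (e : tgt C f = src C g) e',
    fA (cmp e) = @cmp _ _ D (fA f) (fA g) e'
}.

(* A 2-cell has left and right boundaries ([src], [tgt] in [hsq]) and top and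
   bottom boundaries ([src], [tgt] in [vsq]).  Composition in [hsq] is
   [[a|b]], with identities [Id^u]; composition in [vsq] is [a/b], with
   identities [Id_f]. *)
Record dblcat := DblCat {
  ob : Type;
  hor : Type;
  ver : Type;
  sq : Type;
  hcat : cat_on ob hor;
  vcat : cat_on ob ver;
  hsq : cat_on ver sq;
  vsq : cat_on hor sq;
  corner_tl : forall a, src hcat (src vsq a) = src vcat (src hsq a);
  corner_tr : forall a, tgt hcat (src vsq a) = src vcat (tgt hsq a);
  corner_bl : forall a, src hcat (tgt vsq a) = tgt vcat (src hsq a);
  corner_br : forall a, tgt hcat (tgt vsq a) = tgt vcat (tgt hsq a);
  top_Id : forall u, src vsq (idn hsq u) = idn hcat (src vcat u);
  bot_Id : forall u, tgt vsq (idn hsq u) = idn hcat (tgt vcat u);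
  left_Id : forall f, src hsq (idn vsq f) = idn vcat (src hcat f);
  right_Id : forall f, tgt hsq (idn vsq f) = idn vcat (tgt hcat f);
  top_hcmp : forall a b (e : tgt hsq a = src hsq b) e',
    src vsq (cmp e) = @cmp _ _ hcat (src vsq a) (src vsq b) e';
  bot_hcmp : forall a b (e : tgt hsq a = src hsq b) e',
    tgt vsq (cmp e) = @cmp _ _ hcat (tgt vsq a) (tgt vsq b) e';
  left_vcmp : forall a b (e : tgt vsq a = src vsq b) e',
    src hsq (cmp e) = @cmp _ _ vcat (src hsq a) (src hsq b) e';
  right_vcmp : forall a b (e : tgt vsq a = src vsq b) e',
    tgt hsq (cmp e) = @cmp _ _ vcat (tgt hsq a) (tgt hsq b) e';
  Id_vcmp : forall u v (e : tgt vcat u = src vcat v) e',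
    idn hsq (cmp e) = @cmp _ _ vsq (idn hsq u) (idn hsq v) e';
  Id_hcmp : forall f g (e : tgt hcat f = src hcat g) e',
    idn vsq (cmp e) = @cmp _ _ hsq (idn vsq f) (idn vsq g) e';
  Id_Id : forall x, idn hsq (idn vcat x) = idn vsq (idn hcat x);
  interchange : forall a b c d
    (ab : tgt hsq a = src hsq b) (cd : tgt hsq c = src hsq d)
    (ac : tgt vsq a = src vsq c) (bd : tgt vsq b = src vsq d) e e',
    @cmp _ _ vsq (cmp ab) (cmp cd) e = @cmp _ _ hsq (cmp ac) (cmp bd) e'
}.

Record dblfun (C D : dblcat) := DblFun {
  fob : ob C -> ob D;
  fhor : hor C -> hor D;
  fver : ver C -> ver D;
  fsq : sq C -> sq D;
  fun_hcat : functor_on (hcat C) (hcat D) fob fhor;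
  fun_vcat : functor_on (vcat C) (vcat D) fob fver;
  fun_hsq : functor_on (hsq C) (hsq D) fver fsq;
  fun_vsq : functor_on (vsq C) (vsq D) fhor fsq
}.

Lemma dblfun_eq (C D : dblcat) (F G : dblfun C D) :
  (forall x, fob F x = fob G x) -> (forall f, fhor F f = fhor G f) ->
  (forall u, fver F u = fver G u) -> (forall a, fsq F a = fsq G a) -> F = G.
Proof.
case: F => fo fh fv fs p1 p2 p3 p4; case: G => go gh gv gs q1 q2 q3 q4 /=.
move=> /functional_extensionality eo /functional_extensionality eh.
move=> /functional_extensionality ev /functional_extensionality es.
by subst; f_equal; apply: proof_irrelevance.
Qed.

Lemma functor_on_id (O A : Type) (C : cat_on O A) :
  functor_on C C (fun x => x) (fun f => f).
Proof. by split=> // f g e e'; rewrite (proof_irrelevance _ e e'). Qed.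

Lemma functor_on_comp (O A P B Q E : Type) (C : cat_on O A) (D : cat_on P B)
    (F : cat_on Q E) gO gA fO fA :
  functor_on D F gO gA -> functor_on C D fO fA ->
  functor_on C F (fun x => gO (fO x)) (fun f => gA (fA f)).
Proof.
move=> G H; split.
- by move=> f; rewrite (f_src G) (f_src H).
- by move=> f; rewrite (f_tgt G) (f_tgt H).
- by move=> x; rewrite (f_idn H) (f_idn G).
- move=> f g e e'.
  have e1 : tgt D (fA f) = src D (fA g) by rewrite (f_tgt H) (f_src H) e.
  by rewrite (f_cmp H e e1) (f_cmp G e1 e').
Qed.

Definition dblfun_id (C : dblcat) : dblfun C C :=
  DblFun (functor_on_id _) (functor_on_id _)
         (functor_on_id _) (functor_on_id _).

Definition dblfun_comp (C D E : dblcat) (G : dblfun D E) (F : dblfun C D) :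
    dblfun C E :=
  DblFun (functor_on_comp (fun_hcat G) (fun_hcat F))
         (functor_on_comp (fun_vcat G) (fun_vcat F))
         (functor_on_comp (fun_hsq G) (fun_hsq F))
         (functor_on_comp (fun_vsq G) (fun_vsq F)).

Definition Dbl : category.
Proof.
by refine (@Category dblcat dblfun dblfun_id dblfun_comp _ _ _);
  move=> *; apply: dblfun_eq.
Defined.

Definition terminal_cat_on : cat_on unit unit.
Proof.
by refine (@CatOn unit unit (fun _ => tt) (fun _ => tt) (fun _ => tt)
             (fun _ _ _ => tt) _ _ _ _ _ _ _); repeat case.
Defined.

Definition terminal_dblcat : dblcat.
Proof.
by refine (@DblCat unit unit unit unit terminal_cat_on terminal_cat_on
             terminal_cat_on terminal_cat_on
             _ _ _ _ _ _ _ _ _ _ _ _ _ _ _ _); repeat case.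
Defined.

(* The set of equivalence classes of the elements [t] with [R t t]. *)
Definition quot (T : Type) (R : T -> T -> Prop) : Type :=
  {P : T -> Prop | exists t, R t t /\ P = R t}.

Definition cls (T : Type) (R : T -> T -> Prop) (t : T) (Rt : R t t) : quot R :=
  exist _ (R t) (ex_intro _ t (conj Rt eq_refl)).

Definition repr (T : Type) (R : T -> T -> Prop) (q : quot R) : T :=
  proj1_sig (constructive_indefinite_description _ (proj2_sig q)).

Section Quotient.
Variables (T : Type) (R : T -> T -> Prop).
Hypothesis Rsym : forall a b, R a b -> R b a.
Hypothesis Rtrans : forall a b c, R a b -> R b c -> R a c.

Lemma repr_wf (q : quot R) : R (repr q) (repr q).
Proof. by rewrite /repr; case: constructive_indefinite_description => t []. Qed.

Lemma quot_eq (p q : quot R) : R (repr p) (repr q) -> p = q.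
Proof.
have E (r : quot R) : proj1_sig r = R (repr r).
  by rewrite /repr; case: constructive_indefinite_description => t [].
move=> H; have {E} : proj1_sig p = proj1_sig q.
  rewrite !E; apply: functional_extensionality => t.
  apply: propositional_extensionality.
  by split=> K; [apply: Rtrans (Rsym H) K | apply: Rtrans H K].
case: p q {H} => P p [Q q] /= E; subst; congr exist; exact: proof_irrelevance.
Qed.

Lemma repr_cls t (Rt : R t t) : R (repr (cls Rt)) t.
Proof.
rewrite /repr; case: constructive_indefinite_description => s [Rs E] /=.
by move: E => /= <-.
Qed.

Lemma cls_eq a b (Ra : R a a) (Rb : R b b) : R a b -> cls Ra = cls Rb.
Proof.
move=> Rab; apply: quot_eq.
exact: Rtrans (repr_cls Ra) (Rtrans Rab (Rsym (repr_cls Rb))).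
Qed.

Lemma cls_repr q : cls (repr_wf q) = q.
Proof. by apply: quot_eq; apply: repr_cls. Qed.

End Quotient.

Inductive term (O E : Type) :=
| Gen (e : E)
| Idt (x : O)
| Cmp (a b : term O E).
Arguments Gen {O E} e.
Arguments Idt {O E} x.

Section Terms.
Variables (O E : Type) (s t : E -> O).

Fixpoint tsrc (a : term O E) : O :=
  match a with Gen e => s e | Idt x => x | Cmp a _ => tsrc a end.

Fixpoint ttgt (a : term O E) : O :=
  match a with Gen e => t e | Idt x => x | Cmp _ b => ttgt b end.

Variable R : term O E -> term O E -> Prop.

(* The least congruence containing [R] for which the category laws hold.  It
   is partial: [teq a a] says that [a] is a well-formed composite. *)
Inductive teq : term O E -> term O E -> Prop :=
| teq_gen e : teq (Gen e) (Gen e)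
| teq_id x : teq (Idt x) (Idt x)
| teq_cmp a a' b b' : teq a a' -> teq b b' -> ttgt a = tsrc b ->
    teq (Cmp a b) (Cmp a' b')
| teq_sym a b : teq a b -> teq b a
| teq_trans a b c : teq a b -> teq b c -> teq a c
| teq_idl a : teq a a -> teq (Cmp (Idt (tsrc a)) a) a
| teq_idr a : teq a a -> teq (Cmp a (Idt (ttgt a))) a
| teq_assoc a b c : teq a a -> teq b b -> teq c c ->
    ttgt a = tsrc b -> ttgt b = tsrc c ->
    teq (Cmp (Cmp a b) c) (Cmp a (Cmp b c))
| teq_rel a b : R a b -> teq a b.

Hypothesis R_src : forall a b, R a b -> tsrc a = tsrc b.
Hypothesis R_tgt : forall a b, R a b -> ttgt a = ttgt b.

Lemma teq_src a b : teq a b -> tsrc a = tsrc b.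
Proof. by elim=> //= *; solve [congruence | exact: R_src]. Qed.

Lemma teq_tgt a b : teq a b -> ttgt a = ttgt b.
Proof. by elim=> //= *; solve [congruence | exact: R_tgt]. Qed.

Definition arr : Type := quot teq.
Definition arr_src (q : arr) : O := tsrc (repr q).
Definition arr_tgt (q : arr) : O := ttgt (repr q).
Definition arr_id (x : O) : arr := cls (teq_id x).
Definition arr_cmp (p q : arr) (e : arr_tgt p = arr_src q) : arr :=
  cls (teq_cmp (repr_wf p) (repr_wf q) e).

Lemma arr_src_cls a (wa : teq a a) : arr_src (cls wa) = tsrc a.
Proof. exact: teq_src (repr_cls wa). Qed.

Lemma arr_tgt_cls a (wa : teq a a) : arr_tgt (cls wa) = ttgt a.
Proof. exact: teq_tgt (repr_cls wa). Qed.

Definition arr_eq := @quot_eq _ _ teq_sym teq_trans.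
Definition arr_cls_eq := @cls_eq _ _ teq_sym teq_trans.

Lemma arr_cmp_cls a b (wa : teq a a) (wb : teq b b) e (wab : teq _ _) :
  @arr_cmp (cls wa) (cls wb) e = cls (t := Cmp a b) wab.
Proof. by apply: arr_cls_eq; apply: teq_cmp e; apply: repr_cls. Qed.

Definition presented_cat : cat_on O arr.
Proof.
refine (@CatOn O arr arr_src arr_tgt arr_id arr_cmp _ _ _ _ _ _ _).
- by move=> x; rewrite arr_src_cls.
- by move=> x; rewrite arr_tgt_cls.
- by move=> f g e; rewrite arr_src_cls.
- by move=> f g e; rewrite arr_tgt_cls.
- move=> f e; apply: arr_eq; apply: teq_trans (repr_cls _) _.
  apply: teq_trans (teq_idl (repr_wf f)).
  by apply: teq_cmp (repr_wf f) e; apply: repr_cls.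
- move=> f e; apply: arr_eq; apply: teq_trans (repr_cls _) _.
  apply: teq_trans (teq_idr (repr_wf f)).
  by apply: teq_cmp (repr_wf f) _ e; apply: repr_cls.
- move=> f g h fg gh e e'; apply: arr_cls_eq.
  apply: (@teq_trans _ (Cmp (Cmp (repr f) (repr g)) (repr h))).
    by apply: teq_cmp (repr_wf h) e; apply: repr_cls.
  apply: teq_trans (teq_assoc (repr_wf f) (repr_wf g) (repr_wf h) fg gh) _.
  apply: teq_sym.
  by apply: teq_cmp (repr_wf f) _ e'; apply: repr_cls.
Defined.

End Terms.

(* Terms for 2-cells: generators, [Id^u], [Id_f], [[a|b]] and [a/b]. *)
Inductive sterm (O H V S : Type) :=
| SGen (e : S)
| SHId (u : term O V)
| SVId (f : term O H)
| SHCmp (a b : sterm O H V S)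
| SVCmp (a b : sterm O H V S).
Arguments SGen {O H V S} e.
Arguments SHId {O H V S} u.
Arguments SVId {O H V S} f.

(* Generating cells; the boundary of a generating 2-cell consists of
   generating 1-cells. *)
Record dblgraph := DblGraph {
  gob : Type;
  ghor : Type;
  gver : Type;
  gsq : Type;
  hsrc : ghor -> gob;
  htgt : ghor -> gob;
  vsrc : gver -> gob;
  vtgt : gver -> gob;
  gtop : gsq -> ghor;
  gbot : gsq -> ghor;
  gleft : gsq -> gver;
  gright : gsq -> gver;
  gcorner_tl : forall a, hsrc (gtop a) = vsrc (gleft a);
  gcorner_tr : forall a, htgt (gtop a) = vsrc (gright a);
  gcorner_bl : forall a, hsrc (gbot a) = vtgt (gleft a);
  gcorner_br : forall a, htgt (gbot a) = vtgt (gright a)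
}.

Definition hterm (G : dblgraph) := term (gob G) (ghor G).
Definition vterm (G : dblgraph) := term (gob G) (gver G).
Definition sqterm (G : dblgraph) := sterm (gob G) (ghor G) (gver G) (gsq G).

Section Boundary.
Variable G : dblgraph.

Definition hts : hterm G -> gob G := tsrc (@hsrc G).
Definition htt : hterm G -> gob G := ttgt (@htgt G).
Definition vts : vterm G -> gob G := tsrc (@vsrc G).
Definition vtt : vterm G -> gob G := ttgt (@vtgt G).

Fixpoint stop (a : sqterm G) : hterm G :=
  match a with
  | SGen e => Gen (gtop e)
  | SHId u => Idt (vts u)
  | SVId f => f
  | SHCmp a b => Cmp (stop a) (stop b)
  | SVCmp a _ => stop a
  end.

Fixpoint sbot (a : sqterm G) : hterm G :=
  match a with
  | SGen e => Gen (gbot e)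
  | SHId u => Idt (vtt u)
  | SVId f => f
  | SHCmp a b => Cmp (sbot a) (sbot b)
  | SVCmp _ b => sbot b
  end.

Fixpoint sleft (a : sqterm G) : vterm G :=
  match a with
  | SGen e => Gen (gleft e)
  | SHId u => u
  | SVId f => Idt (hts f)
  | SHCmp a _ => sleft a
  | SVCmp a b => Cmp (sleft a) (sleft b)
  end.

Fixpoint sright (a : sqterm G) : vterm G :=
  match a with
  | SGen e => Gen (gright e)
  | SHId u => u
  | SVId f => Idt (htt f)
  | SHCmp _ b => sright b
  | SVCmp a b => Cmp (sright a) (sright b)
  end.

Lemma scorner_tl a : hts (stop a) = vts (sleft a).
Proof. elim: a => //= e; exact: gcorner_tl. Qed.
Lemma scorner_tr a : htt (stop a) = vts (sright a).
Proof. elim: a => //= e; exact: gcorner_tr. Qed.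
Lemma scorner_bl a : hts (sbot a) = vtt (sleft a).
Proof. elim: a => //= e; exact: gcorner_bl. Qed.
Lemma scorner_br a : htt (sbot a) = vtt (sright a).
Proof. elim: a => //= e; exact: gcorner_br. Qed.

Variables (hrel : hterm G -> hterm G -> Prop)
          (vrel : vterm G -> vterm G -> Prop)
          (srel : sqterm G -> sqterm G -> Prop).

Definition heq := teq (@hsrc G) (@htgt G) hrel.
Definition veq := teq (@vsrc G) (@vtgt G) vrel.

(* The least congruence containing [srel] for which the laws of a double
   category hold; again [seq a a] says that [a] is well formed, where the
   matching of boundaries is up to the relations on 1-cells. *)
Inductive seq : sqterm G -> sqterm G -> Prop :=
| seq_gen e : seq (SGen e) (SGen e)
| seq_hid u v : veq u v -> seq (SHId u) (SHId v)
| seq_vid f g : heq f g -> seq (SVId f) (SVId g)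
| seq_hcmp a a' b b' : seq a a' -> seq b b' -> veq (sright a) (sleft b) ->
    seq (SHCmp a b) (SHCmp a' b')
| seq_vcmp a a' b b' : seq a a' -> seq b b' -> heq (sbot a) (stop b) ->
    seq (SVCmp a b) (SVCmp a' b')
| seq_sym a b : seq a b -> seq b a
| seq_trans a b c : seq a b -> seq b c -> seq a c
| seq_hidl a : seq a a -> seq (SHCmp (SHId (sleft a)) a) a
| seq_hidr a : seq a a -> seq (SHCmp a (SHId (sright a))) a
| seq_hassoc a b c : seq a a -> seq b b -> seq c c ->
    veq (sright a) (sleft b) -> veq (sright b) (sleft c) ->
    seq (SHCmp (SHCmp a b) c) (SHCmp a (SHCmp b c))
| seq_vidl a : seq a a -> seq (SVCmp (SVId (stop a)) a) a
| seq_vidr a : seq a a -> seq (SVCmp a (SVId (sbot a))) a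
| seq_vassoc a b c : seq a a -> seq b b -> seq c c ->
    heq (sbot a) (stop b) -> heq (sbot b) (stop c) ->
    seq (SVCmp (SVCmp a b) c) (SVCmp a (SVCmp b c))
| seq_Id_v u v : veq u u -> veq v v -> vtt u = vts v ->
    seq (SHId (Cmp u v)) (SVCmp (SHId u) (SHId v))
| seq_Id_h f g : heq f f -> heq g g -> htt f = hts g ->
    seq (SVId (Cmp f g)) (SHCmp (SVId f) (SVId g))
| seq_Id_Id x : seq (SHId (Idt x)) (SVId (Idt x))
| seq_interchange a b c d : seq a a -> seq b b -> seq c c -> seq d d ->
    veq (sright a) (sleft b) -> veq (sright c) (sleft d) ->
    heq (sbot a) (stop c) -> heq (sbot b) (stop d) ->
    seq (SVCmp (SHCmp a b) (SHCmp c d)) (SHCmp (SVCmp a c) (SVCmp b d))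
| seq_rel a b : srel a b -> seq a b.

End Boundary.

(* Related terms must be parallel, so that boundaries pass to the quotient.
   They should also be well formed, since [teq] and [seq] make them so. *)
Record presentation := Presentation {
  pgraph :> dblgraph;
  hrel : hterm pgraph -> hterm pgraph -> Prop;
  vrel : vterm pgraph -> vterm pgraph -> Prop;
  srel : sqterm pgraph -> sqterm pgraph -> Prop;
  hrel_src : forall a b, hrel a b -> hts a = hts b;
  hrel_tgt : forall a b, hrel a b -> htt a = htt b;
  vrel_src : forall a b, vrel a b -> vts a = vts b;
  vrel_tgt : forall a b, vrel a b -> vtt a = vtt b;
  srel_top : forall a b, srel a b -> heq hrel (stop a) (stop b);
  srel_bot : forall a b, srel a b -> heq hrel (sbot a) (sbot b);
  srel_left : forall a b, srel a b -> veq vrel (sleft a) (sleft b);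
  srel_right : forall a b, srel a b -> veq vrel (sright a) (sright b)
}.

Section Presented.
Variable P : presentation.

Local Notation heq := (heq (@hrel P)).
Local Notation veq := (veq (@vrel P)).
Local Notation seq := (seq (@hrel P) (@vrel P) (@srel P)).

Lemma heq_src a b : heq a b -> hts a = hts b.
Proof. exact: teq_src (@hrel_src P) _ _. Qed.
Lemma heq_tgt a b : heq a b -> htt a = htt b.
Proof. exact: teq_tgt (@hrel_tgt P) _ _. Qed.
Lemma veq_src a b : veq a b -> vts a = vts b.
Proof. exact: teq_src (@vrel_src P) _ _. Qed.
Lemma veq_tgt a b : veq a b -> vtt a = vtt b.
Proof. exact: teq_tgt (@vrel_tgt P) _ _. Qed.

Lemma seq_boundary a b : seq a b ->
  (heq (stop a) (stop b) /\ heq (sbot a) (sbot b)) /\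
  (veq (sleft a) (sleft b) /\ veq (sright a) (sright b)).
Proof.
have hj a' b' : veq (sright a') (sleft b') ->
    htt (stop a') = hts (stop b') /\ htt (sbot a') = hts (sbot b').
  move=> e; rewrite scorner_tr scorner_tl scorner_br scorner_bl.
  by split; [apply: veq_src | apply: veq_tgt].
have vj a' b' : heq (sbot a') (stop b') ->
    vtt (sleft a') = vts (sleft b') /\ vtt (sright a') = vts (sright b').
  move=> e; rewrite -scorner_bl -scorner_tl -scorner_br -scorner_tr.
  by split; [apply: heq_src | apply: heq_tgt].
elim=> {a b} /=.
- by move=> e; do !split; apply: teq_gen.
- move=> u v e; rewrite (veq_src e) (veq_tgt e).
  by do !split; try apply: teq_id.
- move=> f g e; rewrite (heq_src e) (heq_tgt e).
  by do !split; try apply: teq_id.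
- move=> a a' b b' _ [[? ?] [? ?]] _ [[? ?] [? ?]] /hj [? ?].
  by do !split=> //; apply: teq_cmp.
- move=> a a' b b' _ [[? ?] [? ?]] _ [[? ?] [? ?]] /vj [? ?].
  by do !split=> //; apply: teq_cmp.
- move=> a b _ [[? ?] [? ?]]; by do !split; apply: teq_sym.
- move=> a b c _ [[? ?] [? ?]] _ [[? ?] [? ?]].
  by do !split; apply: teq_trans; eassumption.
- move=> a _ [[? ?] [? ?]]; rewrite -scorner_tl -scorner_bl.
  by do !split=> //; apply: teq_idl.
- move=> a _ [[? ?] [? ?]]; rewrite -scorner_tr -scorner_br.
  by do !split=> //; apply: teq_idr.
- move=> a b c _ [[? ?] [? ?]] _ [[? ?] [? ?]] _ [[? ?] [? ?]].
  by move=> /hj [? ?] /hj [? ?]; do !split=> //; apply: teq_assoc.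
- move=> a _ [[? ?] [? ?]]; rewrite scorner_tl scorner_tr.
  by do !split=> //; apply: teq_idl.
- move=> a _ [[? ?] [? ?]]; rewrite scorner_bl scorner_br.
  by do !split=> //; apply: teq_idr.
- move=> a b c _ [[? ?] [? ?]] _ [[? ?] [? ?]] _ [[? ?] [? ?]].
  by move=> /vj [? ?] /vj [? ?]; do !split=> //; apply: teq_assoc.
- by move=> u v ? ? ?; do !split; try apply: teq_id; apply: teq_cmp.
- by move=> f g ? ? ?; do !split; try apply: teq_id; apply: teq_cmp.
- by move=> x; do !split; apply: teq_id.
- move=> a b c d _ [[? ?] [? ?]] _ [[? ?] [? ?]] _ [[? ?] [? ?]].
  move=> _ [[? ?] [? ?]] /hj [? ?] /hj [? ?] /vj [? ?] /vj [? ?].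
  by do !split; apply: teq_cmp.
- move=> a b r; do !split.
  + exact: srel_top.
  + exact: srel_bot.
  + exact: srel_left.
  + exact: srel_right.
Qed.

Lemma seq_top a b : seq a b -> heq (stop a) (stop b).
Proof. by case/seq_boundary=> [[]]. Qed.
Lemma seq_bot a b : seq a b -> heq (sbot a) (sbot b).
Proof. by case/seq_boundary=> [[]]. Qed.
Lemma seq_left a b : seq a b -> veq (sleft a) (sleft b).
Proof. by case/seq_boundary=> [_ []]. Qed.
Lemma seq_right a b : seq a b -> veq (sright a) (sright b).
Proof. by case/seq_boundary=> [_ []]. Qed.

Definition pres_hcat : cat_on (gob P) (quot heq) :=
  presented_cat (@hrel_src P) (@hrel_tgt P).
Definition pres_vcat : cat_on (gob P) (quot veq) :=
  presented_cat (@vrel_src P) (@vrel_tgt P).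

Definition pres_top (q : quot seq) : quot heq := cls (seq_top (repr_wf q)).
Definition pres_bot (q : quot seq) : quot heq := cls (seq_bot (repr_wf q)).
Definition pres_left (q : quot seq) : quot veq := cls (seq_left (repr_wf q)).
Definition pres_right (q : quot seq) : quot veq := cls (seq_right (repr_wf q)).

Definition heq_cls_eq := @cls_eq _ heq (@teq_sym _ _ _ _ _) (@teq_trans _ _ _ _ _).
Definition veq_cls_eq := @cls_eq _ veq (@teq_sym _ _ _ _ _) (@teq_trans _ _ _ _ _).
Definition seq_cls_eq := @cls_eq _ seq (@seq_sym _ _ _ _) (@seq_trans _ _ _ _).
Definition seq_quot_eq := @quot_eq _ seq (@seq_sym _ _ _ _) (@seq_trans _ _ _ _).

Lemma heq_cls_inj a b (wa : heq a a) (wb : heq b b) :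
  cls wa = cls wb -> heq a b.
Proof.
move=> e; apply: teq_trans (repr_cls wb).
by rewrite -e; apply: teq_sym; apply: (repr_cls wa).
Qed.

Lemma veq_cls_inj a b (wa : veq a a) (wb : veq b b) :
  cls wa = cls wb -> veq a b.
Proof.
move=> e; apply: teq_trans (repr_cls wb).
by rewrite -e; apply: teq_sym; apply: (repr_cls wa).
Qed.

Definition pres_hid (u : quot veq) : quot seq :=
  cls (@seq_hid _ _ _ (@srel P) _ _ (repr_wf u)).
Definition pres_vid (f : quot heq) : quot seq :=
  cls (@seq_vid _ _ _ (@srel P) _ _ (repr_wf f)).
Definition pres_hcmp (p q : quot seq) (e : pres_right p = pres_left q) :
    quot seq :=
  cls (seq_hcmp (repr_wf p) (repr_wf q) (veq_cls_inj e)).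
Definition pres_vcmp (p q : quot seq) (e : pres_bot p = pres_top q) :
    quot seq :=
  cls (seq_vcmp (repr_wf p) (repr_wf q) (heq_cls_inj e)).

Lemma pres_top_cls a (wa : seq a a) w : pres_top (cls wa) = cls (t := stop a) w.
Proof. apply: heq_cls_eq; exact: seq_top (repr_cls wa). Qed.
Lemma pres_bot_cls a (wa : seq a a) w : pres_bot (cls wa) = cls (t := sbot a) w.
Proof. apply: heq_cls_eq; exact: seq_bot (repr_cls wa). Qed.
Lemma pres_left_cls a (wa : seq a a) w :
  pres_left (cls wa) = cls (t := sleft a) w.
Proof. apply: veq_cls_eq; exact: seq_left (repr_cls wa). Qed.
Lemma pres_right_cls a (wa : seq a a) w :
  pres_right (cls wa) = cls (t := sright a) w.
Proof. apply: veq_cls_eq; exact: seq_right (repr_cls wa). Qed.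

Definition pres_hsq : cat_on (quot veq) (quot seq).
Proof.
refine (@CatOn _ _ pres_left pres_right pres_hid pres_hcmp _ _ _ _ _ _ _).
- move=> u; rewrite (@pres_left_cls (SHId (repr u)) _ (repr_wf u)).
  by apply: cls_repr; [apply: teq_sym | apply: teq_trans].
- move=> u; rewrite (@pres_right_cls (SHId (repr u)) _ (repr_wf u)).
  by apply: cls_repr; [apply: teq_sym | apply: teq_trans].
- by move=> f g e; apply: pres_left_cls.
- by move=> f g e; apply: pres_right_cls.
- move=> f e; apply: seq_quot_eq; apply: seq_trans (repr_cls _) _.
  apply: seq_trans (seq_hidl (repr_wf f)).
  apply: seq_hcmp (repr_wf f) (veq_cls_inj e).
  by apply: seq_trans (repr_cls _) _; apply: seq_hid; apply: repr_cls.
- move=> f e; apply: seq_quot_eq; apply: seq_trans (repr_cls _) _.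
  apply: seq_trans (seq_hidr (repr_wf f)).
  apply: seq_hcmp (repr_wf f) _ (veq_cls_inj e).
  by apply: seq_trans (repr_cls _) _; apply: seq_hid; apply: repr_cls.
- move=> f g h fg gh e e'; apply: seq_cls_eq.
  apply: (@seq_trans _ _ _ _ _ (SHCmp (SHCmp (repr f) (repr g)) (repr h))).
    by apply: seq_hcmp (repr_wf h) (veq_cls_inj e); apply: repr_cls.
  apply: seq_trans (seq_hassoc (repr_wf f) (repr_wf g) (repr_wf h)
                      (veq_cls_inj fg) (veq_cls_inj gh)) _.
  apply: seq_sym.
  by apply: seq_hcmp (repr_wf f) _ (veq_cls_inj e'); apply: repr_cls.
Defined.

Definition pres_vsq : cat_on (quot heq) (quot seq).
Proof.
refine (@CatOn _ _ pres_top pres_bot pres_vid pres_vcmp _ _ _ _ _ _ _).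
- move=> u; rewrite (@pres_top_cls (SVId (repr u)) _ (repr_wf u)).
  by apply: cls_repr; [apply: teq_sym | apply: teq_trans].
- move=> u; rewrite (@pres_bot_cls (SVId (repr u)) _ (repr_wf u)).
  by apply: cls_repr; [apply: teq_sym | apply: teq_trans].
- by move=> f g e; apply: pres_top_cls.
- by move=> f g e; apply: pres_bot_cls.
- move=> f e; apply: seq_quot_eq; apply: seq_trans (repr_cls _) _.
  apply: seq_trans (seq_vidl (repr_wf f)).
  apply: seq_vcmp (repr_wf f) (heq_cls_inj e).
  by apply: seq_trans (repr_cls _) _; apply: seq_vid; apply: repr_cls.
- move=> f e; apply: seq_quot_eq; apply: seq_trans (repr_cls _) _.
  apply: seq_trans (seq_vidr (repr_wf f)).
  apply: seq_vcmp (repr_wf f) _ (heq_cls_inj e).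
  by apply: seq_trans (repr_cls _) _; apply: seq_vid; apply: repr_cls.
- move=> f g h fg gh e e'; apply: seq_cls_eq.
  apply: (@seq_trans _ _ _ _ _ (SVCmp (SVCmp (repr f) (repr g)) (repr h))).
    by apply: seq_vcmp (repr_wf h) (heq_cls_inj e); apply: repr_cls.
  apply: seq_trans (seq_vassoc (repr_wf f) (repr_wf g) (repr_wf h)
                      (heq_cls_inj fg) (heq_cls_inj gh)) _.
  apply: seq_sym.
  by apply: seq_vcmp (repr_wf f) _ (heq_cls_inj e'); apply: repr_cls.
Defined.

Lemma pres_hs a (w : heq a a) : src pres_hcat (cls w) = hts a.
Proof. exact: (arr_src_cls (@hrel_src P)). Qed.
Lemma pres_ht a (w : heq a a) : tgt pres_hcat (cls w) = htt a.
Proof. exact: (arr_tgt_cls (@hrel_tgt P)). Qed.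
Lemma pres_vs a (w : veq a a) : src pres_vcat (cls w) = vts a.
Proof. exact: (arr_src_cls (@vrel_src P)). Qed.
Lemma pres_vt a (w : veq a a) : tgt pres_vcat (cls w) = vtt a.
Proof. exact: (arr_tgt_cls (@vrel_tgt P)). Qed.

Definition presented : dblcat.
Proof.
refine (@DblCat _ _ _ _ pres_hcat pres_vcat pres_hsq pres_vsq
          _ _ _ _ _ _ _ _ _ _ _ _ _ _ _ _) => /=.
- by move=> a; apply: eq_trans (pres_hs _) _; rewrite scorner_tl; symmetry; apply: pres_vs.
- by move=> a; apply: eq_trans (pres_ht _) _; rewrite scorner_tr; symmetry; apply: pres_vs.
- by move=> a; apply: eq_trans (pres_hs _) _; rewrite scorner_bl; symmetry; apply: pres_vt.
- by move=> a; apply: eq_trans (pres_ht _) _; rewrite scorner_br; symmetry; apply: pres_vt.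
- by move=> u; apply: pres_top_cls.
- by move=> u; apply: pres_bot_cls.
- by move=> f; apply: pres_left_cls.
- by move=> f; apply: pres_right_cls.
- move=> a b e e'; have w := seq_hcmp (repr_wf a) (repr_wf b) (veq_cls_inj e).
  by rewrite (pres_top_cls _ (seq_top w)); symmetry; apply: arr_cmp_cls.
- move=> a b e e'; have w := seq_hcmp (repr_wf a) (repr_wf b) (veq_cls_inj e).
  by rewrite (pres_bot_cls _ (seq_bot w)); symmetry; apply: arr_cmp_cls.
- move=> a b e e'; have w := seq_vcmp (repr_wf a) (repr_wf b) (heq_cls_inj e).
  by rewrite (pres_left_cls _ (seq_left w)); symmetry; apply: arr_cmp_cls.
- move=> a b e e'; have w := seq_vcmp (repr_wf a) (repr_wf b) (heq_cls_inj e).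
  by rewrite (pres_right_cls _ (seq_right w)); symmetry; apply: arr_cmp_cls.
- move=> u v e e'; apply: seq_cls_eq.
  apply: seq_trans (seq_hid _ _ (repr_cls _)) _.
  apply: seq_trans (seq_Id_v _ _ _ _ _) _; [exact: repr_wf ..| exact: e |].
  apply: seq_sym.
  by apply: seq_vcmp (heq_cls_inj e'); apply: repr_cls.
- move=> f g e e'; apply: seq_cls_eq.
  apply: seq_trans (seq_vid _ _ (repr_cls _)) _.
  apply: seq_trans (seq_Id_h _ _ _ _ _) _; [exact: repr_wf ..| exact: e |].
  apply: seq_sym.
  by apply: seq_hcmp (veq_cls_inj e'); apply: repr_cls.
- move=> x; apply: seq_cls_eq.
  apply: seq_trans (seq_hid _ _ (repr_cls _)) _.
  apply: seq_trans (seq_Id_Id _ _ _ _) _.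
  by apply: seq_sym; apply: seq_vid; apply: repr_cls.
- move=> a b c d ab cd ac bd e e'; apply: seq_cls_eq.
  apply: (@seq_trans _ _ _ _ _ (SVCmp (SHCmp (repr a) (repr b))
                                      (SHCmp (repr c) (repr d)))).
    by apply: seq_vcmp (heq_cls_inj e); apply: repr_cls.
  apply: seq_trans (seq_interchange (repr_wf a) (repr_wf b) (repr_wf c)
    (repr_wf d) (veq_cls_inj ab) (veq_cls_inj cd) (heq_cls_inj ac)
    (heq_cls_inj bd)) _.
  by apply: seq_sym; apply: seq_hcmp (veq_cls_inj e'); apply: repr_cls.
Defined.

End Presented.

Fixpoint tmap (O E O' E' : Type) (fO : O -> O') (fE : E -> E')
    (a : term O E) : term O' E' :=
  match a with
  | Gen e => Gen (fE e)
  | Idt x => Idt (fO x)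
  | Cmp a b => Cmp (tmap fO fE a) (tmap fO fE b)
  end.

Lemma tmap_id (O E : Type) (a : term O E) :
  tmap (fun x => x) (fun x => x) a = a.
Proof. by elim: a => //= a -> b ->. Qed.

Lemma tmap_comp (O E O' E' O'' E'' : Type) (gO : O' -> O'') (gE : E' -> E'')
    (fO : O -> O') (fE : E -> E') (a : term O E) :
  tmap (fun x => gO (fO x)) (fun x => gE (fE x)) a
  = tmap gO gE (tmap fO fE a).
Proof. by elim: a => //= a -> b ->. Qed.

Section TermMap.
Variables (O E O' E' : Type) (s t : E -> O) (s' t' : E' -> O').
Variables (fO : O -> O') (fE : E -> E').
Hypothesis fs : forall e, s' (fE e) = fO (s e).
Hypothesis ft : forall e, t' (fE e) = fO (t e).

Lemma tsrc_tmap a : tsrc s' (tmap fO fE a) = fO (tsrc s a).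
Proof. by elim: a. Qed.

Lemma ttgt_tmap a : ttgt t' (tmap fO fE a) = fO (ttgt t a).
Proof. by elim: a. Qed.

Variables (R : term O E -> term O E -> Prop).
Variables (R' : term O' E' -> term O' E' -> Prop).
Hypothesis fR : forall a b, R a b ->
  teq s' t' R' (tmap fO fE a) (tmap fO fE b).

Lemma teq_tmap a b : teq s t R a b ->
  teq s' t' R' (tmap fO fE a) (tmap fO fE b).
Proof.
elim=> {a b} /=.
- by move=> e; apply: teq_gen.
- by move=> x; apply: teq_id.
- move=> a a' b b' _ ? _ ? e; apply: teq_cmp => //.
  by rewrite ttgt_tmap tsrc_tmap e.
- by move=> a b _; apply: teq_sym.
- by move=> a b c _ ab _; apply: teq_trans.
- by move=> a _ ?; rewrite -tsrc_tmap; apply: teq_idl.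
- by move=> a _ ?; rewrite -ttgt_tmap; apply: teq_idr.
- move=> a b c _ ? _ ? _ ? ab bc.
  by apply: teq_assoc => //; rewrite ttgt_tmap tsrc_tmap ?ab ?bc.
- exact: fR.
Qed.
End TermMap.

Record graph_map (G G' : dblgraph) := GraphMap {
  mob : gob G -> gob G';
  mhor : ghor G -> ghor G';
  mver : gver G -> gver G';
  msq : gsq G -> gsq G';
  m_hsrc : forall e, hsrc (mhor e) = mob (hsrc e);
  m_htgt : forall e, htgt (mhor e) = mob (htgt e);
  m_vsrc : forall e, vsrc (mver e) = mob (vsrc e);
  m_vtgt : forall e, vtgt (mver e) = mob (vtgt e);
  m_top : forall e, gtop (msq e) = mhor (gtop e);
  m_bot : forall e, gbot (msq e) = mhor (gbot e);
  m_left : forall e, gleft (msq e) = mver (gleft e);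
  m_right : forall e, gright (msq e) = mver (gright e)
}.

Section GraphMap.
Variables (G G' : dblgraph) (m : graph_map G G').

Definition hmap : hterm G -> hterm G' := tmap (mob m) (mhor m).
Definition vmap : vterm G -> vterm G' := tmap (mob m) (mver m).

Fixpoint smap (a : sqterm G) : sqterm G' :=
  match a with
  | SGen e => SGen (msq m e)
  | SHId u => SHId (vmap u)
  | SVId f => SVId (hmap f)
  | SHCmp a b => SHCmp (smap a) (smap b)
  | SVCmp a b => SVCmp (smap a) (smap b)
  end.

Lemma hts_hmap a : hts (hmap a) = mob m (hts a).
Proof. apply: tsrc_tmap; exact: m_hsrc. Qed.
Lemma htt_hmap a : htt (hmap a) = mob m (htt a).
Proof. apply: ttgt_tmap; exact: m_htgt. Qed.
Lemma vts_vmap a : vts (vmap a) = mob m (vts a).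
Proof. apply: tsrc_tmap; exact: m_vsrc. Qed.
Lemma vtt_vmap a : vtt (vmap a) = mob m (vtt a).
Proof. apply: ttgt_tmap; exact: m_vtgt. Qed.

Lemma stop_smap a : stop (smap a) = hmap (stop a).
Proof.
elim: a => //= [e|u|a -> b ->] //; first by rewrite m_top.
by rewrite vts_vmap.
Qed.
Lemma sbot_smap a : sbot (smap a) = hmap (sbot a).
Proof.
elim: a => //= [e|u|a -> b ->] //; first by rewrite m_bot.
by rewrite vtt_vmap.
Qed.
Lemma sleft_smap a : sleft (smap a) = vmap (sleft a).
Proof.
elim: a => //= [e|u|a -> b ->] //; first by rewrite m_left.
by rewrite hts_hmap.
Qed.
Lemma sright_smap a : sright (smap a) = vmap (sright a).
Proof.
elim: a => //= [e|u|a -> b ->] //; first by rewrite m_right.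
by rewrite htt_hmap.
Qed.
End GraphMap.

Section PresentedMap.
Variables (P Q : presentation) (m : graph_map P Q).
Hypothesis m_hrel : forall a b, hrel a b ->
  heq (@hrel Q) (hmap m a) (hmap m b).
Hypothesis m_vrel : forall a b, vrel a b ->
  veq (@vrel Q) (vmap m a) (vmap m b).
Hypothesis m_srel : forall a b, srel a b ->
  seq (@hrel Q) (@vrel Q) (@srel Q) (smap m a) (smap m b).

Lemma heq_hmap a b :
  heq (@hrel P) a b -> heq (@hrel Q) (hmap m a) (hmap m b).
Proof. apply: teq_tmap; [exact: m_hsrc | exact: m_htgt | exact: m_hrel]. Qed.

Lemma veq_vmap a b :
  veq (@vrel P) a b -> veq (@vrel Q) (vmap m a) (vmap m b).
Proof. apply: teq_tmap; [exact: m_vsrc | exact: m_vtgt | exact: m_vrel]. Qed.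

Lemma seq_smap a b : seq (@hrel P) (@vrel P) (@srel P) a b ->
  seq (@hrel Q) (@vrel Q) (@srel Q) (smap m a) (smap m b).
Proof.
have hj a' b' : veq (@vrel P) (sright a') (sleft b') ->
    veq (@vrel Q) (sright (smap m a')) (sleft (smap m b')).
  by rewrite sright_smap sleft_smap; apply: veq_vmap.
have vj a' b' : heq (@hrel P) (sbot a') (stop b') ->
    heq (@hrel Q) (sbot (smap m a')) (stop (smap m b')).
  by rewrite sbot_smap stop_smap; apply: heq_hmap.
elim=> {a b} /=.
- by move=> e; apply: seq_gen.
- by move=> u v /veq_vmap; apply: seq_hid.
- by move=> f g /heq_hmap; apply: seq_vid.
- by move=> a a' b b' _ ? _ ? /hj ?; apply: seq_hcmp.
- by move=> a a' b b' _ ? _ ? /vj ?; apply: seq_vcmp.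
- by move=> a b _; apply: seq_sym.
- by move=> a b c _ ab _; apply: seq_trans.
- by move=> a _ ?; rewrite -sleft_smap; apply: seq_hidl.
- by move=> a _ ?; rewrite -sright_smap; apply: seq_hidr.
- by move=> a b c _ ? _ ? _ ? /hj ? /hj ?; apply: seq_hassoc.
- by move=> a _ ?; rewrite -stop_smap; apply: seq_vidl.
- by move=> a _ ?; rewrite -sbot_smap; apply: seq_vidr.
- by move=> a b c _ ? _ ? _ ? /vj ? /vj ?; apply: seq_vassoc.
- move=> u v /veq_vmap ? /veq_vmap ? e; apply: seq_Id_v => //.
  by rewrite vtt_vmap vts_vmap e.
- move=> f g /heq_hmap ? /heq_hmap ? e; apply: seq_Id_h => //.
  by rewrite htt_hmap hts_hmap e.
- by move=> x; apply: seq_Id_Id.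
- move=> a b c d _ ? _ ? _ ? _ ? /hj ? /hj ? /vj ? /vj ?.
  exact: seq_interchange.
- exact: m_srel.
Qed.

Definition presented_hor (q : quot (heq (@hrel P))) :
    quot (heq (@hrel Q)) :=
  cls (heq_hmap (repr_wf q)).
Definition presented_ver (q : quot (veq (@vrel P))) :
    quot (veq (@vrel Q)) :=
  cls (veq_vmap (repr_wf q)).
Definition presented_sq (q : quot (seq (@hrel P) (@vrel P) (@srel P))) :
    quot (seq (@hrel Q) (@vrel Q) (@srel Q)) :=
  cls (seq_smap (repr_wf q)).

Lemma presented_hor_cls a (wa : heq _ a a) w :
  presented_hor (cls wa) = cls (t := hmap m a) w.
Proof. apply: heq_cls_eq; apply: heq_hmap; exact: repr_cls. Qed.
Lemma presented_ver_cls a (wa : veq _ a a) w :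
  presented_ver (cls wa) = cls (t := vmap m a) w.
Proof. apply: veq_cls_eq; apply: veq_vmap; exact: repr_cls. Qed.
Lemma presented_sq_cls a (wa : seq _ _ _ a a) w :
  presented_sq (cls wa) = cls (t := smap m a) w.
Proof. apply: seq_cls_eq; apply: seq_smap; exact: repr_cls. Qed.

Definition presented_map : dblfun (presented P) (presented Q).
Proof.
refine (@DblFun (presented P) (presented Q) (mob m)
          presented_hor presented_ver presented_sq _ _ _ _); split.
- move=> f; apply: eq_trans (hts_hmap m _).
  by apply: heq_src; apply: repr_cls.
- move=> f; apply: eq_trans (htt_hmap m _).
  by apply: heq_tgt; apply: repr_cls.
- by move=> x; apply: presented_hor_cls.
- move=> f g e e'; apply: heq_cls_eq.
  apply: teq_trans (heq_hmap (repr_cls _)) _; apply: teq_sym.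
  by apply: teq_cmp e'; apply: repr_cls.
- move=> f; apply: eq_trans (vts_vmap m _).
  by apply: veq_src; apply: repr_cls.
- move=> f; apply: eq_trans (vtt_vmap m _).
  by apply: veq_tgt; apply: repr_cls.
- by move=> x; apply: presented_ver_cls.
- move=> f g e e'; apply: veq_cls_eq.
  apply: teq_trans (veq_vmap (repr_cls _)) _; apply: teq_sym.
  by apply: teq_cmp e'; apply: repr_cls.
- move=> a; apply: veq_cls_eq.
  apply: teq_trans (seq_left (repr_cls _)) _; rewrite sleft_smap.
  by apply: veq_vmap; apply: teq_sym; apply: repr_cls.
- move=> a; apply: veq_cls_eq.
  apply: teq_trans (seq_right (repr_cls _)) _; rewrite sright_smap.
  by apply: veq_vmap; apply: teq_sym; apply: repr_cls.
- move=> u; apply: seq_cls_eq; apply: seq_trans (seq_smap (repr_cls _)) _.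
  by apply: seq_hid; apply: teq_sym; apply: repr_cls.
- move=> a b e e'; apply: seq_cls_eq.
  apply: seq_trans (seq_smap (repr_cls _)) _; apply: seq_sym.
  by apply: seq_hcmp (veq_cls_inj e'); apply: repr_cls.
- move=> a; apply: heq_cls_eq.
  apply: teq_trans (seq_top (repr_cls _)) _; rewrite stop_smap.
  by apply: heq_hmap; apply: teq_sym; apply: repr_cls.
- move=> a; apply: heq_cls_eq.
  apply: teq_trans (seq_bot (repr_cls _)) _; rewrite sbot_smap.
  by apply: heq_hmap; apply: teq_sym; apply: repr_cls.
- move=> f; apply: seq_cls_eq; apply: seq_trans (seq_smap (repr_cls _)) _.
  by apply: seq_vid; apply: teq_sym; apply: repr_cls.
- move=> a b e e'; apply: seq_cls_eq.
  apply: seq_trans (seq_smap (repr_cls _)) _; apply: seq_sym.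
  by apply: seq_vcmp (heq_cls_inj e'); apply: repr_cls.
Defined.

End PresentedMap.

Section Composable.
Variables (D : dblcat) (a b : sq D).

Lemma top_hcmp_ex (e : tgt (hsq D) a = src (hsq D) b) :
  exists e', src (vsq D) (cmp e)
             = @cmp _ _ (hcat D) (src (vsq D) a) (src (vsq D) b) e'.
Proof.
have e' : tgt (hcat D) (src (vsq D) a) = src (hcat D) (src (vsq D) b).
  by rewrite corner_tr corner_tl e.
by exists e'; apply: top_hcmp.
Qed.

Lemma bot_hcmp_ex (e : tgt (hsq D) a = src (hsq D) b) :
  exists e', tgt (vsq D) (cmp e)
             = @cmp _ _ (hcat D) (tgt (vsq D) a) (tgt (vsq D) b) e'.
Proof.
have e' : tgt (hcat D) (tgt (vsq D) a) = src (hcat D) (tgt (vsq D) b).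
  by rewrite corner_br corner_bl e.
by exists e'; apply: bot_hcmp.
Qed.

Lemma left_vcmp_ex (e : tgt (vsq D) a = src (vsq D) b) :
  exists e', src (hsq D) (cmp e)
             = @cmp _ _ (vcat D) (src (hsq D) a) (src (hsq D) b) e'.
Proof.
have e' : tgt (vcat D) (src (hsq D) a) = src (vcat D) (src (hsq D) b).
  by rewrite -corner_bl -corner_tl e.
by exists e'; apply: left_vcmp.
Qed.

Lemma right_vcmp_ex (e : tgt (vsq D) a = src (vsq D) b) :
  exists e', tgt (hsq D) (cmp e)
             = @cmp _ _ (vcat D) (tgt (hsq D) a) (tgt (hsq D) b) e'.
Proof.
have e' : tgt (vcat D) (tgt (hsq D) a) = src (vcat D) (tgt (hsq D) b).
  by rewrite -corner_br -corner_tr e.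
by exists e'; apply: right_vcmp.
Qed.
End Composable.

Section Funny.
Variables A B : dblcat.

(* Writing x # y for the funny product: the 1h-cells x # k and K # y. *)
Inductive funny_hor :=
| HR (x : ob A) (k : hor B)
| HL (K : hor A) (y : ob B).

(* The 1v-cells x # u and U # y. *)
Inductive funny_ver :=
| VR (x : ob A) (u : ver B)
| VL (U : ver A) (y : ob B).

(* The 2-cells x # w, z # y, U # k and K # u. *)
Inductive funny_sq :=
| SR (x : ob A) (w : sq B)
| SL (z : sq A) (y : ob B)
| SVH (U : ver A) (k : hor B)
| SHV (K : hor A) (u : ver B).

Definition funny_hsrc (f : funny_hor) : ob A * ob B :=
  match f with
  | HR x k => (x, src (hcat B) k) | HL K y => (src (hcat A) K, y)
  end.
Definition funny_htgt (f : funny_hor) : ob A * ob B :=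
  match f with
  | HR x k => (x, tgt (hcat B) k) | HL K y => (tgt (hcat A) K, y)
  end.
Definition funny_vsrc (f : funny_ver) : ob A * ob B :=
  match f with
  | VR x u => (x, src (vcat B) u) | VL U y => (src (vcat A) U, y)
  end.
Definition funny_vtgt (f : funny_ver) : ob A * ob B :=
  match f with
  | VR x u => (x, tgt (vcat B) u) | VL U y => (tgt (vcat A) U, y)
  end.
Definition funny_top (a : funny_sq) : funny_hor :=
  match a with
  | SR x w => HR x (src (vsq B) w)
  | SL z y => HL (src (vsq A) z) y
  | SVH U k => HR (src (vcat A) U) k
  | SHV K u => HL K (src (vcat B) u)
  end.
Definition funny_bot (a : funny_sq) : funny_hor :=
  match a with
  | SR x w => HR x (tgt (vsq B) w)
  | SL z y => HL (tgt (vsq A) z) y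
  | SVH U k => HR (tgt (vcat A) U) k
  | SHV K u => HL K (tgt (vcat B) u)
  end.
Definition funny_left (a : funny_sq) : funny_ver :=
  match a with
  | SR x w => VR x (src (hsq B) w)
  | SL z y => VL (src (hsq A) z) y
  | SVH U k => VL U (src (hcat B) k)
  | SHV K u => VR (src (hcat A) K) u
  end.
Definition funny_right (a : funny_sq) : funny_ver :=
  match a with
  | SR x w => VR x (tgt (hsq B) w)
  | SL z y => VL (tgt (hsq A) z) y
  | SVH U k => VL U (tgt (hcat B) k)
  | SHV K u => VR (tgt (hcat A) K) u
  end.

Definition funny_graph : dblgraph.
Proof.
refine (@DblGraph (ob A * ob B) funny_hor funny_ver funny_sq
          funny_hsrc funny_htgt funny_vsrc funny_vtgt
          funny_top funny_bot funny_left funny_right _ _ _ _);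
  case=> * /=.
all: by rewrite ?(corner_tl, corner_tr, corner_bl, corner_br).
Defined.

Inductive funny_hrel : hterm funny_graph -> hterm funny_graph -> Prop :=
| hR_id x y : funny_hrel (Gen (HR x (idn (hcat B) y))) (Idt (x, y))
| hR_cmp x k k' (e : tgt (hcat B) k = src (hcat B) k') :
    funny_hrel (Gen (HR x (cmp e))) (Cmp (Gen (HR x k)) (Gen (HR x k')))
| hL_id x y : funny_hrel (Gen (HL (idn (hcat A) x) y)) (Idt (x, y))
| hL_cmp K K' y (e : tgt (hcat A) K = src (hcat A) K') :
    funny_hrel (Gen (HL (cmp e) y)) (Cmp (Gen (HL K y)) (Gen (HL K' y))).

(* [v_swap] makes the two 1v-composites along [U] and [u] equal; there is no
   such relation for 1h-cells. *)
Inductive funny_vrel : vterm funny_graph -> vterm funny_graph -> Prop :=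
| vR_id x y : funny_vrel (Gen (VR x (idn (vcat B) y))) (Idt (x, y))
| vR_cmp x u u' (e : tgt (vcat B) u = src (vcat B) u') :
    funny_vrel (Gen (VR x (cmp e))) (Cmp (Gen (VR x u)) (Gen (VR x u')))
| vL_id x y : funny_vrel (Gen (VL (idn (vcat A) x) y)) (Idt (x, y))
| vL_cmp U U' y (e : tgt (vcat A) U = src (vcat A) U') :
    funny_vrel (Gen (VL (cmp e) y)) (Cmp (Gen (VL U y)) (Gen (VL U' y)))
| v_swap U u :
    funny_vrel
      (Cmp (Gen (VR (src (vcat A) U) u)) (Gen (VL U (tgt (vcat B) u))))
      (Cmp (Gen (VL U (src (vcat B) u))) (Gen (VR (tgt (vcat A) U) u))).

Inductive funny_srel : sqterm funny_graph -> sqterm funny_graph -> Prop :=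
| sR_hid x u :
    funny_srel (SGen (SR x (idn (hsq B) u))) (SHId (Gen (VR x u)))
| sR_vid x k :
    funny_srel (SGen (SR x (idn (vsq B) k))) (SVId (Gen (HR x k)))
| sR_hcmp x w w' (e : tgt (hsq B) w = src (hsq B) w') :
    funny_srel (SGen (SR x (cmp e))) (SHCmp (SGen (SR x w)) (SGen (SR x w')))
| sR_vcmp x w w' (e : tgt (vsq B) w = src (vsq B) w') :
    funny_srel (SGen (SR x (cmp e))) (SVCmp (SGen (SR x w)) (SGen (SR x w')))
| sL_hid U y :
    funny_srel (SGen (SL (idn (hsq A) U) y)) (SHId (Gen (VL U y)))
| sL_vid K y :
    funny_srel (SGen (SL (idn (vsq A) K) y)) (SVId (Gen (HL K y)))
| sL_hcmp z z' y (e : tgt (hsq A) z = src (hsq A) z') :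
    funny_srel (SGen (SL (cmp e) y)) (SHCmp (SGen (SL z y)) (SGen (SL z' y)))
| sL_vcmp z z' y (e : tgt (vsq A) z = src (vsq A) z') :
    funny_srel (SGen (SL (cmp e) y)) (SVCmp (SGen (SL z y)) (SGen (SL z' y)))
| sHV_vid K y :
    funny_srel (SGen (SHV K (idn (vcat B) y))) (SVId (Gen (HL K y)))
| sHV_vcmp K u u' (e : tgt (vcat B) u = src (vcat B) u') :
    funny_srel (SGen (SHV K (cmp e)))
      (SVCmp (SGen (SHV K u)) (SGen (SHV K u')))
| sHV_hid x u :
    funny_srel (SGen (SHV (idn (hcat A) x) u)) (SHId (Gen (VR x u)))
| sHV_hcmp K K' u (e : tgt (hcat A) K = src (hcat A) K') :
    funny_srel (SGen (SHV (cmp e) u))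
      (SHCmp (SGen (SHV K u)) (SGen (SHV K' u)))
| sVH_vid x k :
    funny_srel (SGen (SVH (idn (vcat A) x) k)) (SVId (Gen (HR x k)))
| sVH_vcmp U U' k (e : tgt (vcat A) U = src (vcat A) U') :
    funny_srel (SGen (SVH (cmp e) k))
      (SVCmp (SGen (SVH U k)) (SGen (SVH U' k)))
| sVH_hid U y :
    funny_srel (SGen (SVH U (idn (hcat B) y))) (SHId (Gen (VL U y)))
| sVH_hcmp U k k' (e : tgt (hcat B) k = src (hcat B) k') :
    funny_srel (SGen (SVH U (cmp e)))
      (SHCmp (SGen (SVH U k)) (SGen (SVH U k')))
| sVH_nat U w :
    funny_srel
      (SVCmp (SGen (SR (src (vcat A) U) w)) (SGen (SVH U (tgt (vsq B) w))))
      (SVCmp (SGen (SVH U (src (vsq B) w))) (SGen (SR (tgt (vcat A) U) w)))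
| sHV_nat z u :
    funny_srel
      (SVCmp (SGen (SHV (src (vsq A) z) u)) (SGen (SL z (tgt (vcat B) u))))
      (SVCmp (SGen (SL z (src (vcat B) u))) (SGen (SHV (tgt (vsq A) z) u))).

Local Notation fheq := (heq funny_hrel).
Local Notation fveq := (veq funny_vrel).

Lemma funny_hrel_src a b : funny_hrel a b -> hts a = hts b.
Proof. by case=> *; rewrite /hts /= ?(src_idn, src_cmp). Qed.
Lemma funny_hrel_tgt a b : funny_hrel a b -> htt a = htt b.
Proof. by case=> *; rewrite /htt /= ?(tgt_idn, tgt_cmp). Qed.
Lemma funny_vrel_src a b : funny_vrel a b -> vts a = vts b.
Proof. by case=> *; rewrite /vts /= ?(src_idn, src_cmp). Qed.
Lemma funny_vrel_tgt a b : funny_vrel a b -> vtt a = vtt b.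
Proof. by case=> *; rewrite /vtt /= ?(tgt_idn, tgt_cmp). Qed.

Lemma funny_srel_top a b : funny_srel a b -> fheq (stop a) (stop b).
Proof.
destruct 1; rewrite /= /vts /= ?(src_idn, src_cmp, top_Id);
  try exact: teq_gen; try by apply: teq_rel; constructor.
- case: (top_hcmp_ex e) => e' ->; apply: teq_rel; exact: hR_cmp.
- case: (top_hcmp_ex e) => e' ->; apply: teq_rel; exact: hL_cmp.
Qed.

Lemma funny_srel_bot a b : funny_srel a b -> fheq (sbot a) (sbot b).
Proof.
destruct 1; rewrite /= /vtt /= ?(tgt_idn, tgt_cmp, bot_Id);
  try exact: teq_gen; try by apply: teq_rel; constructor.
- case: (bot_hcmp_ex e) => e' ->; apply: teq_rel; exact: hR_cmp.
- case: (bot_hcmp_ex e) => e' ->; apply: teq_rel; exact: hL_cmp.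
Qed.

Lemma funny_srel_left a b : funny_srel a b -> fveq (sleft a) (sleft b).
Proof.
destruct 1; rewrite /= /hts /= ?(src_idn, src_cmp, left_Id);
  try exact: teq_gen; try by apply: teq_rel; constructor.
- case: (left_vcmp_ex e) => e' ->; apply: teq_rel; exact: vR_cmp.
- case: (left_vcmp_ex e) => e' ->; apply: teq_rel; exact: vL_cmp.
- by rewrite corner_tl corner_bl; apply: teq_rel; constructor.
- by rewrite corner_tl corner_bl; apply: teq_rel; constructor.
Qed.

Lemma funny_srel_right a b : funny_srel a b -> fveq (sright a) (sright b).
Proof.
destruct 1; rewrite /= /htt /= ?(tgt_idn, tgt_cmp, right_Id);
  try exact: teq_gen; try by apply: teq_rel; constructor.
- case: (right_vcmp_ex e) => e' ->; apply: teq_rel; exact: vR_cmp.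
- case: (right_vcmp_ex e) => e' ->; apply: teq_rel; exact: vL_cmp.
- by rewrite corner_tr corner_br; apply: teq_rel; constructor.
- by rewrite corner_tr corner_br; apply: teq_rel; constructor.
Qed.

Definition funny_presentation : presentation :=
  Presentation funny_hrel_src funny_hrel_tgt funny_vrel_src funny_vrel_tgt
    funny_srel_top funny_srel_bot funny_srel_left funny_srel_right.

Definition funny : dblcat := presented funny_presentation.

End Funny.

Lemma functor_cmp_ex (O A P B : Type) (C : cat_on O A) (D : cat_on P B) fO fA
    (F : functor_on C D fO fA) f g (e : tgt C f = src C g) :
  exists e', fA (cmp e) = @cmp _ _ D (fA f) (fA g) e'.
Proof.
have e' : tgt D (fA f) = src D (fA g) by rewrite (f_tgt F) (f_src F) e.
by exists e'; exact: (f_cmp F).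
Qed.

Section FunnyMap.
Variables (A A' B B' : dblcat) (F : dblfun A A') (G : dblfun B B').

Definition funny_map_hor (f : funny_hor A B) : funny_hor A' B' :=
  match f with
  | HR x k => HR (fob F x) (fhor G k) | HL K y => HL (fhor F K) (fob G y)
  end.
Definition funny_map_ver (u : funny_ver A B) : funny_ver A' B' :=
  match u with
  | VR x u => VR (fob F x) (fver G u) | VL U y => VL (fver F U) (fob G y)
  end.
Definition funny_map_sq (a : funny_sq A B) : funny_sq A' B' :=
  match a with
  | SR x w => SR (fob F x) (fsq G w)
  | SL z y => SL (fsq F z) (fob G y)
  | SVH U k => SVH (fver F U) (fhor G k)
  | SHV K u => SHV (fhor F K) (fver G u)
  end.

Definition funny_graph_map : graph_map (funny_graph A B) (funny_graph A' B').
Proof.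
refine (@GraphMap (funny_graph A B) (funny_graph A' B')
  (fun p => (fob F (fst p), fob G (snd p)))
  funny_map_hor funny_map_ver funny_map_sq _ _ _ _ _ _ _ _);
  case=> * /=;
  have [[? ? _ _] [? ? _ _]] := conj (fun_hcat F) (fun_hcat G);
  have [[? ? _ _] [? ? _ _]] := conj (fun_vcat F) (fun_vcat G);
  have [[? ? _ _] [? ? _ _]] := conj (fun_hsq F) (fun_hsq G);
  have [[? ? _ _] [? ? _ _]] := conj (fun_vsq F) (fun_vsq G);
  congruence.
Defined.

Local Notation P := (funny_presentation A B).
Local Notation P' := (funny_presentation A' B').
Local Notation m := (funny_graph_map : graph_map P P').

Lemma funny_map_hrel a b : @hrel P a b ->
  heq (@hrel P') (hmap m a) (hmap m b).
Proof.
destruct 1; rewrite /hmap /=; apply: teq_rel => /=.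
- rewrite (f_idn (fun_hcat G)); exact: hR_id.
- case: (functor_cmp_ex (fun_hcat G) e) => e' ->; exact: hR_cmp.
- rewrite (f_idn (fun_hcat F)); exact: hL_id.
- case: (functor_cmp_ex (fun_hcat F) e) => e' ->; exact: hL_cmp.
Qed.

Lemma funny_map_vrel a b : @vrel P a b ->
  veq (@vrel P') (vmap m a) (vmap m b).
Proof.
destruct 1; rewrite /vmap /=; apply: teq_rel => /=.
- rewrite (f_idn (fun_vcat G)); exact: vR_id.
- case: (functor_cmp_ex (fun_vcat G) e) => e' ->; exact: vR_cmp.
- rewrite (f_idn (fun_vcat F)); exact: vL_id.
- case: (functor_cmp_ex (fun_vcat F) e) => e' ->; exact: vL_cmp.
- rewrite -(f_src (fun_vcat F)) -(f_tgt (fun_vcat F)).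
  rewrite -(f_src (fun_vcat G)) -(f_tgt (fun_vcat G)); exact: v_swap.
Qed.

Lemma funny_map_srel a b : @srel P a b ->
  seq (@hrel P') (@vrel P') (@srel P') (smap m a) (smap m b).
Proof.
destruct 1; rewrite /= /vmap /hmap /=; apply: seq_rel => /=.
- rewrite (f_idn (fun_hsq G)); exact: sR_hid.
- rewrite (f_idn (fun_vsq G)); exact: sR_vid.
- case: (functor_cmp_ex (fun_hsq G) e) => e' ->; exact: sR_hcmp.
- case: (functor_cmp_ex (fun_vsq G) e) => e' ->; exact: sR_vcmp.
- rewrite (f_idn (fun_hsq F)); exact: sL_hid.
- rewrite (f_idn (fun_vsq F)); exact: sL_vid.
- case: (functor_cmp_ex (fun_hsq F) e) => e' ->; exact: sL_hcmp.
- case: (functor_cmp_ex (fun_vsq F) e) => e' ->; exact: sL_vcmp.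
- rewrite (f_idn (fun_vcat G)); exact: sHV_vid.
- case: (functor_cmp_ex (fun_vcat G) e) => e' ->; exact: sHV_vcmp.
- rewrite (f_idn (fun_hcat F)); exact: sHV_hid.
- case: (functor_cmp_ex (fun_hcat F) e) => e' ->; exact: sHV_hcmp.
- rewrite (f_idn (fun_vcat F)); exact: sVH_vid.
- case: (functor_cmp_ex (fun_vcat F) e) => e' ->; exact: sVH_vcmp.
- rewrite (f_idn (fun_hcat G)); exact: sVH_hid.
- case: (functor_cmp_ex (fun_hcat G) e) => e' ->; exact: sVH_hcmp.
- rewrite -(f_src (fun_vcat F)) -(f_tgt (fun_vcat F)).
  rewrite -(f_src (fun_vsq G)) -(f_tgt (fun_vsq G)); exact: sVH_nat.
- rewrite -(f_src (fun_vsq F)) -(f_tgt (fun_vsq F)).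
  rewrite -(f_src (fun_vcat G)) -(f_tgt (fun_vcat G)); exact: sHV_nat.
Qed.

(* F # G, sending each generator a # b to F a # G b. *)
Definition funny_map : dblfun (funny A B) (funny A' B') :=
  presented_map funny_map_hrel funny_map_vrel funny_map_srel.

End FunnyMap.

Section FunnyMapLaws.
Local Notation gm F G := (funny_graph_map F G).

Lemma funny_hmap_id A B a :
  hmap (gm (dblfun_id A) (dblfun_id B)) a = a.
Proof. rewrite /hmap; by elim: a => [[]|[]|a + b] //=; move=> -> ->. Qed.
Lemma funny_vmap_id A B a :
  vmap (gm (dblfun_id A) (dblfun_id B)) a = a.
Proof. rewrite /vmap; by elim: a => [[]|[]|a + b] //=; move=> -> ->. Qed.
Lemma funny_smap_id A B a :
  smap (gm (dblfun_id A) (dblfun_id B)) a = a.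
Proof.
elim: a => [[]|u|f|a + b|a + b] //=; try by move=> -> ->.
- by rewrite funny_vmap_id.
- by rewrite funny_hmap_id.
Qed.

Variables (A A' A'' B B' B'' : dblcat).
Variables (F' : dblfun A' A'') (F : dblfun A A').
Variables (G' : dblfun B' B'') (G : dblfun B B').

Lemma funny_hmap_comp a :
  hmap (gm (dblfun_comp F' F) (dblfun_comp G' G)) a
  = hmap (gm F' G') (hmap (gm F G) a).
Proof. rewrite /hmap; by elim: a => [[]|[]|a + b] //=; move=> -> ->. Qed.
Lemma funny_vmap_comp a :
  vmap (gm (dblfun_comp F' F) (dblfun_comp G' G)) a
  = vmap (gm F' G') (vmap (gm F G) a).
Proof. rewrite /vmap; by elim: a => [[]|[]|a + b] //=; move=> -> ->. Qed.
Lemma funny_smap_comp a :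
  smap (gm (dblfun_comp F' F) (dblfun_comp G' G)) a
  = smap (gm F' G') (smap (gm F G) a).
Proof.
elim: a => [[]|u|f|a + b|a + b] //=; try by move=> -> ->.
- by rewrite funny_vmap_comp.
- by rewrite funny_hmap_comp.
Qed.

Lemma funny_map_id : funny_map (dblfun_id A) (dblfun_id B)
  = dblfun_id (funny A B).
Proof.
apply: dblfun_eq => /=.
- by case.
- move=> f; rewrite -[RHS](cls_repr (@teq_sym _ _ _ _ _) (@teq_trans _ _ _ _ _) f).
  apply: (@heq_cls_eq (funny_presentation A B)); rewrite funny_hmap_id; exact: repr_wf.
- move=> f; rewrite -[RHS](cls_repr (@teq_sym _ _ _ _ _) (@teq_trans _ _ _ _ _) f).
  apply: (@veq_cls_eq (funny_presentation A B)); rewrite funny_vmap_id; exact: repr_wf.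
- move=> f; rewrite -[RHS](cls_repr (@seq_sym _ _ _ _) (@seq_trans _ _ _ _) f).
  apply: (@seq_cls_eq (funny_presentation A B)); rewrite funny_smap_id; exact: repr_wf.
Qed.

Lemma funny_map_comp : funny_map (dblfun_comp F' F) (dblfun_comp G' G)
  = dblfun_comp (funny_map F' G') (funny_map F G).
Proof.
apply: dblfun_eq => /=.
- by case.
- move=> f; apply: (@heq_cls_eq (funny_presentation A'' B'')); rewrite funny_hmap_comp.
  apply: (heq_hmap (funny_map_hrel F' G')).
  by apply: teq_sym; apply: repr_cls.
- move=> f; apply: (@veq_cls_eq (funny_presentation A'' B'')); rewrite funny_vmap_comp.
  apply: (veq_vmap (funny_map_vrel F' G')).
  by apply: teq_sym; apply: repr_cls.
- move=> f; apply: (@seq_cls_eq (funny_presentation A'' B'')); rewrite funny_smap_comp.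
  apply: (seq_smap (funny_map_hrel F' G') (funny_map_vrel F' G')
            (funny_map_srel F' G')).
  by apply: seq_sym; apply: repr_cls.
Qed.
End FunnyMapLaws.

Definition funny_tensor : functor (prod_category Dbl Dbl) Dbl.
Proof.
refine (@Functor (prod_category Dbl Dbl) Dbl
  (fun X => funny (fst X) (snd X))
  (fun X Y F => funny_map (fst F) (snd F)) _ _).
- by move=> X; apply: funny_map_id.
- by move=> X Y Z G F; apply: funny_map_comp.
Defined.

(* Main.v *)
(* A double functor out of A # B is given by double functors x # - and - # y
   together with the squares U # k and K # u; these data are exactly a double
   functor from A to the internal hom [B, C], which yields the right adjoint of
   - # B, and that of B # - follows through the symmetry A # B ~ B # A.

   The associator is the transpose of
     X # Y -> [Y # Z, X # (Y # Z)] # [Z, Y # Z] -> [Z, X # (Y # Z)],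
   units of the adjunction followed by composition of internal homs.  A double
   functor out of (X # Y) # Z is determined by its values on iterated
   generators, on which the associator is a mere rebracketing, so that the
   coherence laws hold by evaluation.  The inverse of the associator is its
   conjugate by symmetries. *)

From Stdlib Require Import ssreflect.
From Stdlib Require Import FunctionalExtensionality ProofIrrelevance.
From Stdlib Require Import ClassicalEpsilon.
Require Import Defs.

Set Implicit Arguments.
Unset Strict Implicit.
Unset Printing Implicit Defensive.

(** * Total composition *)

(** Evaluation on iterated generators needs a justification. In [funny (funny X Y) Z] a generator
    such as [hL K z] takes for [K] an arbitrary 1h-cell of [funny X Y], itself a class of terms. One
    may replace [K] by a generator only because every family of generators is functorial in its
    arguments. For a square such as [sVH U k] this functor goes from 1v-cells to squares under
    vertical composition and is not part of a double functor; hence extensionality is also proved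
    for plain functors between the underlying categories.

    A second obstacle is partiality: the congruences relate only well-formed terms to themselves,
    and composites carry composability proofs. Well-formedness is therefore turned into a recursive
    predicate and composition into a total operation, so that terms can be evaluated by recursion.

    The lack of a swap relation for 1h-cells in the tensor matches the lack of naturality along
    1h-cells in the horizontal transformations of the hom. Thus the fields of [bifun] are at once
    the relations of [funny] and the axioms of cells of [dhom]. *)

Section TotalComposition.
Variables (O A : Type) (C : cat_on O A).

(* Composition made total, with junk value [f] when [f] and [g] do not
   compose, so that composability proofs never occur inside terms. *)
Definition tcmp (f g : A) : A :=
  match excluded_middle_informative (tgt C f = src C g) with
  | left e => cmp e
  | right _ => f
  end.

Lemma tcmpE f g (e : tgt C f = src C g) : cmp e = tcmp f g.
Proof.
rewrite /tcmp; case: excluded_middle_informative => // e'.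
by rewrite (proof_irrelevance _ e e').
Qed.

Lemma src_tcmp f g : tgt C f = src C g -> src C (tcmp f g) = src C f.
Proof. by move=> e; rewrite -(tcmpE e) src_cmp. Qed.

Lemma tgt_tcmp f g : tgt C f = src C g -> tgt C (tcmp f g) = tgt C g.
Proof. by move=> e; rewrite -(tcmpE e) tgt_cmp. Qed.

Lemma tcmp_idl x f : src C f = x -> tcmp (idn C x) f = f.
Proof.
move=> <-; have e : tgt C (idn C (src C f)) = src C f by rewrite tgt_idn.
by rewrite -(tcmpE e) cmp_idl.
Qed.

Lemma tcmp_idr x f : tgt C f = x -> tcmp f (idn C x) = f.
Proof.
move=> <-; have e : tgt C f = src C (idn C (tgt C f)) by rewrite src_idn.
by rewrite -(tcmpE e) cmp_idr.
Qed.

Lemma tcmpA f g h : tgt C f = src C g -> tgt C g = src C h ->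
  tcmp (tcmp f g) h = tcmp f (tcmp g h).
Proof.
move=> fg gh.
have e : tgt C (cmp fg) = src C h by rewrite tgt_cmp.
have e' : tgt C f = src C (cmp gh) by rewrite src_cmp.
by have := cmp_assoc e e'; rewrite !tcmpE.
Qed.
End TotalComposition.

Lemma f_tcmp (O A P B : Type) (C : cat_on O A) (D : cat_on P B) fO fA :
  functor_on C D fO fA -> forall f g, tgt C f = src C g ->
  fA (tcmp C f g) = tcmp D (fA f) (fA g).
Proof.
move=> F f g e; rewrite -(tcmpE e).
by case: (functor_cmp_ex F e) => e' ->; apply: tcmpE.
Qed.

Lemma functor_on_tcmp (O A P B : Type) (C : cat_on O A) (D : cat_on P B)
    (fO : O -> P) (fA : A -> B) :
  (forall f, src D (fA f) = fO (src C f)) ->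
  (forall f, tgt D (fA f) = fO (tgt C f)) ->
  (forall x, fA (idn C x) = idn D (fO x)) ->
  (forall f g, tgt C f = src C g -> fA (tcmp C f g) = tcmp D (fA f) (fA g)) ->
  functor_on C D fO fA.
Proof. by move=> s t i c; split=> // f g e e'; rewrite !tcmpE c. Qed.

Notation "f *h g" := (tcmp (hcat _) f g) (at level 40, left associativity).
Notation "u *v w" := (tcmp (vcat _) u w) (at level 40, left associativity).
Notation "a +h b" := (tcmp (hsq _) a b) (at level 50, left associativity).
Notation "a +v b" := (tcmp (vsq _) a b) (at level 50, left associativity).

Section TotalDouble.
Variable D : dblcat.
Implicit Types (a b c d : sq D) (u v : ver D) (f g : hor D).

Lemma top_tcmp a b : tgt (hsq D) a = src (hsq D) b ->
  src (vsq D) (a +h b) = src (vsq D) a *h src (vsq D) b.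
Proof.
by move=> e; rewrite -(tcmpE e); case: (top_hcmp_ex e) => e' ->; rewrite tcmpE.
Qed.

Lemma bot_tcmp a b : tgt (hsq D) a = src (hsq D) b ->
  tgt (vsq D) (a +h b) = tgt (vsq D) a *h tgt (vsq D) b.
Proof.
by move=> e; rewrite -(tcmpE e); case: (bot_hcmp_ex e) => e' ->; rewrite tcmpE.
Qed.

Lemma left_tcmp a b : tgt (vsq D) a = src (vsq D) b ->
  src (hsq D) (a +v b) = src (hsq D) a *v src (hsq D) b.
Proof.
by move=> e; rewrite -(tcmpE e); case: (left_vcmp_ex e) => e' ->; rewrite tcmpE.
Qed.

Lemma right_tcmp a b : tgt (vsq D) a = src (vsq D) b ->
  tgt (hsq D) (a +v b) = tgt (hsq D) a *v tgt (hsq D) b.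
Proof.
by move=> e; rewrite -(tcmpE e); case: (right_vcmp_ex e) => e' ->;
  rewrite tcmpE.
Qed.

Lemma Id_tcmpv u v : tgt (vcat D) u = src (vcat D) v ->
  idn (hsq D) (u *v v) = idn (hsq D) u +v idn (hsq D) v.
Proof.
move=> e.
have e' : tgt (vsq D) (idn (hsq D) u) = src (vsq D) (idn (hsq D) v).
  by rewrite bot_Id top_Id e.
by rewrite -(tcmpE e) -(tcmpE e') (Id_vcmp e e').
Qed.

Lemma Id_tcmph f g : tgt (hcat D) f = src (hcat D) g ->
  idn (vsq D) (f *h g) = idn (vsq D) f +h idn (vsq D) g.
Proof.
move=> e.
have e' : tgt (hsq D) (idn (vsq D) f) = src (hsq D) (idn (vsq D) g).
  by rewrite right_Id left_Id e.
by rewrite -(tcmpE e) -(tcmpE e') (Id_hcmp e e').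
Qed.

Lemma interchange_tcmp a b c d :
  tgt (hsq D) a = src (hsq D) b -> tgt (hsq D) c = src (hsq D) d ->
  tgt (vsq D) a = src (vsq D) c -> tgt (vsq D) b = src (vsq D) d ->
  (a +h b) +v (c +h d) = (a +v c) +h (b +v d).
Proof.
move=> ab cd ac bd.
have e : tgt (vsq D) (cmp ab) = src (vsq D) (cmp cd).
  by rewrite !tcmpE bot_tcmp // top_tcmp // ac bd.
have e' : tgt (hsq D) (cmp ac) = src (hsq D) (cmp bd).
  by rewrite !tcmpE right_tcmp // left_tcmp // ab cd.
by have := interchange e e'; rewrite !tcmpE.
Qed.
End TotalDouble.

(** * Double functors out of a presented double category *)

Section WellFormed.
Variables (O E : Type) (s t : E -> O).
Variable R : term O E -> term O E -> Prop.

(** [teq a a] also expresses that [a] is well formed, but symmetry and transitivity among its rules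
    prevent inversion to the subterms of [a]. This recursive form gives them directly. *)
Fixpoint twf (a : term O E) : Prop :=
  match a with
  | Cmp a b => twf a /\ twf b /\ ttgt t a = tsrc s b
  | _ => True
  end.

Lemma twf_teq a : twf a -> teq s t R a a.
Proof.
elim: a => [e|x|a Ha b Hb] /=; [by move=> _; apply: teq_gen | by move=> _;
  apply: teq_id |].
by case=> /Ha ? [/Hb ? ?]; apply: teq_cmp.
Qed.

Hypothesis R_src : forall a b, R a b -> tsrc s a = tsrc s b.
Hypothesis R_tgt : forall a b, R a b -> ttgt t a = ttgt t b.
Hypothesis R_wf : forall a b, R a b -> twf a /\ twf b.

Lemma teq_twf a b : teq s t R a b -> twf a /\ twf b.
Proof.
elim=> {a b} /=; try by move=> *; do !split; tauto.
- move=> a a' b b' aa [? ?] bb [? ?] e; do !split=> //.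
  by rewrite -(teq_src R_src bb) -(teq_tgt R_tgt aa).
- exact: R_wf.
Qed.

Variables (P A : Type) (D : cat_on P A) (fO : O -> P) (fE : E -> A).

(** Total composition makes this a plain recursion; only the values at well-formed terms carry
    meaning. *)
Fixpoint teval (a : term O E) : A :=
  match a with
  | Gen e => fE e
  | Idt x => idn D (fO x)
  | Cmp a b => tcmp D (teval a) (teval b)
  end.

Section Evaluation.
Hypothesis f_s : forall e, src D (fE e) = fO (s e).
Hypothesis f_t : forall e, tgt D (fE e) = fO (t e).

Lemma teval_boundary a : twf a ->
  src D (teval a) = fO (tsrc s a) /\ tgt D (teval a) = fO (ttgt t a).
Proof.
elim: a => [e|x|a Ha b Hb] //=; first by rewrite src_idn tgt_idn.
case=> /Ha [? e] [/Hb [e' ?] ab].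
have ? : tgt D (teval a) = src D (teval b) by congruence.
by rewrite src_tcmp // tgt_tcmp.
Qed.

Lemma src_teval a : twf a -> src D (teval a) = fO (tsrc s a).
Proof. by case/teval_boundary. Qed.

Lemma tgt_teval a : twf a -> tgt D (teval a) = fO (ttgt t a).
Proof. by case/teval_boundary. Qed.

Lemma teval_joint a b : twf a -> twf b -> ttgt t a = tsrc s b ->
  tgt D (teval a) = src D (teval b).
Proof. by move=> wa wb e; rewrite tgt_teval // src_teval // e. Qed.

Hypothesis R_eval : forall a b, R a b -> teval a = teval b.

Lemma teq_teval a b : teq s t R a b -> teval a = teval b.
Proof.
elim=> {a b} //=; try by move=> *; congruence.
- by move=> a /teq_twf[w _] _; apply: tcmp_idl; apply: src_teval.
- by move=> a /teq_twf[w _] _; apply: tcmp_idr; apply: tgt_teval.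
- move=> a b c /teq_twf[wa _] _ /teq_twf[wb _] _ /teq_twf[wc _] _ ab bc.
  by apply: tcmpA; apply: teval_joint.
Qed.
End Evaluation.
End WellFormed.

Section PresentedCategory.
Variables (O E : Type) (s t : E -> O).
Variable R : term O E -> term O E -> Prop.
Hypothesis R_src : forall a b, R a b -> tsrc s a = tsrc s b.
Hypothesis R_tgt : forall a b, R a b -> ttgt t a = ttgt t b.
Hypothesis R_wf : forall a b, R a b -> twf s t a /\ twf s t b.
Local Notation C := (presented_cat R_src R_tgt).

Lemma cls_Cmp a b (wa : teq s t R a a) (wb : teq s t R b b) wab :
  ttgt t a = tsrc s b -> cls (t := Cmp a b) wab = tcmp C (cls wa) (cls wb).
Proof.
move=> e; have e' : tgt C (cls wa) = src C (cls wb).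
  by rewrite /= (arr_tgt_cls R_tgt) (arr_src_cls R_src).
by rewrite -(tcmpE e'); symmetry; apply: arr_cmp_cls.
Qed.

Variables (P A : Type) (D : cat_on P A).

(** The uniqueness half of the universal property: a functor commutes with every term former, so it
    is the evaluation of its own values on generators. *)
Lemma presented_teval (fO : O -> P) (fA : arr s t R -> A) a w :
  functor_on C D fO fA ->
  fA (cls (t := a) w) = teval D fO (fun e => fA (cls (teq_gen s t R e))) a.
Proof.
move=> F; elim: a w => [e|x|a Ha b Hb] w /=.
- by rewrite (proof_irrelevance _ w (teq_gen s t R e)).
- by rewrite -(f_idn F) /= /arr_id (proof_irrelevance _ w (teq_id s t R x)).
- have [/= [wa [wb e]] _] := teq_twf R_src R_tgt R_wf w.
  rewrite (cls_Cmp (twf_teq R wa) (twf_teq R wb) w e) (f_tcmp F) ?Ha ?Hb //=.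
  by rewrite (arr_tgt_cls R_tgt) (arr_src_cls R_src).
Qed.

Lemma presented_cat_ext fO (fA gA : arr s t R -> A) :
  functor_on C D fO fA -> functor_on C D fO gA ->
  (forall e, fA (cls (teq_gen s t R e)) = gA (cls (teq_gen s t R e))) ->
  forall q, fA q = gA q.
Proof.
move=> F G e q.
rewrite -(cls_repr (@teq_sym _ _ _ _ _) (@teq_trans _ _ _ _ _) q).
rewrite (presented_teval _ F) (presented_teval _ G).
by congr teval; apply: functional_extensionality.
Qed.
End PresentedCategory.

Section Presented.
Variable P : presentation.

Local Notation heq := (heq (@hrel P)).
Local Notation veq := (veq (@vrel P)).
Local Notation seq := (seq (@hrel P) (@vrel P) (@srel P)).
Local Notation hwf := (twf (@hsrc P) (@htgt P)).
Local Notation vwf := (twf (@vsrc P) (@vtgt P)).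

(** The counterpart of [twf] for 2-cells. Faces of adjacent squares need to match only up to the
    relations on 1-cells, so the congruences [veq] and [heq] occur in the predicate. *)
Fixpoint swf (a : sqterm P) : Prop :=
  match a with
  | SGen _ => True
  | SHId u => vwf u
  | SVId f => hwf f
  | SHCmp a b => swf a /\ swf b /\ veq (sright a) (sleft b)
  | SVCmp a b => swf a /\ swf b /\ heq (sbot a) (stop b)
  end.

Lemma swf_seq a : swf a -> seq a a.
Proof.
elim: a => [e|u|f|a Ha b Hb|a Ha b Hb] /=.
- by move=> _; apply: seq_gen.
- by move=> w; apply: seq_hid; apply: twf_teq.
- by move=> w; apply: seq_vid; apply: twf_teq.
- by case=> /Ha ? [/Hb ? ?]; apply: seq_hcmp.
- by case=> /Ha ? [/Hb ? ?]; apply: seq_vcmp.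
Qed.

Hypothesis hrel_wf : forall a b, @hrel P a b -> hwf a /\ hwf b.
Hypothesis vrel_wf : forall a b, @vrel P a b -> vwf a /\ vwf b.
Hypothesis srel_wf : forall a b, @srel P a b -> swf a /\ swf b.

Lemma heq_wf a b : heq a b -> hwf a /\ hwf b.
Proof. exact: (teq_twf (@hrel_src P) (@hrel_tgt P) hrel_wf). Qed.

Lemma veq_wf a b : veq a b -> vwf a /\ vwf b.
Proof. exact: (teq_twf (@vrel_src P) (@vrel_tgt P) vrel_wf). Qed.

Lemma seq_swf a b : seq a b -> swf a /\ swf b.
Proof.
(* A matching of faces passes to related squares. Symmetry and transitivity have to suffice, since
   the congruences are not reflexive on all terms. *)
have tr (T : Type) (R : T -> T -> Prop) (sym : forall a b, R a b -> R b a)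
    (trans : forall a b c, R a b -> R b c -> R a c) (p p' q q' : T) :
    R p p' -> R q q' -> R p q -> R p' q'.
  by move=> pp qq pq; apply: trans (sym _ _ pp) (trans _ _ _ pq qq).
have trv := tr _ _ (@teq_sym _ _ (@vsrc P) (@vtgt P) (@vrel P))
                   (@teq_trans _ _ (@vsrc P) (@vtgt P) (@vrel P)).
have trh := tr _ _ (@teq_sym _ _ (@hsrc P) (@htgt P) (@hrel P))
                   (@teq_trans _ _ (@hsrc P) (@htgt P) (@hrel P)).
have lid a' : swf a' -> vwf (sleft a') /\ vwf (sright a').
  move/swf_seq=> e; split.
    by case: (veq_wf (seq_left e)).
  by case: (veq_wf (seq_right e)).
have tid a' : swf a' -> hwf (stop a') /\ hwf (sbot a').
  move/swf_seq=> e; split.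
    by case: (heq_wf (seq_top e)).
  by case: (heq_wf (seq_bot e)).
elim=> {a b} /=.
- by [].
- by move=> u v /veq_wf.
- by move=> f g /heq_wf.
- move=> a a' b b' aa [? ?] bb [? ?] e; do !split=> //.
  exact: trv (seq_right aa) (seq_left bb) e.
- move=> a a' b b' aa [? ?] bb [? ?] e; do !split=> //.
  exact: trh (seq_bot aa) (seq_top bb) e.
- by move=> a b _ [? ?].
- by move=> a b c _ [? ?] _ [? ?].
- move=> a aa [w _]; do !split=> //; first by case: (lid a w).
  exact: seq_left.
- move=> a aa [w _]; do !split=> //; first by case: (lid a w).
  exact: seq_right.
- by move=> a b c _ [? _] _ [? _] _ [? _] ? ?.
- move=> a aa [w _]; do !split=> //; first by case: (tid a w).
  exact: seq_top.
- move=> a aa [w _]; do !split=> //; first by case: (tid a w).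
  exact: seq_bot.
- by move=> a b c _ [? _] _ [? _] _ [? _] ? ?.
- move=> u v /veq_wf[? _] /veq_wf[? _] e; do !split=> //.
  by rewrite e; apply: teq_id.
- move=> f g /heq_wf[? _] /heq_wf[? _] e; do !split=> //.
  by rewrite e; apply: teq_id.
- by [].
- move=> a b c d aa [? _] bb [? _] cc [? _] dd [? _] ab cd ac bd.
  (* Interchange composes the faces themselves. Squares that match along one direction have
     composable faces in the other, because the corner objects agree. *)
  have htv (a' c' : sqterm P) :
      heq (sbot a') (stop c') -> vtt (sleft a') = vts (sleft c').
    by move=> e; rewrite -scorner_bl -scorner_tl; apply: heq_src e.
  have htv' (a' c' : sqterm P) :
      heq (sbot a') (stop c') -> vtt (sright a') = vts (sright c').
    by move=> e; rewrite -scorner_br -scorner_tr; apply: heq_tgt e.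
  have vth (a' c' : sqterm P) :
      veq (sright a') (sleft c') -> htt (sbot a') = hts (sbot c').
    by move=> e; rewrite scorner_br scorner_bl; apply: veq_tgt e.
  do !split=> //; apply: teq_cmp => //; first exact: vth.
  exact: htv'.
- exact: srel_wf.
Qed.

Lemma cls_SHCmp a b (wa : seq a a) (wb : seq b b) wab :
  veq (sright a) (sleft b) ->
  cls (t := SHCmp a b) wab = tcmp (pres_hsq P) (cls wa) (cls wb).
Proof.
move=> e; have e' : tgt (pres_hsq P) (cls wa) = src (pres_hsq P) (cls wb).
  rewrite /= (pres_right_cls _ (seq_right wa)) (pres_left_cls _ (seq_left wb)).
  exact: veq_cls_eq.
rewrite -(tcmpE e'); apply: seq_cls_eq; apply: seq_sym.
by apply: seq_hcmp (veq_cls_inj e'); apply: repr_cls.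
Qed.

Lemma cls_SVCmp a b (wa : seq a a) (wb : seq b b) wab :
  heq (sbot a) (stop b) ->
  cls (t := SVCmp a b) wab = tcmp (pres_vsq P) (cls wa) (cls wb).
Proof.
move=> e; have e' : tgt (pres_vsq P) (cls wa) = src (pres_vsq P) (cls wb).
  rewrite /= (pres_bot_cls _ (seq_bot wa)) (pres_top_cls _ (seq_top wb)).
  exact: heq_cls_eq.
rewrite -(tcmpE e'); apply: seq_cls_eq; apply: seq_sym.
by apply: seq_vcmp (heq_cls_inj e'); apply: repr_cls.
Qed.

Variable D : dblcat.

Section Evaluation.
Variables (mo : gob P -> ob D) (mh : ghor P -> hor D) (mv : gver P -> ver D).
Variable ms : gsq P -> sq D.

Definition heval (a : hterm P) : hor D := teval (hcat D) mo mh a.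
Definition veval (a : vterm P) : ver D := teval (vcat D) mo mv a.

Fixpoint seval (a : sqterm P) : sq D :=
  match a with
  | SGen e => ms e
  | SHId u => idn (hsq D) (veval u)
  | SVId f => idn (vsq D) (heval f)
  | SHCmp a b => seval a +h seval b
  | SVCmp a b => seval a +v seval b
  end.

Hypothesis mh_src : forall e, src (hcat D) (mh e) = mo (hsrc e).
Hypothesis mh_tgt : forall e, tgt (hcat D) (mh e) = mo (htgt e).
Hypothesis mv_src : forall e, src (vcat D) (mv e) = mo (vsrc e).
Hypothesis mv_tgt : forall e, tgt (vcat D) (mv e) = mo (vtgt e).
Hypothesis ms_top : forall e, src (vsq D) (ms e) = mh (gtop e).
Hypothesis ms_bot : forall e, tgt (vsq D) (ms e) = mh (gbot e).
Hypothesis ms_left : forall e, src (hsq D) (ms e) = mv (gleft e).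
Hypothesis ms_right : forall e, tgt (hsq D) (ms e) = mv (gright e).
Hypothesis hrel_eval : forall a b, @hrel P a b -> heval a = heval b.
Hypothesis vrel_eval : forall a b, @vrel P a b -> veval a = veval b.
Hypothesis srel_eval : forall a b, @srel P a b -> seval a = seval b.

Lemma heq_heval a b : heq a b -> heval a = heval b.
Proof.
exact: (teq_teval (@hrel_src P) (@hrel_tgt P) hrel_wf mh_src mh_tgt hrel_eval).
Qed.

Lemma veq_veval a b : veq a b -> veval a = veval b.
Proof.
exact: (teq_teval (@vrel_src P) (@vrel_tgt P) vrel_wf mv_src mv_tgt vrel_eval).
Qed.

Lemma hs_heval a : hwf a -> src (hcat D) (heval a) = mo (hts a).
Proof. by move=> w; apply: (src_teval mh_src mh_tgt). Qed.
Lemma ht_heval a : hwf a -> tgt (hcat D) (heval a) = mo (htt a).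
Proof. by move=> w; apply: (tgt_teval mh_src mh_tgt). Qed.
Lemma vs_veval a : vwf a -> src (vcat D) (veval a) = mo (vts a).
Proof. by move=> w; apply: (src_teval mv_src mv_tgt). Qed.
Lemma vt_veval a : vwf a -> tgt (vcat D) (veval a) = mo (vtt a).
Proof. by move=> w; apply: (tgt_teval mv_src mv_tgt). Qed.

Lemma seval_boundary a : swf a ->
  (src (vsq D) (seval a) = heval (stop a) /\
   tgt (vsq D) (seval a) = heval (sbot a)) /\
  (src (hsq D) (seval a) = veval (sleft a) /\
   tgt (hsq D) (seval a) = veval (sright a)).
Proof.
elim: a => [e|u|f|a Ha b Hb|a Ha b Hb] /=.
- by move=> _; rewrite ms_top ms_bot ms_left ms_right.
- by move=> w; rewrite top_Id bot_Id src_idn tgt_idn vs_veval // vt_veval.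
- by move=> w; rewrite left_Id right_Id src_idn tgt_idn hs_heval // ht_heval.
- case=> /Ha[[ta ba] [la ra]] [/Hb[[tb bb] [lb rb]] /veq_veval e].
  have {}e : tgt (hsq D) (seval a) = src (hsq D) (seval b) by congruence.
  by rewrite src_tcmp // tgt_tcmp // top_tcmp // bot_tcmp // ta tb ba bb.
- case=> /Ha[[ta ba] [la ra]] [/Hb[[tb bb] [lb rb]] /heq_heval e].
  have {}e : tgt (vsq D) (seval a) = src (vsq D) (seval b) by congruence.
  by rewrite src_tcmp // tgt_tcmp // left_tcmp // right_tcmp // la lb ra rb.
Qed.

Lemma top_seval a : swf a -> src (vsq D) (seval a) = heval (stop a).
Proof. by case/seval_boundary=> [[]]. Qed.
Lemma bot_seval a : swf a -> tgt (vsq D) (seval a) = heval (sbot a).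
Proof. by case/seval_boundary=> [[]]. Qed.
Lemma left_seval a : swf a -> src (hsq D) (seval a) = veval (sleft a).
Proof. by case/seval_boundary=> [_ []]. Qed.
Lemma right_seval a : swf a -> tgt (hsq D) (seval a) = veval (sright a).
Proof. by case/seval_boundary=> [_ []]. Qed.

Lemma seval_hjoint a b : swf a -> swf b -> veq (sright a) (sleft b) ->
  tgt (hsq D) (seval a) = src (hsq D) (seval b).
Proof. by move=> wa wb /veq_veval; rewrite right_seval // left_seval. Qed.

Lemma seval_vjoint a b : swf a -> swf b -> heq (sbot a) (stop b) ->
  tgt (vsq D) (seval a) = src (vsq D) (seval b).
Proof. by move=> wa wb /heq_heval; rewrite bot_seval // top_seval. Qed.

(** Soundness: each closure rule of [seq] becomes a law of the double category [D], and [srel_eval]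
    covers the defining relations. Well-formedness supplies the composability that the total laws
    ask for. *)
Lemma seq_seval a b : seq a b -> seval a = seval b.
Proof.
elim=> {a b} //=; try by move=> *; congruence.
- by move=> u v /veq_veval ->.
- by move=> f g /heq_heval ->.
- by move=> a /seq_swf[w _] _; apply: tcmp_idl; apply: left_seval.
- by move=> a /seq_swf[w _] _; apply: tcmp_idr; apply: right_seval.
- move=> a b c /seq_swf[wa _] _ /seq_swf[wb _] _ /seq_swf[wc _] _ ab bc.
  by apply: tcmpA; apply: seval_hjoint.
- by move=> a /seq_swf[w _] _; apply: tcmp_idl; apply: top_seval.
- by move=> a /seq_swf[w _] _; apply: tcmp_idr; apply: bot_seval.
- move=> a b c /seq_swf[wa _] _ /seq_swf[wb _] _ /seq_swf[wc _] _ ab bc.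
  by apply: tcmpA; apply: seval_vjoint.
- move=> u v /veq_wf[wu _] /veq_wf[wv _] e; rewrite /veval /=.
  by apply: Id_tcmpv; rewrite vt_veval // vs_veval // e.
- move=> u v /heq_wf[wu _] /heq_wf[wv _] e; rewrite /heval /=.
  by apply: Id_tcmph; rewrite ht_heval // hs_heval // e.
- by move=> x; apply: Id_Id.
- move=> a b c d /seq_swf[wa _] _ /seq_swf[wb _] _ /seq_swf[wc _] _.
  move=> /seq_swf[wd _] _ ab cd ac bd.
  apply: interchange_tcmp; [exact: seval_hjoint | exact: seval_hjoint| exact:
    seval_vjoint | exact: seval_vjoint].
Qed.

(** The existence half of the universal property. A class is evaluated at its chosen representative,
    and soundness makes the choice irrelevant. *)
Definition presented_lift : dblfun (presented P) D.
Proof.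
refine (@DblFun (presented P) D mo (fun q => heval (repr q))
  (fun q => veval (repr q)) (fun q => seval (repr q)) _ _ _ _).
- split=> [f|f|x|f g e e'].
  + by apply: hs_heval; case: (heq_wf (repr_wf f)).
  + by apply: ht_heval; case: (heq_wf (repr_wf f)).
  + exact: heq_heval (repr_cls _).
  + by rewrite (heq_heval (repr_cls _)) tcmpE.
- split=> [f|f|x|f g e e'].
  + by apply: vs_veval; case: (veq_wf (repr_wf f)).
  + by apply: vt_veval; case: (veq_wf (repr_wf f)).
  + exact: veq_veval (repr_cls _).
  + by rewrite (veq_veval (repr_cls _)) tcmpE.
- split=> [a|a|u|a b e e'].
  + rewrite left_seval; first by case: (seq_swf (repr_wf a)).
    by apply: veq_veval; apply: teq_sym; apply: repr_cls.
  + rewrite right_seval; first by case: (seq_swf (repr_wf a)).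
    by apply: veq_veval; apply: teq_sym; apply: repr_cls.
  + exact: seq_seval (repr_cls _).
  + by rewrite (seq_seval (repr_cls _)) tcmpE.
- split=> [a|a|u|a b e e'].
  + rewrite top_seval; first by case: (seq_swf (repr_wf a)).
    by apply: heq_heval; apply: teq_sym; apply: repr_cls.
  + rewrite bot_seval; first by case: (seq_swf (repr_wf a)).
    by apply: heq_heval; apply: teq_sym; apply: repr_cls.
  + exact: seq_seval (repr_cls _).
  + by rewrite (seq_seval (repr_cls _)) tcmpE.
Defined.

Lemma presented_lift_hor e :
  fhor presented_lift (cls (teq_gen _ _ _ e)) = mh e.
Proof. exact: heq_heval (repr_cls _). Qed.
Lemma presented_lift_ver e :
  fver presented_lift (cls (teq_gen _ _ _ e)) = mv e.
Proof. exact: veq_veval (repr_cls _). Qed.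
Lemma presented_lift_sq e :
  fsq presented_lift (cls (seq_gen _ _ _ e)) = ms e.
Proof. exact: seq_seval (repr_cls _). Qed.
End Evaluation.

Lemma presented_seval (F : dblfun (presented P) D) a w :
  fsq F (cls (t := a) w)
  = seval (fob F) (fun e => fhor F (cls (teq_gen _ _ _ e)))
      (fun e => fver F (cls (teq_gen _ _ _ e)))
      (fun e => fsq F (cls (seq_gen _ _ _ e))) a.
Proof.
have [wa _] := seq_swf w.
elim: a w wa => [e|u|f|a Ha b Hb|a Ha b Hb] w /= wa.
- by rewrite (proof_irrelevance _ w (seq_gen _ _ _ e)).
- have wu := twf_teq (@vrel P) wa.
  rewrite /veval -(presented_teval vrel_wf wu (fun_vcat F)).
  rewrite -(f_idn (fun_hsq F)); congr fsq; apply: seq_cls_eq.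
  by apply: seq_hid; apply: teq_sym; apply: repr_cls.
- have wf := twf_teq (@hrel P) wa.
  rewrite /heval -(presented_teval hrel_wf wf (fun_hcat F)).
  rewrite -(f_idn (fun_vsq F)); congr fsq; apply: seq_cls_eq.
  by apply: seq_vid; apply: teq_sym; apply: repr_cls.
- case: wa => wa [wb e].
  rewrite (cls_SHCmp (swf_seq wa) (swf_seq wb) w e) (f_tcmp (fun_hsq F)) ?Ha
    ?Hb //=.
  rewrite (pres_right_cls _ (seq_right (swf_seq wa))).
  by rewrite (pres_left_cls _ (seq_left (swf_seq wb))); apply: veq_cls_eq.
- case: wa => wa [wb e].
  rewrite (cls_SVCmp (swf_seq wa) (swf_seq wb) w e) (f_tcmp (fun_vsq F)) ?Ha
    ?Hb //=.
  rewrite (pres_bot_cls _ (seq_bot (swf_seq wa))).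
  by rewrite (pres_top_cls _ (seq_top (swf_seq wb))); apply: heq_cls_eq.
Qed.

Lemma presented_ext (F G : dblfun (presented P) D) :
  (forall x, fob F x = fob G x) ->
  (forall e, fhor F (cls (teq_gen _ _ _ e)) = fhor G (cls (teq_gen _ _ _ e))) ->
  (forall e, fver F (cls (teq_gen _ _ _ e)) = fver G (cls (teq_gen _ _ _ e))) ->
  (forall e, fsq F (cls (seq_gen _ _ _ e)) = fsq G (cls (seq_gen _ _ _ e))) ->
  F = G.
Proof.
move=> eo eh ev es.
(* [presented_cat_ext] compares functors with one common object map, so the object maps are
   identified before it is applied. *)
have eo' : fob F = fob G by apply: functional_extensionality.
have Gh := fun_hcat G; have Gv := fun_vcat G; rewrite -eo' in Gh Gv.
apply: dblfun_eq => //.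
- exact: (presented_cat_ext hrel_wf (fun_hcat F) Gh eh).
- exact: (presented_cat_ext vrel_wf (fun_vcat F) Gv ev).
- move=> q; rewrite -(cls_repr (@seq_sym _ _ _ _) (@seq_trans _ _ _ _) q).
  rewrite !presented_seval eo'.
  by congr seval; apply: functional_extensionality.
Qed.
End Presented.

(** * Double functors out of the funny product *)

Section FunnyGenerators.
Variables A B : dblcat.
Local Notation P := (funny_presentation A B).

Lemma funny_hrel_wf a b : @hrel P a b ->
  twf (@hsrc P) (@htgt P) a /\ twf (@hsrc P) (@htgt P) b.
Proof. by case=> * /=; do !split; congr pair. Qed.

Lemma funny_vrel_wf a b : @vrel P a b ->
  twf (@vsrc P) (@vtgt P) a /\ twf (@vsrc P) (@vtgt P) b.
Proof. by case=> * /=; do !split; congr pair. Qed.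

Lemma funny_srel_wf a b : @srel P a b -> swf a /\ swf b.
Proof.
case=> * /=; do !split;
  by match goal with
     | e : _ = _ |- _ => rewrite e; apply: teq_gen
     | _ => apply: teq_gen
     end.
Qed.

Definition hgen (f : funny_hor A B) : hor (funny A B) :=
  cls (@teq_gen _ _ (@hsrc P) (@htgt P) (@hrel P) f).
Definition vgen (u : funny_ver A B) : ver (funny A B) :=
  cls (@teq_gen _ _ (@vsrc P) (@vtgt P) (@vrel P) u).
Definition sgen (a : funny_sq A B) : sq (funny A B) :=
  cls (@seq_gen P (@hrel P) (@vrel P) (@srel P) a).
Definition hR x k : hor (funny A B) := hgen (HR x k).
Definition hL K y : hor (funny A B) := hgen (HL K y).
Definition vR x u : ver (funny A B) := vgen (VR x u).
Definition vL U y : ver (funny A B) := vgen (VL U y).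
Definition sR x w : sq (funny A B) := sgen (SR x w).
Definition sL z y : sq (funny A B) := sgen (SL z y).
Definition sVH U k : sq (funny A B) := sgen (SVH U k).
Definition sHV K u : sq (funny A B) := sgen (SHV K u).

(** This and the following lemmas translate one shape of defining relation each into an equation
    between cells of [funny A B]. Afterwards every law of the generators follows by naming the shape
    and choosing the constructor. *)
Lemma hgen_Idt f x w : @hrel P (Gen f) (Idt x) ->
  cls (t := Gen f) w = idn (hcat (funny A B)) x.
Proof. by move=> r; apply: (@heq_cls_eq P); apply: teq_rel. Qed.

Lemma vgen_Idt u x w : @vrel P (Gen u) (Idt x) ->
  cls (t := Gen u) w = idn (vcat (funny A B)) x.
Proof. by move=> r; apply: (@veq_cls_eq P); apply: teq_rel. Qed.

Lemma hgen_Cmp f g h wf wg wh : @hrel P (Gen f) (Cmp (Gen g) (Gen h)) ->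
  cls (t := Gen f) wf
  = tcmp (hcat (funny A B)) (cls (t := Gen g) wg) (cls (t := Gen h) wh).
Proof.
move=> r; have [_ /= [_ [_ e]]] := funny_hrel_wf r.
have w : heq (@hrel P) (Cmp (Gen g) (Gen h)) (Cmp (Gen g) (Gen h)).
  by apply: teq_cmp.
rewrite -(cls_Cmp (@hrel_src P) (@hrel_tgt P) wg wh w e).
by apply: (@heq_cls_eq P); apply: teq_rel.
Qed.

Lemma vgen_Cmp f g h wf wg wh : @vrel P (Gen f) (Cmp (Gen g) (Gen h)) ->
  cls (t := Gen f) wf
  = tcmp (vcat (funny A B)) (cls (t := Gen g) wg) (cls (t := Gen h) wh).
Proof.
move=> r; have [_ /= [_ [_ e]]] := funny_vrel_wf r.
have w : veq (@vrel P) (Cmp (Gen g) (Gen h)) (Cmp (Gen g) (Gen h)).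
  by apply: teq_cmp.
rewrite -(cls_Cmp (@vrel_src P) (@vrel_tgt P) wg wh w e).
by apply: (@veq_cls_eq P); apply: teq_rel.
Qed.

Lemma sgen_SHId a u w wu : @srel P (SGen a) (SHId (Gen u)) ->
  cls (t := SGen a) w = idn (hsq (funny A B)) (cls (t := Gen u) wu).
Proof.
move=> r; apply: (@seq_cls_eq P); apply: (@seq_trans P _ _ _ _ (SHId (Gen u))).
  exact: seq_rel.
by apply: seq_hid; apply: teq_sym; apply: (repr_cls wu).
Qed.

Lemma sgen_SVId a u w wu : @srel P (SGen a) (SVId (Gen u)) ->
  cls (t := SGen a) w = idn (vsq (funny A B)) (cls (t := Gen u) wu).
Proof.
move=> r; apply: (@seq_cls_eq P); apply: (@seq_trans P _ _ _ _ (SVId (Gen u))).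
  exact: seq_rel.
by apply: seq_vid; apply: teq_sym; apply: (repr_cls wu).
Qed.

Lemma sgen_SHCmp a b c wa wb wc :
  @srel P (SGen a) (SHCmp (SGen b) (SGen c)) ->
  cls (t := SGen a) wa
  = tcmp (hsq (funny A B)) (cls (t := SGen b) wb) (cls (t := SGen c) wc).
Proof.
move=> r; have [_ ww] := funny_srel_wf r; have w := swf_seq ww.
rewrite -(cls_SHCmp wb wc w); first by case: ww => _ [].
by apply: (@seq_cls_eq P); apply: seq_rel.
Qed.

Lemma sgen_SVCmp a b c wa wb wc :
  @srel P (SGen a) (SVCmp (SGen b) (SGen c)) ->
  cls (t := SGen a) wa
  = tcmp (vsq (funny A B)) (cls (t := SGen b) wb) (cls (t := SGen c) wc).
Proof.
move=> r; have [_ ww] := funny_srel_wf r; have w := swf_seq ww.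
rewrite -(cls_SVCmp wb wc w); first by case: ww => _ [].
by apply: (@seq_cls_eq P); apply: seq_rel.
Qed.

Lemma vgen_Cmp2 f g h k :
  @vrel P (Cmp (Gen f) (Gen g)) (Cmp (Gen h) (Gen k)) ->
  tcmp (vcat (funny A B)) (vgen f) (vgen g)
  = tcmp (vcat (funny A B)) (vgen h) (vgen k).
Proof.
move=> r; have [w1 w2] := funny_vrel_wf r.
have [e1 e2] := conj (proj2 (proj2 w1)) (proj2 (proj2 w2)).
rewrite -(cls_Cmp (@vrel_src P) (@vrel_tgt P) _ _ (twf_teq (@vrel P) w1) e1).
rewrite -(cls_Cmp (@vrel_src P) (@vrel_tgt P) _ _ (twf_teq (@vrel P) w2) e2).
by apply: (@veq_cls_eq P); apply: teq_rel.
Qed.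

Lemma sgen_SVCmp2 a b c d :
  @srel P (SVCmp (SGen a) (SGen b)) (SVCmp (SGen c) (SGen d)) ->
  tcmp (vsq (funny A B)) (sgen a) (sgen b)
  = tcmp (vsq (funny A B)) (sgen c) (sgen d).
Proof.
move=> r; have [w1 w2] := funny_srel_wf r.
have [e1 e2] := conj (proj2 (proj2 w1)) (proj2 (proj2 w2)).
rewrite -(cls_SVCmp _ _ (swf_seq w1) e1) -(cls_SVCmp _ _ (swf_seq w2) e2).
by apply: (@seq_cls_eq P); apply: seq_rel.
Qed.

Lemma hsrc_gen f : src (hcat (funny A B)) (hgen f) = funny_hsrc f.
Proof. exact: (@pres_hs P). Qed.
Lemma htgt_gen f : tgt (hcat (funny A B)) (hgen f) = funny_htgt f.
Proof. exact: (@pres_ht P). Qed.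
Lemma vsrc_gen f : src (vcat (funny A B)) (vgen f) = funny_vsrc f.
Proof. exact: (@pres_vs P). Qed.
Lemma vtgt_gen f : tgt (vcat (funny A B)) (vgen f) = funny_vtgt f.
Proof. exact: (@pres_vt P). Qed.
Lemma top_gen a : src (vsq (funny A B)) (sgen a)
  = hgen (funny_top a).
Proof. exact: (@pres_top_cls P). Qed.
Lemma bot_gen a : tgt (vsq (funny A B)) (sgen a)
  = hgen (funny_bot a).
Proof. exact: (@pres_bot_cls P). Qed.
Lemma left_gen a : src (hsq (funny A B)) (sgen a)
  = vgen (funny_left a).
Proof. exact: (@pres_left_cls P). Qed.
Lemma right_gen a : tgt (hsq (funny A B)) (sgen a)
  = vgen (funny_right a).
Proof. exact: (@pres_right_cls P). Qed.

Definition funny_inr (x : ob A) : dblfun B (funny A B).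
Proof.
refine (@DblFun B (funny A B) (fun y => (x, y)) (hR x) (vR x) (sR x) _ _ _ _).
- apply: functor_on_tcmp => *; [exact: hsrc_gen | exact: htgt_gen | |].
    by apply: hgen_Idt; constructor.
  by rewrite -tcmpE; apply: hgen_Cmp; constructor.
- apply: functor_on_tcmp => *; [exact: vsrc_gen | exact: vtgt_gen | |].
    by apply: vgen_Idt; constructor.
  by rewrite -tcmpE; apply: vgen_Cmp; constructor.
- apply: functor_on_tcmp => *; [exact: left_gen | exact: right_gen | |].
    by apply: sgen_SHId; constructor.
  by rewrite -tcmpE; apply: sgen_SHCmp; constructor.
- apply: functor_on_tcmp => *; [exact: top_gen | exact: bot_gen | |].
    by apply: sgen_SVId; constructor.
  by rewrite -tcmpE; apply: sgen_SVCmp; constructor.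
Defined.

Definition funny_inl (y : ob B) : dblfun A (funny A B).
Proof.
refine (@DblFun A (funny A B) (fun x => (x, y)) (fun K => hL K y)
          (fun U => vL U y) (fun z => sL z y) _ _ _ _).
- apply: functor_on_tcmp => *; [exact: hsrc_gen | exact: htgt_gen | |].
    by apply: hgen_Idt; constructor.
  by rewrite -tcmpE; apply: hgen_Cmp; constructor.
- apply: functor_on_tcmp => *; [exact: vsrc_gen | exact: vtgt_gen | |].
    by apply: vgen_Idt; constructor.
  by rewrite -tcmpE; apply: vgen_Cmp; constructor.
- apply: functor_on_tcmp => *; [exact: left_gen | exact: right_gen | |].
    by apply: sgen_SHId; constructor.
  by rewrite -tcmpE; apply: sgen_SHCmp; constructor.
- apply: functor_on_tcmp => *; [exact: top_gen | exact: bot_gen | |].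
    by apply: sgen_SVId; constructor.
  by rewrite -tcmpE; apply: sgen_SVCmp; constructor.
Defined.
End FunnyGenerators.
Arguments funny_inr {A B} x.
Arguments funny_inl {A B} y.

(* A double functor out of [funny A B], in terms of its values on the
   generating cells: the relations say that it restricts to double functors on
   [x # B] and on [A # y], together with the conditions below. *)
Record bifun (A B C : dblcat) := Bifun {
  bR : ob A -> dblfun B C;
  bL : ob B -> dblfun A C;
  bVH : ver A -> hor B -> sq C;
  bHV : hor A -> ver B -> sq C;
  b_ob : forall x y, fob (bL y) x = fob (bR x) y;
  bVH_h : forall U,
    functor_on (hcat B) (hsq C) (fun y => fver (bL y) U) (bVH U);
  bVH_v : forall k,
    functor_on (vcat A) (vsq C) (fun x => fhor (bR x) k) (fun U => bVH U k);
  bHV_v : forall K,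
    functor_on (vcat B) (vsq C) (fun y => fhor (bL y) K) (bHV K);
  bHV_h : forall u,
    functor_on (hcat A) (hsq C) (fun x => fver (bR x) u) (fun K => bHV K u);
  b_swap : forall U u,
    fver (bR (src (vcat A) U)) u *v fver (bL (tgt (vcat B) u)) U
    = fver (bL (src (vcat B) u)) U *v fver (bR (tgt (vcat A) U)) u;
  bVH_nat : forall U w,
    fsq (bR (src (vcat A) U)) w +v bVH U (tgt (vsq B) w)
    = bVH U (src (vsq B) w) +v fsq (bR (tgt (vcat A) U)) w;
  bHV_nat : forall z u,
    bHV (src (vsq A) z) u +v fsq (bL (tgt (vcat B) u)) z
    = fsq (bL (src (vcat B) u)) z +v bHV (tgt (vsq A) z) u
}.

(** The universal instance: currying it gives the unit of the adjunction. *)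
Definition funny_bifun (A B : dblcat) : bifun A B (funny A B).
Proof.
refine (@Bifun A B (funny A B) (@funny_inr A B) (@funny_inl A B) (@sVH A B)
  (@sHV A B)
  _ _ _ _ _ _ _ _) => //=.
- move=> *; apply: functor_on_tcmp => *;
    [exact: left_gen | exact: right_gen | |].
    by apply: sgen_SHId; constructor.
  by rewrite -tcmpE; apply: sgen_SHCmp; constructor.
- move=> *; apply: functor_on_tcmp => *; [exact: top_gen | exact: bot_gen | |].
    by apply: sgen_SVId; constructor.
  by rewrite -tcmpE; apply: sgen_SVCmp; constructor.
- move=> *; apply: functor_on_tcmp => *; [exact: top_gen | exact: bot_gen | |].
    by apply: sgen_SVId; constructor.
  by rewrite -tcmpE; apply: sgen_SVCmp; constructor.
- move=> *; apply: functor_on_tcmp => *;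
    [exact: left_gen | exact: right_gen | |].
    by apply: sgen_SHId; constructor.
  by rewrite -tcmpE; apply: sgen_SHCmp; constructor.
- by move=> U u; apply: vgen_Cmp2; constructor.
- by move=> U w; apply: sgen_SVCmp2; constructor.
- by move=> z u; apply: sgen_SVCmp2; constructor.
Defined.

Section FunnyLift.
Variables (A B C : dblcat) (b : bifun A B C).
Local Notation P := (funny_presentation A B).

(** Reading objects through [bR] is a choice; [b_ob] reconciles it with [bL] wherever a generator
    coming from [A] has to match. *)
Definition lift_ob (p : gob P) : ob C := fob (bR b (fst p)) (snd p).
Definition lift_hor (f : ghor P) : hor C :=
  match f with HR x k => fhor (bR b x) k | HL K y => fhor (bL b y) K end.
Definition lift_ver (u : gver P) : ver C :=
  match u with VR x u => fver (bR b x) u | VL U y => fver (bL b y) U end.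
Definition lift_sq (a : gsq P) : sq C :=
  match a with
  | SR x w => fsq (bR b x) w
  | SL z y => fsq (bL b y) z
  | SVH U k => bVH b U k
  | SHV K u => bHV b K u
  end.

Definition funny_lift_def : dblfun (funny A B) C.
Proof.
refine (@presented_lift P (@funny_hrel_wf A B) (@funny_vrel_wf A B)
  (@funny_srel_wf A B) C lift_ob lift_hor lift_ver lift_sq
  _ _ _ _ _ _ _ _ _ _ _); rewrite /lift_ob.
- by case=> [x k|K y] /=; rewrite ?(f_src (fun_hcat _)) ?b_ob.
- by case=> [x k|K y] /=; rewrite ?(f_tgt (fun_hcat _)) ?b_ob.
- by case=> [x k|K y] /=; rewrite ?(f_src (fun_vcat _)) ?b_ob.
- by case=> [x k|K y] /=; rewrite ?(f_tgt (fun_vcat _)) ?b_ob.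
- case=> [x w|z y|U k|K u] /=; rewrite ?(f_src (fun_vsq _)) //.
    exact: (f_src (bVH_v b k)).
  exact: (f_src (bHV_v b K)).
- case=> [x w|z y|U k|K u] /=; rewrite ?(f_tgt (fun_vsq _)) //.
    exact: (f_tgt (bVH_v b k)).
  exact: (f_tgt (bHV_v b K)).
- case=> [x w|z y|U k|K u] /=; rewrite ?(f_src (fun_hsq _)) //.
    exact: (f_src (bVH_h b U)).
  exact: (f_src (bHV_h b u)).
- case=> [x w|z y|U k|K u] /=; rewrite ?(f_tgt (fun_hsq _)) //.
    exact: (f_tgt (bVH_h b U)).
  exact: (f_tgt (bHV_h b u)).
- move=> f g; case=> [x y|x k k' e|x y|K K' y e];
    rewrite /heval /lift_ob /= ?tcmpE.
  + exact: (f_idn (fun_hcat _)).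
  + exact: (f_tcmp (fun_hcat _)).
  + by rewrite -b_ob; apply: (f_idn (fun_hcat _)).
  + exact: (f_tcmp (fun_hcat _)).
- move=> f g; case=> [x y|x k k' e|x y|K K' y e|U u];
    rewrite /veval /lift_ob /= ?tcmpE.
  + exact: (f_idn (fun_vcat _)).
  + exact: (f_tcmp (fun_vcat _)).
  + by rewrite -b_ob; apply: (f_idn (fun_vcat _)).
  + exact: (f_tcmp (fun_vcat _)).
  + exact: b_swap.
- move=> f g [] *; rewrite /= /heval /veval /= ?tcmpE.
  + exact: (f_idn (fun_hsq _)).
  + exact: (f_idn (fun_vsq _)).
  + exact: (f_tcmp (fun_hsq _)).
  + exact: (f_tcmp (fun_vsq _)).
  + exact: (f_idn (fun_hsq _)).
  + exact: (f_idn (fun_vsq _)).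
  + exact: (f_tcmp (fun_hsq _)).
  + exact: (f_tcmp (fun_vsq _)).
  + exact: (f_idn (bHV_v b _)).
  + exact: (f_tcmp (bHV_v b _)).
  + exact: (f_idn (bHV_h b _)).
  + exact: (f_tcmp (bHV_h b _)).
  + exact: (f_idn (bVH_v b _)).
  + exact: (f_tcmp (bVH_v b _)).
  + exact: (f_idn (bVH_h b _)).
  + exact: (f_tcmp (bVH_h b _)).
  + exact: bVH_nat.
  + exact: bHV_nat.
Defined.

(* Sealed, so that unification never unfolds it into the quotient. *)
Record lifting := Lifting {
  lifting_fun : dblfun (funny A B) C;
  liftingE : lifting_fun = funny_lift_def
}.

Lemma lifting_exists : lifting.
Proof. exact: Lifting eq_refl. Qed.

Definition funny_lift : dblfun (funny A B) C := lifting_fun lifting_exists.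

Lemma funny_liftE : funny_lift = funny_lift_def.
Proof. exact: liftingE. Qed.

Lemma lift_obE x y : fob funny_lift (x, y) = fob (bR b x) y.
Proof. by rewrite funny_liftE. Qed.
Lemma lift_hR x k : fhor funny_lift (hR x k) = fhor (bR b x) k.
Proof. rewrite funny_liftE; exact: presented_lift_hor. Qed.
Lemma lift_hL K y : fhor funny_lift (hL K y) = fhor (bL b y) K.
Proof. rewrite funny_liftE; exact: presented_lift_hor. Qed.
Lemma lift_vR x u : fver funny_lift (vR x u) = fver (bR b x) u.
Proof. rewrite funny_liftE; exact: presented_lift_ver. Qed.
Lemma lift_vL U y : fver funny_lift (vL U y) = fver (bL b y) U.
Proof. rewrite funny_liftE; exact: presented_lift_ver. Qed.
Lemma lift_sR x w : fsq funny_lift (sR x w) = fsq (bR b x) w.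
Proof. rewrite funny_liftE; exact: presented_lift_sq. Qed.
Lemma lift_sL z y : fsq funny_lift (sL z y) = fsq (bL b y) z.
Proof. rewrite funny_liftE; exact: presented_lift_sq. Qed.
Lemma lift_sVH U k : fsq funny_lift (sVH U k) = bVH b U k.
Proof. rewrite funny_liftE; exact: presented_lift_sq. Qed.
Lemma lift_sHV K u : fsq funny_lift (sHV K u) = bHV b K u.
Proof. rewrite funny_liftE; exact: presented_lift_sq. Qed.
End FunnyLift.

(** * Extensionality on the generators of the funny product *)

Section FunnyExt.
Variables A B : dblcat.

(** Stated for a functor on the 1h-cells alone, into any category, in order to apply to a family of
    squares such as [fun K => sHV K u], which is functorial from 1h-cells to squares under
    horizontal composition. [funny_ver_ext] does the same for [fun U => sVH U k]. *)
Lemma funny_hor_ext (O M : Type) (D : cat_on O M) fO gO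
    (fA gA : hor (funny A B) -> M) :
  functor_on (hcat (funny A B)) D fO fA ->
  functor_on (hcat (funny A B)) D gO gA ->
  (forall x y, fO (x, y) = gO (x, y)) ->
  (forall x k, fA (hR x k) = gA (hR x k)) ->
  (forall K y, fA (hL K y) = gA (hL K y)) ->
  forall f, fA f = gA f.
Proof.
move=> F G eo eR eL.
have {}eo : gO = fO by apply: functional_extensionality => -[x y]; rewrite eo.
rewrite eo in G; apply: (presented_cat_ext (@funny_hrel_wf A B) F G).
by case=> [x k|K y]; [apply: eR | apply: eL].
Qed.

Lemma funny_ver_ext (O M : Type) (D : cat_on O M) fO gO
    (fA gA : ver (funny A B) -> M) :
  functor_on (vcat (funny A B)) D fO fA ->
  functor_on (vcat (funny A B)) D gO gA ->
  (forall x y, fO (x, y) = gO (x, y)) ->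
  (forall x k, fA (vR x k) = gA (vR x k)) ->
  (forall K y, fA (vL K y) = gA (vL K y)) ->
  forall f, fA f = gA f.
Proof.
move=> F G eo eR eL.
have {}eo : gO = fO by apply: functional_extensionality => -[x y]; rewrite eo.
rewrite eo in G; apply: (presented_cat_ext (@funny_vrel_wf A B) F G).
by case=> [x k|K y]; [apply: eR | apply: eL].
Qed.

Lemma funny_ext (C : dblcat) (F G : dblfun (funny A B) C) :
  (forall x y, fob F (x, y) = fob G (x, y)) ->
  (forall x k, fhor F (hR x k) = fhor G (hR x k)) ->
  (forall K y, fhor F (hL K y) = fhor G (hL K y)) ->
  (forall x u, fver F (vR x u) = fver G (vR x u)) ->
  (forall U y, fver F (vL U y) = fver G (vL U y)) ->
  (forall x w, fsq F (sR x w) = fsq G (sR x w)) ->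
  (forall z y, fsq F (sL z y) = fsq G (sL z y)) ->
  (forall U k, fsq F (sVH U k) = fsq G (sVH U k)) ->
  (forall K u, fsq F (sHV K u) = fsq G (sHV K u)) ->
  F = G.
Proof.
move=> eo hr hl vr vl sr sl svh shv.
apply: (presented_ext (@funny_hrel_wf A B) (@funny_vrel_wf A B) (@funny_srel_wf
  A B)).
- by case.
- by case=> [x k|K y]; [apply: hr | apply: hl].
- by case=> [x k|K y]; [apply: vr | apply: vl].
- by case=> *; [apply: sr | apply: sl | apply: svh | apply: shv].
Qed.
End FunnyExt.

Section FunnyMapGenerators.
Variables (A A' B B' : dblcat) (F : dblfun A A') (G : dblfun B B').

(** The same seal as for [lifting]: the opaque proof of [mapping_exists] leaves [mappingE] as the
    only access to the quotient. *)
Record mapping := Mapping {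
  mapping_fun : dblfun (funny A B) (funny A' B');
  mappingE : mapping_fun = funny_map F G
}.

Lemma mapping_exists : mapping.
Proof. exact: Mapping eq_refl. Qed.

Definition dmap : dblfun (funny A B) (funny A' B') :=
  mapping_fun mapping_exists.

Lemma dmapE : dmap = funny_map F G.
Proof. exact: mappingE. Qed.

Lemma dmap_ob x y : fob dmap (x, y) = (fob F x, fob G y).
Proof. by rewrite dmapE. Qed.
Lemma dmap_hR x k : fhor dmap (hR x k) = hR (fob F x) (fhor G k).
Proof.
rewrite dmapE.
exact: (@presented_hor_cls (funny_presentation A B)
         (funny_presentation A' B')).
Qed.
Lemma dmap_hL K y : fhor dmap (hL K y) = hL (fhor F K) (fob G y).
Proof.
rewrite dmapE.
exact: (@presented_hor_cls (funny_presentation A B)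
         (funny_presentation A' B')).
Qed.
Lemma dmap_vR x k : fver dmap (vR x k) = vR (fob F x) (fver G k).
Proof.
rewrite dmapE.
exact: (@presented_ver_cls (funny_presentation A B)
         (funny_presentation A' B')).
Qed.
Lemma dmap_vL K y : fver dmap (vL K y) = vL (fver F K) (fob G y).
Proof.
rewrite dmapE.
exact: (@presented_ver_cls (funny_presentation A B)
         (funny_presentation A' B')).
Qed.
Lemma dmap_sR x w : fsq dmap (sR x w) = sR (fob F x) (fsq G w).
Proof.
rewrite dmapE.
exact: (@presented_sq_cls (funny_presentation A B)
         (funny_presentation A' B')).
Qed.
Lemma dmap_sL z y : fsq dmap (sL z y) = sL (fsq F z) (fob G y).
Proof.
rewrite dmapE.
exact: (@presented_sq_cls (funny_presentation A B)
         (funny_presentation A' B')).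
Qed.
Lemma dmap_sVH U k : fsq dmap (sVH U k) = sVH (fver F U) (fhor G k).
Proof.
rewrite dmapE.
exact: (@presented_sq_cls (funny_presentation A B)
         (funny_presentation A' B')).
Qed.
Lemma dmap_sHV K u : fsq dmap (sHV K u) = sHV (fhor F K) (fver G u).
Proof.
rewrite dmapE.
exact: (@presented_sq_cls (funny_presentation A B)
         (funny_presentation A' B')).
Qed.
End FunnyMapGenerators.


Definition liftE := (lift_obE, lift_hR, lift_hL, lift_vR, lift_vL, lift_sR,
  lift_sL, lift_sVH, lift_sHV).
Definition mapE := (dmap_ob, dmap_hR, dmap_hL, dmap_vR, dmap_vL, dmap_sR,
  dmap_sL, dmap_sVH, dmap_sHV).
(** * The internal hom *)

Section InternalHom.
Variables B C : dblcat.

(* Horizontal unnatural transformations: [h0 y] is alpha(y), [h1 u] is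
   alpha^u. *)
Record htrans := HTrans {
  hs : dblfun B C;
  ht : dblfun B C;
  h0 : ob B -> hor C;
  h1 : ver B -> sq C;
  h_fun : functor_on (vcat B) (vsq C) h0 h1;
  h0_src : forall y, src (hcat C) (h0 y) = fob hs y;
  h0_tgt : forall y, tgt (hcat C) (h0 y) = fob ht y;
  h1_left : forall u, src (hsq C) (h1 u) = fver hs u;
  h1_right : forall u, tgt (hsq C) (h1 u) = fver ht u
}.

(* Vertical strict transformations: [v0 y] is alpha_0(y), [v1 k] is
   (alpha_0)_k. *)
Record vtrans := VTrans {
  vs : dblfun B C;
  vt : dblfun B C;
  v0 : ob B -> ver C;
  v1 : hor B -> sq C;
  v_fun : functor_on (hcat B) (hsq C) v0 v1;
  v0_src : forall y, src (vcat C) (v0 y) = fob vs y;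
  v0_tgt : forall y, tgt (vcat C) (v0 y) = fob vt y;
  v1_top : forall k, src (vsq C) (v1 k) = fhor vs k;
  v1_bot : forall k, tgt (vsq C) (v1 k) = fhor vt k;
  v0_nat : forall u,
    fver vs u *v v0 (tgt (vcat B) u) = v0 (src (vcat B) u) *v fver vt u;
  v1_nat : forall w,
    fsq vs w +v v1 (tgt (vsq B) w) = v1 (src (vsq B) w) +v fsq vt w
}.

(** The four faces are fields, so that taking a face of a composite is a projection; the corner
    conditions then become equations between double functors. *)
Record tsq := TSq {
  t_top : htrans;
  t_bot : htrans;
  t_left : vtrans;
  t_right : vtrans;
  t0 : ob B -> sq C;
  t_tl : hs t_top = vs t_left;
  t_tr : ht t_top = vs t_right;
  t_bl : hs t_bot = vt t_left;
  t_br : ht t_bot = vt t_right;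
  t0_top : forall y, src (vsq C) (t0 y) = h0 t_top y;
  t0_bot : forall y, tgt (vsq C) (t0 y) = h0 t_bot y;
  t0_left : forall y, src (hsq C) (t0 y) = v0 t_left y;
  t0_right : forall y, tgt (hsq C) (t0 y) = v0 t_right y;
  t0_nat : forall u,
    h1 t_top u +v t0 (tgt (vcat B) u) = t0 (src (vcat B) u) +v h1 t_bot u
}.

(** The arrows of a [cat_on] form one type, so the types of the components do not mention the end
    functors; equality of transformations is componentwise, without transport. *)
Lemma htrans_eq (a b : htrans) : hs a = hs b -> ht a = ht b ->
  (forall y, h0 a y = h0 b y) -> (forall u, h1 a u = h1 b u) -> a = b.
Proof.
case: a => s t a0 a1 ? ? ? ? ?; case: b => s' t' b0 b1 ? ? ? ? ? /= es et.
move=> /functional_extensionality e0 /functional_extensionality e1.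
by subst; f_equal; apply: proof_irrelevance.
Qed.

Lemma vtrans_eq (a b : vtrans) : vs a = vs b -> vt a = vt b ->
  (forall y, v0 a y = v0 b y) -> (forall k, v1 a k = v1 b k) -> a = b.
Proof.
case: a => s t a0 a1 ? ? ? ? ? ? ?;
  case: b => s' t' b0 b1 ? ? ? ? ? ? ? /= es et.
move=> /functional_extensionality e0 /functional_extensionality e1.
by subst; f_equal; apply: proof_irrelevance.
Qed.

Lemma tsq_eq (a b : tsq) : t_top a = t_top b -> t_bot a = t_bot b ->
  t_left a = t_left b -> t_right a = t_right b ->
  (forall y, t0 a y = t0 b y) -> a = b.
Proof.
case: a => ? ? ? ? a0 ? ? ? ? ? ? ? ? ?;
  case: b => ? ? ? ? b0 ? ? ? ? ? ? ? ? ? /=.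
move=> ? ? ? ? /functional_extensionality ?.
by subst; f_equal; apply: proof_irrelevance.
Qed.

Lemma h0_joint a b : ht a = hs b ->
  forall y, tgt (hcat C) (h0 a y) = src (hcat C) (h0 b y).
Proof. by move=> e y; rewrite h0_tgt h0_src e. Qed.
Lemma h1_joint a b : ht a = hs b ->
  forall u, tgt (hsq C) (h1 a u) = src (hsq C) (h1 b u).
Proof. by move=> e y; rewrite h1_right h1_left e. Qed.
Lemma v0_joint a b : vt a = vs b ->
  forall y, tgt (vcat C) (v0 a y) = src (vcat C) (v0 b y).
Proof. by move=> e y; rewrite v0_tgt v0_src e. Qed.
Lemma v1_joint a b : vt a = vs b ->
  forall k, tgt (vsq C) (v1 a k) = src (vsq C) (v1 b k).
Proof. by move=> e y; rewrite v1_bot v1_top e. Qed.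

Definition hid (F : dblfun B C) : htrans.
Proof.
refine (@HTrans F F (fun y => idn (hcat C) (fob F y))
          (fun u => idn (hsq C) (fver F u)) _ _ _ _ _) => *.
- apply: functor_on_tcmp => *.
  + by rewrite top_Id (f_src (fun_vcat F)).
  + by rewrite bot_Id (f_tgt (fun_vcat F)).
  + by rewrite (f_idn (fun_vcat F)) Id_Id.
  + rewrite (f_tcmp (fun_vcat F)) // Id_tcmpv //.
    by rewrite (f_src (fun_vcat F)) (f_tgt (fun_vcat F)); congr fob.
- by rewrite src_idn.
- by rewrite tgt_idn.
- by rewrite src_idn.
- by rewrite tgt_idn.
Defined.

Definition hcomp (a b : htrans) (e : ht a = hs b) : htrans.
Proof.
refine (@HTrans (hs a) (ht b) (fun y => h0 a y *h h0 b y)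
          (fun u => h1 a u +h h1 b u) _ _ _ _ _);
  have j0 := h0_joint e; have j1 := h1_joint e => *.
- apply: functor_on_tcmp => *.
  + by rewrite top_tcmp // !(f_src (h_fun _)).
  + by rewrite bot_tcmp // !(f_tgt (h_fun _)).
  + by rewrite Id_tcmph // !(f_idn (h_fun _)).
  + rewrite !(f_tcmp (h_fun _)) // interchange_tcmp //.
      by rewrite (f_src (h_fun _)) (f_tgt (h_fun _)); congr h0.
    by rewrite (f_src (h_fun _)) (f_tgt (h_fun _)); congr h0.
- by rewrite src_tcmp // h0_src.
- by rewrite tgt_tcmp // h0_tgt.
- by rewrite src_tcmp // h1_left.
- by rewrite tgt_tcmp // h1_right.
Defined.

Definition vid (F : dblfun B C) : vtrans.
Proof.
refine (@VTrans F F (fun y => idn (vcat C) (fob F y))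
          (fun k => idn (vsq C) (fhor F k)) _ _ _ _ _ _ _) => *.
- apply: functor_on_tcmp => *.
  + by rewrite left_Id (f_src (fun_hcat F)).
  + by rewrite right_Id (f_tgt (fun_hcat F)).
  + by rewrite (f_idn (fun_hcat F)) Id_Id.
  + rewrite (f_tcmp (fun_hcat F)) // Id_tcmph //.
    by rewrite (f_src (fun_hcat F)) (f_tgt (fun_hcat F)); congr fob.
- by rewrite src_idn.
- by rewrite tgt_idn.
- by rewrite src_idn.
- by rewrite tgt_idn.
- by rewrite tcmp_idl ?tcmp_idr ?(f_src (fun_vcat F)) ?(f_tgt (fun_vcat F)).
- by rewrite tcmp_idl ?tcmp_idr ?(f_src (fun_vsq F)) ?(f_tgt (fun_vsq F)).
Defined.

Definition vcomp (a b : vtrans) (e : vt a = vs b) : vtrans.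
Proof.
refine (@VTrans (vs a) (vt b) (fun y => v0 a y *v v0 b y)
          (fun k => v1 a k +v v1 b k) _ _ _ _ _ _ _);
  have j0 := v0_joint e; have j1 := v1_joint e => *.
- apply: functor_on_tcmp => *.
  + by rewrite left_tcmp // !(f_src (v_fun _)).
  + by rewrite right_tcmp // !(f_tgt (v_fun _)).
  + by rewrite Id_tcmpv // !(f_idn (v_fun _)).
  + rewrite !(f_tcmp (v_fun _)) // interchange_tcmp //.
      by rewrite (f_src (v_fun _)) (f_tgt (v_fun _)); congr v0.
    by rewrite (f_src (v_fun _)) (f_tgt (v_fun _)); congr v0.
- by rewrite src_tcmp // v0_src.
- by rewrite tgt_tcmp // v0_tgt.
- by rewrite src_tcmp // v1_top.
- by rewrite tgt_tcmp // v1_bot.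
(* The image of the 1v-cell slides first past [a] and then past [b], with reassociations in
   between. *)
- rewrite -tcmpA // ?v0_nat ?v0_src ?(f_tgt (fun_vcat _)) //.
  rewrite tcmpA ?v0_tgt ?v0_src ?(f_src (fun_vcat _)) ?(f_tgt (fun_vcat _)) ?e
    //.
  rewrite v0_nat tcmpA ?v0_tgt ?v0_src ?(f_src (fun_vcat _)) ?e //.
- rewrite -tcmpA // ?v1_nat ?v1_top ?(f_tgt (fun_vsq _)) //.
  rewrite tcmpA ?v1_bot ?v1_top ?(f_src (fun_vsq _)) ?(f_tgt (fun_vsq _)) ?e //.
  rewrite v1_nat tcmpA ?v1_bot ?v1_top ?(f_src (fun_vsq _)) ?e //.
Defined.

Definition hom_hcat : cat_on (dblfun B C) htrans.
Proof.
refine (@CatOn _ _ hs ht hid hcomp _ _ _ _ _ _ _) => //.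
- move=> f e; apply: htrans_eq => // *; apply: tcmp_idl.
    exact: h0_src.
  exact: h1_left.
- move=> f e; apply: htrans_eq => // *; apply: tcmp_idr.
    exact: h0_tgt.
  exact: h1_right.
- move=> f g h fg gh e e'; apply: htrans_eq => //= *; apply: tcmpA;
    by [apply: h0_joint | apply: h1_joint].
Defined.

Definition hom_vcat : cat_on (dblfun B C) vtrans.
Proof.
refine (@CatOn _ _ vs vt vid vcomp _ _ _ _ _ _ _) => //.
- move=> f e; apply: vtrans_eq => // *; apply: tcmp_idl.
    exact: v0_src.
  exact: v1_top.
- move=> f e; apply: vtrans_eq => // *; apply: tcmp_idr.
    exact: v0_tgt.
  exact: v1_bot.
- move=> f g h fg gh e e'; apply: vtrans_eq => //= *; apply: tcmpA;
    by [apply: v0_joint | apply: v1_joint].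
Defined.

Definition thid (a : vtrans) : tsq.
Proof.
refine (@TSq (hid (vs a)) (hid (vt a)) a a (fun y => idn (hsq C) (v0 a y))
  _ _ _ _ _ _ _ _ _) => //= *.
- by rewrite top_Id v0_src.
- by rewrite bot_Id v0_tgt.
- by rewrite src_idn.
- by rewrite tgt_idn.
- rewrite -!Id_tcmpv ?v0_nat //.
  + by rewrite (f_tgt (fun_vcat _)) v0_src.
  + by rewrite (f_src (fun_vcat _)) v0_tgt.
Defined.

Definition tvid (a : htrans) : tsq.
Proof.
refine (@TSq a a (vid (hs a)) (vid (ht a)) (fun y => idn (vsq C) (h0 a y))
  _ _ _ _ _ _ _ _ _) => //= *.
- by rewrite src_idn.
- by rewrite tgt_idn.
- by rewrite left_Id h0_src.
- by rewrite right_Id h0_tgt.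
- by rewrite tcmp_idl ?tcmp_idr ?(f_src (h_fun _)) ?(f_tgt (h_fun _)).
Defined.

Lemma t_top_joint a b : t_right a = t_left b -> ht (t_top a) = hs (t_top b).
Proof. by move=> e; rewrite t_tr t_tl e. Qed.
Lemma t_bot_joint a b : t_right a = t_left b -> ht (t_bot a) = hs (t_bot b).
Proof. by move=> e; rewrite t_br t_bl e. Qed.
Lemma t_left_joint a b : t_bot a = t_top b -> vt (t_left a) = vs (t_left b).
Proof. by move=> e; rewrite -t_bl -t_tl e. Qed.
Lemma t_right_joint a b : t_bot a = t_top b -> vt (t_right a) = vs (t_right b).
Proof. by move=> e; rewrite -t_br -t_tr e. Qed.

Lemma t0_hjoint a b : t_right a = t_left b ->
  forall y, tgt (hsq C) (t0 a y) = src (hsq C) (t0 b y).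
Proof. by move=> e y; rewrite t0_right t0_left e. Qed.
Lemma t0_vjoint a b : t_bot a = t_top b ->
  forall y, tgt (vsq C) (t0 a y) = src (vsq C) (t0 b y).
Proof. by move=> e y; rewrite t0_bot t0_top e. Qed.

Definition thcomp (a b : tsq) (e : t_right a = t_left b) : tsq.
Proof.
refine (@TSq (hcomp (t_top_joint e)) (hcomp (t_bot_joint e)) (t_left a)
  (t_right b)
  (fun y => t0 a y +h t0 b y) _ _ _ _ _ _ _ _ _);
  have jt := t_top_joint e; have jb := t_bot_joint e;
    have j := t0_hjoint e => //= *.
- exact: t_tl.
- exact: t_tr.
- exact: t_bl.
- exact: t_br.
- by rewrite top_tcmp // !t0_top.
- by rewrite bot_tcmp // !t0_bot.
- by rewrite src_tcmp // t0_left.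
- by rewrite tgt_tcmp // t0_right.
(* Interchange splits the equation into the naturality of [a] on the left and that of [b] on the
   right. *)
- rewrite !interchange_tcmp //; try exact: h1_joint.
  all: by rewrite ?t0_nat ?t0_bot ?t0_top ?(f_src (h_fun _)) ?(f_tgt (h_fun _)).
Defined.

Definition tvcomp (a b : tsq) (e : t_bot a = t_top b) : tsq.
Proof.
refine (@TSq (t_top a) (t_bot b) (vcomp (t_left_joint e)) (vcomp (t_right_joint
  e))
  (fun y => t0 a y +v t0 b y) _ _ _ _ _ _ _ _ _);
  have jl := t_left_joint e; have jr := t_right_joint e;
    have j := t0_vjoint e => //= *.
- exact: t_tl.
- exact: t_tr.
- exact: t_bl.
- exact: t_br.
- by rewrite src_tcmp // t0_top.
- by rewrite tgt_tcmp // t0_bot.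
- by rewrite left_tcmp // !t0_left.
- by rewrite right_tcmp // !t0_right.
- rewrite -tcmpA // ?t0_nat ?t0_top ?(f_tgt (h_fun _)) //.
  rewrite tcmpA ?t0_bot ?t0_top ?(f_src (h_fun _)) ?(f_tgt (h_fun _)) ?e //.
  by rewrite t0_nat tcmpA ?t0_bot ?t0_top ?(f_src (h_fun _)) ?e.
Defined.

Definition hom_hsq : cat_on vtrans tsq.
Proof.
refine (@CatOn _ _ t_left t_right thid thcomp _ _ _ _ _ _ _) => //.
- move=> f e; apply: tsq_eq => //= [||y].
  + apply: htrans_eq => //= *; [by rewrite t_tl|..]; apply: tcmp_idl.
      by rewrite h0_src t_tl.
    by rewrite h1_left t_tl.
  + apply: htrans_eq => //= *; [by rewrite t_bl|..]; apply: tcmp_idl.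
      by rewrite h0_src t_bl.
    by rewrite h1_left t_bl.
  + by apply: tcmp_idl; apply: t0_left.
- move=> f e; apply: tsq_eq => //= [||y].
  + apply: htrans_eq => //= *; [by rewrite t_tr|..]; apply: tcmp_idr.
      by rewrite h0_tgt t_tr.
    by rewrite h1_right t_tr.
  + apply: htrans_eq => //= *; [by rewrite t_br|..]; apply: tcmp_idr.
      by rewrite h0_tgt t_br.
    by rewrite h1_right t_br.
  + by apply: tcmp_idr; apply: t0_right.
- move=> f g h fg gh e e'; apply: tsq_eq => //= [||y].
  + apply: htrans_eq => //= *; apply: tcmpA;
      by (apply: h0_joint || apply: h1_joint); apply: t_top_joint.
  + apply: htrans_eq => //= *; apply: tcmpA;
      by (apply: h0_joint || apply: h1_joint); apply: t_bot_joint.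
  + by apply: tcmpA; apply: t0_hjoint.
Defined.

Definition hom_vsq : cat_on htrans tsq.
Proof.
refine (@CatOn _ _ t_top t_bot tvid tvcomp _ _ _ _ _ _ _) => //.
- move=> f e; apply: tsq_eq => //= [||y].
  + apply: vtrans_eq => //= *; [exact: t_tl|..]; apply: tcmp_idl.
      by rewrite v0_src t_tl.
    by rewrite v1_top t_tl.
  + apply: vtrans_eq => //= *; [exact: t_tr|..]; apply: tcmp_idl.
      by rewrite v0_src t_tr.
    by rewrite v1_top t_tr.
  + by apply: tcmp_idl; apply: t0_top.
- move=> f e; apply: tsq_eq => //= [||y].
  + apply: vtrans_eq => //= *; [exact: t_bl|..]; apply: tcmp_idr.
      by rewrite v0_tgt t_bl.
    by rewrite v1_bot t_bl.
  + apply: vtrans_eq => //= *; [exact: t_br|..]; apply: tcmp_idr.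
      by rewrite v0_tgt t_br.
    by rewrite v1_bot t_br.
  + by apply: tcmp_idr; apply: t0_bot.
- move=> f g h fg gh e e'; apply: tsq_eq => //= [||y].
  + apply: vtrans_eq => //= *; apply: tcmpA;
      by (apply: v0_joint || apply: v1_joint); apply: t_left_joint.
  + apply: vtrans_eq => //= *; apply: tcmpA;
      by (apply: v0_joint || apply: v1_joint); apply: t_right_joint.
  + by apply: tcmpA; apply: t0_vjoint.
Defined.

Definition dhom : dblcat.
Proof.
refine (@DblCat (dblfun B C) htrans vtrans tsq hom_hcat hom_vcat hom_hsq
  hom_vsq t_tl t_tr t_bl t_br _ _ _ _ _ _ _ _ _ _ _ _) => //.
- by move=> a b e e'; apply: htrans_eq.
- by move=> a b e e'; apply: htrans_eq.
- by move=> a b e e'; apply: vtrans_eq.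
- by move=> a b e e'; apply: vtrans_eq.
- move=> u v e e'; apply: tsq_eq => //= [||y]; try exact: vtrans_eq.
  by apply: Id_tcmpv; apply: v0_joint.
- move=> u v e e'; apply: tsq_eq => //= [||y]; try exact: htrans_eq.
  by apply: Id_tcmph; apply: h0_joint.
- by move=> x; apply: tsq_eq => //= y; apply: Id_Id.
- move=> a b c d ab cd ac bd e e'; apply: tsq_eq => //= [||||y];
    try exact: htrans_eq; try exact: vtrans_eq.
  by apply: interchange_tcmp; (apply: t0_hjoint || apply: t0_vjoint).
Defined.
End InternalHom.

(** * Whiskering with a double functor *)

Section Whiskering.
Variables (A B C : dblcat).

Definition hpost (h : dblfun B C) (a : htrans A B) : htrans A C.
Proof.
refine (@HTrans A C (dblfun_comp h (hs a)) (dblfun_comp h (ht a))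
  (fun x => fhor h (h0 a x)) (fun u => fsq h (h1 a u))
  (functor_on_comp (fun_vsq h) (h_fun a)) _ _ _ _) => * /=.
- by rewrite (f_src (fun_hcat h)) h0_src.
- by rewrite (f_tgt (fun_hcat h)) h0_tgt.
- by rewrite (f_src (fun_hsq h)) h1_left.
- by rewrite (f_tgt (fun_hsq h)) h1_right.
Defined.

Definition vpost (h : dblfun B C) (a : vtrans A B) : vtrans A C.
Proof.
refine (@VTrans A C (dblfun_comp h (vs a)) (dblfun_comp h (vt a))
  (fun x => fver h (v0 a x)) (fun k => fsq h (v1 a k))
  (functor_on_comp (fun_hsq h) (v_fun a)) _ _ _ _ _ _) => * /=.
- by rewrite (f_src (fun_vcat h)) v0_src.
- by rewrite (f_tgt (fun_vcat h)) v0_tgt.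
- by rewrite (f_src (fun_vsq h)) v1_top.
- by rewrite (f_tgt (fun_vsq h)) v1_bot.
- rewrite -!(f_tcmp (fun_vcat h)) ?v0_nat //.
    by rewrite (f_tgt (fun_vcat _)) v0_src.
  by rewrite (f_src (fun_vcat _)) v0_tgt.
- rewrite -!(f_tcmp (fun_vsq h)) ?v1_nat //.
    by rewrite (f_tgt (fun_vsq _)) v1_top.
  by rewrite (f_src (fun_vsq _)) v1_bot.
Defined.

Definition tpost (h : dblfun B C) (a : tsq A B) : tsq A C.
Proof.
refine (@TSq A C (hpost h (t_top a)) (hpost h (t_bot a))
  (vpost h (t_left a)) (vpost h (t_right a)) (fun x => fsq h (t0 a x))
  _ _ _ _ _ _ _ _ _) => * /=.
- by rewrite t_tl.
- by rewrite t_tr.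
- by rewrite t_bl.
- by rewrite t_br.
- by rewrite (f_src (fun_vsq h)) t0_top.
- by rewrite (f_tgt (fun_vsq h)) t0_bot.
- by rewrite (f_src (fun_hsq h)) t0_left.
- by rewrite (f_tgt (fun_hsq h)) t0_right.
- rewrite -!(f_tcmp (fun_vsq h)) ?t0_nat //.
    by rewrite (f_tgt (h_fun _)) t0_top.
  by rewrite (f_src (h_fun _)) t0_bot.
Defined.

Definition hpre (g : dblfun A B) (a : htrans B C) : htrans A C.
Proof.
by refine (@HTrans A C (dblfun_comp (hs a) g) (dblfun_comp (ht a) g)
  (fun x => h0 a (fob g x)) (fun u => h1 a (fver g u))
  (functor_on_comp (h_fun a) (fun_vcat g)) _ _ _ _) => * /=;
  rewrite ?h0_src ?h0_tgt ?h1_left ?h1_right.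
Defined.

Definition vpre (g : dblfun A B) (a : vtrans B C) : vtrans A C.
Proof.
refine (@VTrans A C (dblfun_comp (vs a) g) (dblfun_comp (vt a) g)
  (fun x => v0 a (fob g x)) (fun k => v1 a (fhor g k))
  (functor_on_comp (v_fun a) (fun_hcat g)) _ _ _ _ _ _) => * /=;
  rewrite ?v0_src ?v0_tgt ?v1_top ?v1_bot //.
- by rewrite -(f_src (fun_vcat g)) -(f_tgt (fun_vcat g)) v0_nat.
- by rewrite -(f_src (fun_vsq g)) -(f_tgt (fun_vsq g)) v1_nat.
Defined.

Definition tpre (g : dblfun A B) (a : tsq B C) : tsq A C.
Proof.
refine (@TSq A C (hpre g (t_top a)) (hpre g (t_bot a))
  (vpre g (t_left a)) (vpre g (t_right a)) (fun x => t0 a (fob g x))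
  _ _ _ _ _ _ _ _ _) => * /=;
  rewrite ?t_tl ?t_tr ?t_bl ?t_br ?t0_top ?t0_bot ?t0_left ?t0_right //.
by rewrite -(f_src (fun_vcat g)) -(f_tgt (fun_vcat g)) t0_nat.
Defined.

(** This has two uses: it is the action of the right adjoint on double functors, and it is
    composition of internal homs with the outer factor fixed. *)
Definition post (h : dblfun B C) : dblfun (dhom A B) (dhom A C).
Proof.
refine (@DblFun (dhom A B) (dhom A C) (dblfun_comp h) (hpost h) (vpost h)
  (tpost h) _ _ _ _); split=> //.
- by move=> F; apply: htrans_eq => //= *;
    rewrite ?(f_idn (fun_hcat h)) ?(f_idn (fun_hsq h)).
- move=> f g e e'; apply: htrans_eq => //= *.
    by rewrite (f_tcmp (fun_hcat h)) ?(h0_joint e).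
  by rewrite (f_tcmp (fun_hsq h)) ?(h1_joint e).
- by move=> F; apply: vtrans_eq => //= *;
    rewrite ?(f_idn (fun_vcat h)) ?(f_idn (fun_vsq h)).
- move=> f g e e'; apply: vtrans_eq => //= *.
    by rewrite (f_tcmp (fun_vcat h)) ?(v0_joint e).
  by rewrite (f_tcmp (fun_vsq h)) ?(v1_joint e).
- move=> a; apply: tsq_eq => //= *; last by rewrite (f_idn (fun_hsq h)).
    by apply: htrans_eq => //= *;
      rewrite ?(f_idn (fun_hcat h)) ?(f_idn (fun_hsq h)).
  by apply: htrans_eq => //= *;
    rewrite ?(f_idn (fun_hcat h)) ?(f_idn (fun_hsq h)).
- move=> a b e e'; apply: tsq_eq => //= *.
  + apply: htrans_eq => //= *.
      by rewrite (f_tcmp (fun_hcat h)) ?(h0_joint (t_top_joint e)).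
    by rewrite (f_tcmp (fun_hsq h)) ?(h1_joint (t_top_joint e)).
  + apply: htrans_eq => //= *.
      by rewrite (f_tcmp (fun_hcat h)) ?(h0_joint (t_bot_joint e)).
    by rewrite (f_tcmp (fun_hsq h)) ?(h1_joint (t_bot_joint e)).
  + by rewrite (f_tcmp (fun_hsq h)) ?(t0_hjoint e).
- move=> a; apply: tsq_eq => //= *; last by rewrite (f_idn (fun_vsq h)).
    by apply: vtrans_eq => //= *;
      rewrite ?(f_idn (fun_vcat h)) ?(f_idn (fun_vsq h)).
  by apply: vtrans_eq => //= *;
    rewrite ?(f_idn (fun_vcat h)) ?(f_idn (fun_vsq h)).
- move=> a b e e'; apply: tsq_eq => //= *.
  + apply: vtrans_eq => //= *.
      by rewrite (f_tcmp (fun_vcat h)) ?(v0_joint (t_left_joint e)).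
    by rewrite (f_tcmp (fun_vsq h)) ?(v1_joint (t_left_joint e)).
  + apply: vtrans_eq => //= *.
      by rewrite (f_tcmp (fun_vcat h)) ?(v0_joint (t_right_joint e)).
    by rewrite (f_tcmp (fun_vsq h)) ?(v1_joint (t_right_joint e)).
  + by rewrite (f_tcmp (fun_vsq h)) ?(t0_vjoint e).
Defined.

(** Composition of internal homs with the inner factor fixed. *)
Definition pre (g : dblfun A B) : dblfun (dhom B C) (dhom A C).
Proof.
refine (@DblFun (dhom B C) (dhom A C) (fun F => dblfun_comp F g) (hpre g)
  (vpre g) (tpre g) _ _ _ _); split=> //.
- by move=> F; apply: htrans_eq.
- by move=> f h e e'; apply: htrans_eq.
- by move=> F; apply: vtrans_eq.
- by move=> f h e e'; apply: vtrans_eq.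
- by move=> a; apply: tsq_eq => //=; apply: htrans_eq.
- by move=> a b e e'; apply: tsq_eq => //=; apply: htrans_eq.
- by move=> a; apply: tsq_eq => //=; apply: vtrans_eq.
- by move=> a b e e'; apply: tsq_eq => //=; apply: vtrans_eq.
Defined.
End Whiskering.

(** * Evaluation: the counit *)

Section Evaluation.
Variables (B C : dblcat).

Definition eval_at (y : ob B) : dblfun (dhom B C) C.
Proof.
refine (@DblFun (dhom B C) C (fun F => fob F y) (fun a => h0 a y)
  (fun a => v0 a y) (fun a => t0 a y) _ _ _ _); split=> //= *.
- exact: h0_src.
- exact: h0_tgt.
- by rewrite tcmpE.
- exact: v0_src.
- exact: v0_tgt.
- by rewrite tcmpE.
- exact: t0_left.
- exact: t0_right.
- by rewrite tcmpE.
- exact: t0_top.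
- exact: t0_bot.
- by rewrite tcmpE.
Defined.

Lemma eval_v1 k :
  functor_on (vcat (dhom B C)) (vsq C) (fun F => fhor F k) (fun a => v1 a k).
Proof. by split=> //= *; rewrite ?v1_top ?v1_bot ?tcmpE. Qed.

Lemma eval_h1 u :
  functor_on (hcat (dhom B C)) (hsq C) (fun F => fver F u) (fun a => h1 a u).
Proof. by split=> //= *; rewrite ?h1_left ?h1_right ?tcmpE. Qed.

(** The axioms of the cells of [dhom B C] are themselves the conditions of a [bifun]: [v0_nat] is
    the swap law, and [v1_nat] and [t0_nat] are the two naturality laws for squares. *)
Definition eval_bifun : bifun (dhom B C) B C :=
  @Bifun (dhom B C) B C (fun F => F) eval_at (@v1 B C) (@h1 B C)
    (fun _ _ => eq_refl) (@v_fun B C) eval_v1 (@h_fun B C) eval_h1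
    (@v0_nat B C) (@v1_nat B C) (@t0_nat B C).

Definition eval : dblfun (funny (dhom B C) B) C := funny_lift eval_bifun.
End Evaluation.

(** * Currying *)

Section Currying.
Variables (A B C : dblcat) (b : bifun A B C).

(** In currying, the functoriality of the squares in the [B] argument and the mixed laws make the
    images cells of [dhom B C]. Functoriality in the [A] argument gives their boundaries and makes
    [cur] a double functor. *)
Definition cur_hor (K : hor A) : htrans B C.
Proof.
refine (@HTrans B C (bR b (src (hcat A) K)) (bR b (tgt (hcat A) K))
  (fun y => fhor (bL b y) K) (bHV b K) (bHV_v b K) _ _ _ _) => *.
- by rewrite (f_src (fun_hcat _)) b_ob.
- by rewrite (f_tgt (fun_hcat _)) b_ob.
- exact: (f_src (bHV_h b _)).
- exact: (f_tgt (bHV_h b _)).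
Defined.

Definition cur_ver (U : ver A) : vtrans B C.
Proof.
refine (@VTrans B C (bR b (src (vcat A) U)) (bR b (tgt (vcat A) U))
  (fun y => fver (bL b y) U) (bVH b U) (bVH_h b U) _ _ _ _
  (b_swap b U) (bVH_nat b U)) => *.
- by rewrite (f_src (fun_vcat _)) b_ob.
- by rewrite (f_tgt (fun_vcat _)) b_ob.
- exact: (f_src (bVH_v b _)).
- exact: (f_tgt (bVH_v b _)).
Defined.

Definition cur_sq (z : sq A) : tsq B C.
Proof.
refine (@TSq B C (cur_hor (src (vsq A) z)) (cur_hor (tgt (vsq A) z))
  (cur_ver (src (hsq A) z)) (cur_ver (tgt (hsq A) z))
  (fun y => fsq (bL b y) z) _ _ _ _ _ _ _ _ (bHV_nat b z)) => /= *.
- by rewrite corner_tl.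
- by rewrite corner_tr.
- by rewrite corner_bl.
- by rewrite corner_br.
- by rewrite (f_src (fun_vsq _)).
- by rewrite (f_tgt (fun_vsq _)).
- by rewrite (f_src (fun_hsq _)).
- by rewrite (f_tgt (fun_hsq _)).
Defined.

Lemma cur_hcat : functor_on (hcat A) (hcat (dhom B C)) (bR b) cur_hor.
Proof.
split=> //= [x|f g e e'].
- apply: htrans_eq => /= *; rewrite ?src_idn ?tgt_idn ?(f_idn (fun_hcat _))
    ?b_ob //.
  exact: (f_idn (bHV_h b _)).
- apply: htrans_eq => /= *; rewrite ?src_cmp ?tgt_cmp // tcmpE.
    by rewrite (f_tcmp (fun_hcat _)).
  exact: (f_tcmp (bHV_h b _)).
Qed.

Lemma cur_vcat : functor_on (vcat A) (vcat (dhom B C)) (bR b) cur_ver.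
Proof.
split=> //= [x|f g e e'].
- apply: vtrans_eq => /= *; rewrite ?src_idn ?tgt_idn ?(f_idn (fun_vcat _))
    ?b_ob //.
  exact: (f_idn (bVH_v b _)).
- apply: vtrans_eq => /= *; rewrite ?src_cmp ?tgt_cmp // tcmpE.
    by rewrite (f_tcmp (fun_vcat _)).
  exact: (f_tcmp (bVH_v b _)).
Qed.

Definition cur : dblfun A (dhom B C).
Proof.
refine (@DblFun A (dhom B C) (bR b) cur_hor cur_ver cur_sq cur_hcat cur_vcat
  _ _); split=> //= [u|f g e e'].
- apply: tsq_eq => /= *; rewrite ?src_idn ?tgt_idn ?(f_idn (fun_hsq _)) //.
    by rewrite top_Id; apply: (f_idn cur_hcat).
  by rewrite bot_Id; apply: (f_idn cur_hcat).
- apply: tsq_eq => /= *; rewrite ?src_cmp ?tgt_cmp //.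
  + by case: (top_hcmp_ex e) => ? ->; apply: (f_cmp cur_hcat).
  + by case: (bot_hcmp_ex e) => ? ->; apply: (f_cmp cur_hcat).
  + by rewrite tcmpE (f_tcmp (fun_hsq _)).
- apply: tsq_eq => /= *; rewrite ?src_idn ?tgt_idn ?(f_idn (fun_vsq _)) //.
    by rewrite left_Id; apply: (f_idn cur_vcat).
  by rewrite right_Id; apply: (f_idn cur_vcat).
- apply: tsq_eq => /= *; rewrite ?src_cmp ?tgt_cmp //.
  + by case: (left_vcmp_ex e) => ? ->; apply: (f_cmp cur_vcat).
  + by case: (right_vcmp_ex e) => ? ->; apply: (f_cmp cur_vcat).
  + by rewrite tcmpE (f_tcmp (fun_vsq _)).
Defined.
End Currying.

(** * Composition of internal homs *)

Section HomComposition.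
Variables A B C : dblcat.

(** The two mixed whiskering squares are components of the outer transformation: [a] at the 1h-cells
    of [f] here, and at the 1v-cells of [f] in [comp_hv]. Two horizontal transformations give no
    such square, just as [funny] has no square for a pair of 1h-cells. *)
Definition comp_vh (a : vtrans B C) (f : htrans A B) : tsq A C.
Proof.
refine (@TSq A C (hpost (vs a) f) (hpost (vt a) f) (vpre (hs f) a)
  (vpre (ht f) a) (fun x => v1 a (h0 f x)) _ _ _ _ _ _ _ _ _) => //= *.
- by rewrite v1_top.
- by rewrite v1_bot.
- by rewrite (f_src (v_fun a)) h0_src.
- by rewrite (f_tgt (v_fun a)) h0_tgt.
- by rewrite -(f_src (h_fun f)) -(f_tgt (h_fun f)) v1_nat.
Defined.

Definition comp_hv (a : htrans B C) (f : vtrans A B) : tsq A C.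
Proof.
refine (@TSq A C (hpre (vs f) a) (hpre (vt f) a) (vpost (hs a) f)
  (vpost (ht a) f) (fun x => h1 a (v0 f x)) _ _ _ _ _ _ _ _ _) => //= *.
- by rewrite (f_src (h_fun a)) v0_src.
- by rewrite (f_tgt (h_fun a)) v0_tgt.
- by rewrite h1_left.
- by rewrite h1_right.
- rewrite -!(f_tcmp (h_fun a)) ?v0_nat //.
    by rewrite (f_tgt (fun_vcat _)) v0_src.
  by rewrite (f_src (fun_vcat _)) v0_tgt.
Defined.

(** Componentwise this is the naturality of [a] at the 1v-cells [v0 f y] and at the squares
    [v1 f k]. It is here that the strictness of vertical transformations matches the swap
    relation. *)
Lemma comp_swap (a : vtrans B C) (f : vtrans A B) e e' :
  @vcomp A C (vpost (vs a) f) (vpre (vt f) a) e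
  = @vcomp A C (vpre (vs f) a) (vpost (vt a) f) e'.
Proof.
apply: vtrans_eq => //= *.
  by rewrite -(v0_src f) -(v0_tgt f) v0_nat.
by rewrite -(v1_top f) -(v1_bot f) v1_nat.
Qed.

Lemma comp_swap_tcmp (a : vtrans B C) (f : vtrans A B) :
  tcmp (vcat (dhom A C)) (vpost (vs a) f) (vpre (vt f) a)
  = tcmp (vcat (dhom A C)) (vpre (vs f) a) (vpost (vt a) f).
Proof.
have e : vt (vpost (vs a) f) = vs (vpre (vt f) a) by [].
have e' : vt (vpre (vs f) a) = vs (vpost (vt a) f) by [].
rewrite -(@tcmpE _ _ (vcat (dhom A C)) _ _ e).
rewrite -(@tcmpE _ _ (vcat (dhom A C)) _ _ e').
exact: comp_swap.
Qed.

Lemma comp_vh_nat (a : vtrans B C) (w : tsq A B) :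
  tcmp (vsq (dhom A C)) (tpost (vs a) w) (comp_vh a (t_bot w))
  = tcmp (vsq (dhom A C)) (comp_vh a (t_top w)) (tpost (vt a) w).
Proof.
have e : t_bot (tpost (vs a) w) = t_top (comp_vh a (t_bot w)) by [].
have e' : t_bot (comp_vh a (t_top w)) = t_top (tpost (vt a) w) by [].
rewrite -(@tcmpE _ _ (vsq (dhom A C)) _ _ e).
rewrite -(@tcmpE _ _ (vsq (dhom A C)) _ _ e').
(* The left and right faces agree by the argument of [comp_swap], and the components by the
   naturality of [a] at the squares of [w]. *)
apply: tsq_eq => //= [||y].
- apply: vtrans_eq => //= *; rewrite ?t_bl ?t_tl //.
    by rewrite -(v0_src (t_left w)) -(v0_tgt (t_left w)) v0_nat.
  by rewrite -(v1_top (t_left w)) -(v1_bot (t_left w)) v1_nat.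
- apply: vtrans_eq => //= *; rewrite ?t_br ?t_tr //.
    by rewrite -(v0_src (t_right w)) -(v0_tgt (t_right w)) v0_nat.
  by rewrite -(v1_top (t_right w)) -(v1_bot (t_right w)) v1_nat.
- by rewrite -(t0_top w) -(t0_bot w) v1_nat.
Qed.

Lemma comp_hv_nat (z : tsq B C) (f : vtrans A B) :
  tcmp (vsq (dhom A C)) (comp_hv (t_top z) f) (tpre (vt f) z)
  = tcmp (vsq (dhom A C)) (tpre (vs f) z) (comp_hv (t_bot z) f).
Proof.
have e : t_bot (comp_hv (t_top z) f) = t_top (tpre (vt f) z) by [].
have e' : t_bot (tpre (vs f) z) = t_top (comp_hv (t_bot z) f) by [].
rewrite -(@tcmpE _ _ (vsq (dhom A C)) _ _ e).
rewrite -(@tcmpE _ _ (vsq (dhom A C)) _ _ e').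
(* The side faces are again those of [comp_swap]; the components agree by the naturality of [z]
   along the 1v-cells of [f]. *)
apply: tsq_eq => //= [||y].
- apply: vtrans_eq => //= *; rewrite ?t_bl ?t_tl //.
    by rewrite -(v0_src f) -(v0_tgt f) v0_nat.
  by rewrite -(v1_top f) -(v1_bot f) v1_nat.
- apply: vtrans_eq => //= *; rewrite ?t_br ?t_tr //.
    by rewrite -(v0_src f) -(v0_tgt f) v0_nat.
  by rewrite -(v1_top f) -(v1_bot f) v1_nat.
- by rewrite -(v0_src f) -(v0_tgt f) t0_nat.
Qed.

Lemma comp_vh_h (a : vtrans B C) : functor_on (hcat (dhom A B))
  (hsq (dhom A C)) (fun F => vpre F a) (comp_vh a).
Proof.
split=> //= [F|f g e e'].
- apply: tsq_eq => //= [||y].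
  + by apply: htrans_eq => //= *;
      rewrite ?(f_idn (fun_hcat _)) ?(f_idn (fun_hsq _)).
  + by apply: htrans_eq => //= *;
      rewrite ?(f_idn (fun_hcat _)) ?(f_idn (fun_hsq _)).
  + by rewrite (f_idn (v_fun a)).
- have j0 := h0_joint e; have j1 := h1_joint e.
  apply: tsq_eq => //= [||y].
  + by apply: htrans_eq => //= *;
      rewrite ?(f_tcmp (fun_hcat _)) ?(f_tcmp (fun_hsq _)).
  + by apply: htrans_eq => //= *;
      rewrite ?(f_tcmp (fun_hcat _)) ?(f_tcmp (fun_hsq _)).
  + by rewrite (f_tcmp (v_fun a)).
Qed.

Lemma comp_vh_v (f : htrans A B) : functor_on (vcat (dhom B C))
  (vsq (dhom A C)) (fun F => hpost F f) (fun a => comp_vh a f).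
Proof.
split=> //= [F|a b e e'].
- by apply: tsq_eq => //=; apply: vtrans_eq.
- by apply: tsq_eq => //=; apply: vtrans_eq.
Qed.

Lemma comp_hv_v (a : htrans B C) : functor_on (vcat (dhom A B))
  (vsq (dhom A C)) (fun F => hpre F a) (comp_hv a).
Proof.
split=> //= [F|f g e e'].
- apply: tsq_eq => //= [||y].
  + by apply: vtrans_eq => //= *;
      rewrite ?(f_idn (fun_vcat _)) ?(f_idn (fun_vsq _)).
  + by apply: vtrans_eq => //= *;
      rewrite ?(f_idn (fun_vcat _)) ?(f_idn (fun_vsq _)).
  + by rewrite (f_idn (h_fun a)).
- have j0 := v0_joint e; have j1 := v1_joint e.
  apply: tsq_eq => //= [||y].
  + by apply: vtrans_eq => //= *;
      rewrite ?(f_tcmp (fun_vcat _)) ?(f_tcmp (fun_vsq _)).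
  + by apply: vtrans_eq => //= *;
      rewrite ?(f_tcmp (fun_vcat _)) ?(f_tcmp (fun_vsq _)).
  + by rewrite (f_tcmp (h_fun a)).
Qed.

Lemma comp_hv_h (f : vtrans A B) : functor_on (hcat (dhom B C))
  (hsq (dhom A C)) (fun F => vpost F f) (fun a => comp_hv a f).
Proof.
split=> //= [F|a b e e'].
- by apply: tsq_eq => //=; apply: htrans_eq.
- by apply: tsq_eq => //=; apply: htrans_eq.
Qed.

Definition comp_bifun : bifun (dhom B C) (dhom A B) (dhom A C) :=
  @Bifun (dhom B C) (dhom A B) (dhom A C) (@post A B C) (@pre A B C)
    comp_vh comp_hv (fun _ _ => eq_refl) comp_vh_h comp_vh_v comp_hv_v
    comp_hv_h comp_swap_tcmp comp_vh_nat comp_hv_nat.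

Definition hom_comp : dblfun (funny (dhom B C) (dhom A B)) (dhom A C) :=
  funny_lift comp_bifun.
End HomComposition.

Definition unit_dblfun (A B : dblcat) : dblfun A (dhom B (funny A B)) :=
  cur (funny_bifun A B).

(** Exchanging the factors exchanges the squares of types [U # k] and [K # u]. The swap law and the
    two naturality laws are only turned around. *)
Definition sym_bifun (A B C : dblcat) (b : bifun A B C) : bifun B A C.
Proof.
refine (@Bifun B A C (bL b) (bR b) (fun u K => bHV b K u)
  (fun k U => bVH b U k) _ (bHV_h b) (bHV_v b) (bVH_v b) (bVH_h b) _ _ _) => *.
- by rewrite b_ob.
- by rewrite b_swap.
- by rewrite bHV_nat.
- by rewrite bVH_nat.
Defined.

Definition sym (A B : dblcat) : dblfun (funny A B) (funny B A) :=
  funny_lift (sym_bifun (funny_bifun B A)).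

Definition uncurry (A B C : dblcat) (F : dblfun A (dhom B C)) :
    dblfun (funny A B) C :=
  dblfun_comp (eval B C) (dmap F (dblfun_id B)).

(** The transpose through the unit, which requires no [bifun] to be extracted from [F]. *)
Definition curry (A B C : dblcat) (F : dblfun (funny A B) C) :
    dblfun A (dhom B C) :=
  dblfun_comp (post B F) (unit_dblfun A B).

Definition funny_assoc (X Y Z : dblcat) :
    dblfun (funny (funny X Y) Z) (funny X (funny Y Z)) :=
  uncurry (dblfun_comp (hom_comp Z (funny Y Z) (funny X (funny Y Z)))
             (dmap (unit_dblfun X (funny Y Z)) (unit_dblfun Y Z))).

(** * Closedness *)

(* [cbn] is given an explicit list, lest it unfold [hor (funny A B)] and the
   like in implicit type arguments, which makes unification diverge. *)
Ltac gens_step :=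
  cbn [fob fhor fver fsq dblfun_comp dblfun_id bR bL bVH bHV
       h0 h1 v0 v1 t0 hs ht vs vt t_top t_bot t_left t_right
       post pre hpost vpost tpost hpre vpre tpre eval_at eval_bifun
       cur cur_hor cur_ver cur_sq comp_vh comp_hv comp_bifun
       unit_dblfun sym_bifun funny_bifun funny_inr funny_inl curry uncurry].

Ltac gens := gens_step; repeat progress (rewrite ?mapE ?liftE; gens_step);
  try reflexivity.

Lemma curryK (A B C : dblcat) (F : dblfun (funny A B) C) :
  uncurry (curry F) = F.
Proof. by apply: funny_ext => *; gens. Qed.

(** The proof goes up in dimension: cells of [dhom B C] are equal only once their boundaries are,
    and those are values of the two functors one dimension lower. *)
Lemma uncurryK (A B C : dblcat) (F : dblfun A (dhom B C)) :
  curry (uncurry F) = F.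
Proof.
have eo x : fob (curry (uncurry F)) x = fob F x.
  by apply: dblfun_eq => *; gens.
have eh K : fhor (curry (uncurry F)) K = fhor F K.
  apply: htrans_eq => [||y|u]; gens.
    exact: eq_trans (eo _) (eq_sym (f_src (fun_hcat F) _)).
  exact: eq_trans (eo _) (eq_sym (f_tgt (fun_hcat F) _)).
have ev U : fver (curry (uncurry F)) U = fver F U.
  apply: vtrans_eq => [||y|k]; gens.
    exact: eq_trans (eo _) (eq_sym (f_src (fun_vcat F) _)).
  exact: eq_trans (eo _) (eq_sym (f_tgt (fun_vcat F) _)).
apply: dblfun_eq => // a; apply: tsq_eq => [||||y]; gens.
- exact: eq_trans (eh _) (eq_sym (f_src (fun_vsq F) _)).
- exact: eq_trans (eh _) (eq_sym (f_tgt (fun_vsq F) _)).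
- exact: eq_trans (ev _) (eq_sym (f_src (fun_hsq F) _)).
- exact: eq_trans (ev _) (eq_sym (f_tgt (fun_hsq F) _)).
Qed.

Lemma curry_natural (A A' B C C' : dblcat) (f : dblfun A' A)
    (h : dblfun (funny A B) C) (g : dblfun C C') :
  curry (dblfun_comp (dblfun_comp g h) (dmap f (dblfun_id B)))
  = dblfun_comp (dblfun_comp (post B g) (curry h)) f.
Proof.
(* With both sides written as transposes, the equation can be checked on the generators of
   [funny A' B]. *)
rewrite -[RHS]uncurryK; congr curry.
by apply: funny_ext => *; gens.
Qed.

(** * The associator *)

Section AssocGenerators.
Variables X Y Z : dblcat.
Local Notation assoc := (funny_assoc X Y Z).

Lemma assoc_ob x y z : fob assoc ((x, y), z) = (x, (y, z)).
Proof. by rewrite /funny_assoc; gens. Qed.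
Lemma assoc_hR x y k :
  fhor assoc (hR (A := funny X Y) (x, y) k) = hR x (hR y k).
Proof. by rewrite /funny_assoc; gens. Qed.
Lemma assoc_hLR x k z : fhor assoc (hL (hR x k) z) = hR x (hL k z).
Proof. by rewrite /funny_assoc; gens. Qed.
Lemma assoc_hLL K y z :
  fhor assoc (hL (hL K y) z) = hL (B := funny Y Z) K (y, z).
Proof. by rewrite /funny_assoc; gens. Qed.
Lemma assoc_vR x y k :
  fver assoc (vR (A := funny X Y) (x, y) k) = vR x (vR y k).
Proof. by rewrite /funny_assoc; gens. Qed.
Lemma assoc_vLR x k z : fver assoc (vL (vR x k) z) = vR x (vL k z).
Proof. by rewrite /funny_assoc; gens. Qed.
Lemma assoc_vLL K y z :
  fver assoc (vL (vL K y) z) = vL (B := funny Y Z) K (y, z).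
Proof. by rewrite /funny_assoc; gens. Qed.
Lemma assoc_sR x y k : fsq assoc (sR (A := funny X Y) (x, y) k) = sR x (sR y k).
Proof. by rewrite /funny_assoc; gens. Qed.
Lemma assoc_sLR x k z : fsq assoc (sL (sR x k) z) = sR x (sL k z).
Proof. by rewrite /funny_assoc; gens. Qed.
Lemma assoc_sLL K y z :
  fsq assoc (sL (sL K y) z) = sL (B := funny Y Z) K (y, z).
Proof. by rewrite /funny_assoc; gens. Qed.
Lemma assoc_sLVH U k z : fsq assoc (sL (sVH U k) z) = sVH U (hL k z).
Proof. by rewrite /funny_assoc; gens. Qed.
Lemma assoc_sLHV K u z : fsq assoc (sL (sHV K u) z) = sHV K (vL u z).
Proof. by rewrite /funny_assoc; gens. Qed.
Lemma assoc_sVHR x u k : fsq assoc (sVH (vR x u) k) = sR x (sVH u k).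
Proof. by rewrite /funny_assoc; gens. Qed.
Lemma assoc_sVHL U y k : fsq assoc (sVH (vL U y) k) = sVH U (hR y k).
Proof. by rewrite /funny_assoc; gens. Qed.
Lemma assoc_sHVR x k u : fsq assoc (sHV (hR x k) u) = sR x (sHV k u).
Proof. by rewrite /funny_assoc; gens. Qed.
Lemma assoc_sHVL K y u : fsq assoc (sHV (hL K y) u) = sHV K (vR y u).
Proof. by rewrite /funny_assoc; gens. Qed.
End AssocGenerators.

Definition assocE := (assoc_ob, assoc_hR, assoc_hLR, assoc_hLL, assoc_vR,
  assoc_vLR, assoc_vLL, assoc_sR, assoc_sLR, assoc_sLL, assoc_sLVH,
  assoc_sLHV, assoc_sVHR, assoc_sVHL, assoc_sHVR, assoc_sHVL).

Section TripleExt.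
Variables X Y Z W : dblcat.
Variables F G : dblfun (funny (funny X Y) Z) W.

(** For fixed [z], restriction along [funny_inl z] settles all cells [- # z] through [funny_ext].
    What remains is the squares [sVH U k] and [sHV K u] with [U], [K] arbitrary in [funny X Y]. *)
Lemma funny_ext3 :
  (forall x y z, fob F ((x, y), z) = fob G ((x, y), z)) ->
  (forall x y k, fhor F (hR (A := funny X Y) (x, y) k)
     = fhor G (hR (A := funny X Y) (x, y) k)) ->
  (forall x k z, fhor F (hL (hR x k) z) = fhor G (hL (hR x k) z)) ->
  (forall K y z, fhor F (hL (hL K y) z) = fhor G (hL (hL K y) z)) ->
  (forall x y u, fver F (vR (A := funny X Y) (x, y) u)
     = fver G (vR (A := funny X Y) (x, y) u)) ->
  (forall x u z, fver F (vL (vR x u) z) = fver G (vL (vR x u) z)) ->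
  (forall U y z, fver F (vL (vL U y) z) = fver G (vL (vL U y) z)) ->
  (forall x y w, fsq F (sR (A := funny X Y) (x, y) w)
     = fsq G (sR (A := funny X Y) (x, y) w)) ->
  (forall x w z, fsq F (sL (sR x w) z) = fsq G (sL (sR x w) z)) ->
  (forall a y z, fsq F (sL (sL a y) z) = fsq G (sL (sL a y) z)) ->
  (forall U k z, fsq F (sL (sVH U k) z) = fsq G (sL (sVH U k) z)) ->
  (forall K u z, fsq F (sL (sHV K u) z) = fsq G (sL (sHV K u) z)) ->
  (forall x u k, fsq F (sVH (vR x u) k) = fsq G (sVH (vR x u) k)) ->
  (forall U y k, fsq F (sVH (vL U y) k) = fsq G (sVH (vL U y) k)) ->
  (forall x k u, fsq F (sHV (hR x k) u) = fsq G (sHV (hR x k) u)) ->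
  (forall K y u, fsq F (sHV (hL K y) u) = fsq G (sHV (hL K y) u)) ->
  F = G.
Proof.
move=> eo hr hlr hll vr vlr vll sr slr sll slvh slhv svhr svhl shvr shvl.
have eL z : dblfun_comp F (funny_inl z) = dblfun_comp G (funny_inl z).
  by apply: funny_ext => /= *.
apply: funny_ext.
- by case.
- by case.
- by move=> K z; have /(f_equal (fun H => fhor H K)) := eL z.
- by case.
- by move=> U z; have /(f_equal (fun H => fver H U)) := eL z.
- by case.
- by move=> a z; have /(f_equal (fun H => fsq H a)) := eL z.
(* For fixed [k] the square is functorial in [U], so [U] may be taken to be a generator; at objects
   the functors take the values on [hR]. *)
- move=> U k; move: U; apply: (funny_ver_ext
    (functor_on_comp (fun_vsq F) (bVH_v (funny_bifun _ _) k))
    (functor_on_comp (fun_vsq G) (bVH_v (funny_bifun _ _) k))).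
  + by move=> x y; apply: (hr x y k).
  + by move=> x u; apply: svhr.
  + by move=> U y; apply: svhl.
- move=> K u; move: K; apply: (funny_hor_ext
    (functor_on_comp (fun_hsq F) (bHV_h (funny_bifun _ _) u))
    (functor_on_comp (fun_hsq G) (bHV_h (funny_bifun _ _) u))).
  + by move=> x y; apply: (vr x y u).
  + by move=> x k; apply: shvr.
  + by move=> K y; apply: shvl.
Qed.
End TripleExt.

Ltac gens_assoc := gens_step; repeat progress (rewrite ?assocE ?mapE ?liftE;
  gens_step);
  try reflexivity.

(** The order of the three factors is reversed, so that right nesting becomes left nesting. The
    inverse of the associator thus comes from an associator already constructed, and no
    extensionality for right-nested products is required. *)
Definition reassoc (X Y Z : dblcat) :
    dblfun (funny X (funny Y Z)) (funny (funny Z Y) X) :=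
  dblfun_comp (dmap (sym Y Z) (dblfun_id X)) (sym X (funny Y Z)).

Definition reassoc_inv (X Y Z : dblcat) :
    dblfun (funny (funny Z Y) X) (funny X (funny Y Z)) :=
  dblfun_comp (sym (funny Y Z) X) (dmap (sym Z Y) (dblfun_id X)).

Definition assoc_inv (X Y Z : dblcat) :
    dblfun (funny X (funny Y Z)) (funny (funny X Y) Z) :=
  dblfun_comp (reassoc Z Y X) (dblfun_comp (funny_assoc Z Y X) (reassoc X Y Z)).

Lemma assocK (X Y Z : dblcat) :
  dblfun_comp (assoc_inv X Y Z) (funny_assoc X Y Z) = dblfun_id _.
Proof.
rewrite /assoc_inv /reassoc.
by apply: funny_ext3 => *; gens_assoc.
Qed.
Lemma dblfun_compA (A B C D : dblcat) (h : dblfun C D) (g : dblfun B C)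
    (f : dblfun A B) :
  dblfun_comp (dblfun_comp h g) f = dblfun_comp h (dblfun_comp g f).
Proof. exact: dblfun_eq. Qed.

Lemma dblfun_idl (A B : dblcat) (f : dblfun A B) :
  dblfun_comp (dblfun_id B) f = f.
Proof. exact: dblfun_eq. Qed.

Lemma dblfun_idr (A B : dblcat) (f : dblfun A B) :
  dblfun_comp f (dblfun_id A) = f.
Proof. exact: dblfun_eq. Qed.

Lemma symK (A B : dblcat) : dblfun_comp (sym B A) (sym A B) = dblfun_id _.
Proof. by apply: funny_ext => *; rewrite /sym; gens_assoc. Qed.

Lemma sym_natural (A A' B B' : dblcat) (F : dblfun A A') (G : dblfun B B') :
  dblfun_comp (sym A' B') (dmap F G) = dblfun_comp (dmap G F) (sym A B).
Proof. by apply: funny_ext => *; rewrite /sym; gens_assoc. Qed.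

Lemma dmap_id (A B : dblcat) : dmap (dblfun_id A) (dblfun_id B) = dblfun_id _.
Proof. by rewrite dmapE funny_map_id. Qed.

Lemma dmap_comp (A A' A'' B B' B'' : dblcat) (F' : dblfun A' A'')
    (F : dblfun A A') (G' : dblfun B' B'') (G : dblfun B B') :
  dmap (dblfun_comp F' F) (dblfun_comp G' G)
  = dblfun_comp (dmap F' G') (dmap F G).
Proof. by rewrite !dmapE funny_map_comp. Qed.

Lemma dmap_symK (X Y Z : dblcat) :
  dblfun_comp (dmap (sym Z Y) (dblfun_id X)) (dmap (sym Y Z) (dblfun_id X))
  = dblfun_id _.
Proof. by rewrite -dmap_comp symK dblfun_idl dmap_id. Qed.

Lemma reassocK (X Y Z : dblcat) :
  dblfun_comp (reassoc_inv X Y Z) (reassoc X Y Z) = dblfun_id _.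
Proof.
rewrite /reassoc_inv /reassoc dblfun_compA -(dblfun_compA (dmap _ _)).
by rewrite dmap_symK dblfun_idl symK.
Qed.

(* Writing [s] for [reassoc] and [a] for [funny_assoc], [assocK] reads
   [s a s a = id]; since [s] is invertible, [a s a s = id] as well. *)
Lemma assoc_invK (X Y Z : dblcat) :
  dblfun_comp (funny_assoc X Y Z) (assoc_inv X Y Z) = dblfun_id _.
Proof.
have E : dblfun_comp (funny_assoc X Y Z)
    (dblfun_comp (reassoc Z Y X) (funny_assoc Z Y X)) = reassoc_inv X Y Z.
  have /(f_equal (dblfun_comp (reassoc_inv X Y Z))) := assocK Z Y X.
  rewrite dblfun_idr /assoc_inv dblfun_compA -(dblfun_compA (reassoc_inv _ _
    _)).
  by rewrite reassocK dblfun_idl dblfun_compA.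
have /(f_equal (fun F => dblfun_comp F (reassoc X Y Z))) := E.
by rewrite reassocK /assoc_inv !dblfun_compA.
Qed.

(** * The unitors and coherence *)

Definition const_dblfun (A B : dblcat) (y : ob B) : dblfun A B.
Proof.
refine (@DblFun A B (fun _ => y) (fun _ => idn (hcat B) y)
  (fun _ => idn (vcat B) y) (fun _ => idn (hsq B) (idn (vcat B) y)) _ _ _ _);
  apply: functor_on_tcmp => * //; rewrite ?src_idn ?tgt_idn //.
- by rewrite tcmp_idl ?src_idn.
- by rewrite tcmp_idl ?src_idn.
- by rewrite tcmp_idl ?src_idn.
- by rewrite top_Id src_idn.
- by rewrite bot_Id tgt_idn.
- by rewrite Id_Id.
- by rewrite Id_Id tcmp_idl ?src_idn.
Defined.

(** Every cell of the terminal double category is an identity, and the relations send a mixed square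
    over an identity to an identity; so both families of squares are forced. *)
Definition lunit_bifun (X : dblcat) : bifun terminal_dblcat X X.
Proof.
refine (@Bifun terminal_dblcat X X (fun _ => dblfun_id X)
  (const_dblfun terminal_dblcat (B := X)) (fun _ k => idn (vsq X) k)
  (fun _ u => idn (hsq X) u) _ _ _ _ _ _ _ _) => //= *.
- apply: functor_on_tcmp => *; rewrite ?left_Id ?right_Id ?Id_Id //.
  exact: Id_tcmph.
- apply: functor_on_tcmp => *; rewrite ?src_idn ?tgt_idn //.
  by rewrite tcmp_idl ?src_idn.
- apply: functor_on_tcmp => *; rewrite ?top_Id ?bot_Id ?Id_Id //.
  exact: Id_tcmpv.
- apply: functor_on_tcmp => *; rewrite ?src_idn ?tgt_idn //.
  by rewrite tcmp_idl ?src_idn.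
- by rewrite tcmp_idr ?tcmp_idl.
- by rewrite tcmp_idr ?tcmp_idl.
- rewrite Id_Id tcmp_idr ?bot_Id // Id_Id tcmp_idl ?top_Id //.
Defined.

Definition funny_lunit (X : dblcat) : dblfun (funny terminal_dblcat X) X :=
  funny_lift (lunit_bifun X).

Definition funny_runit (X : dblcat) : dblfun (funny X terminal_dblcat) X :=
  dblfun_comp (funny_lunit X) (sym X terminal_dblcat).

Ltac gens_unit := rewrite /funny_runit /funny_lunit /sym;
  cbn [const_dblfun lunit_bifun]; gens_assoc; 
  repeat progress (cbn [fob fhor fver fsq bR bL bVH bHV const_dblfun
    lunit_bifun]; gens_assoc).

Section GeneratorIdentities.
Variables A B : dblcat.
Implicit Types (x : ob A) (y : ob B).
Local Notation b := (funny_bifun A B).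

(** These equations collapse the generators at identities. The unitors produce such generators, and
    evaluation alone does not identify them with identities. *)
Lemma hR_idn x y : hR x (idn (hcat B) y) = idn (hcat (funny A B)) (x, y).
Proof. exact: (f_idn (fun_hcat (bR b x))). Qed.
Lemma hL_idn x y : hL (idn (hcat A) x) y = idn (hcat (funny A B)) (x, y).
Proof. exact: (f_idn (fun_hcat (bL b y))). Qed.
Lemma vR_idn x y : vR x (idn (vcat B) y) = idn (vcat (funny A B)) (x, y).
Proof. exact: (f_idn (fun_vcat (bR b x))). Qed.
Lemma vL_idn x y : vL (idn (vcat A) x) y = idn (vcat (funny A B)) (x, y).
Proof. exact: (f_idn (fun_vcat (bL b y))). Qed.
Lemma sR_hidn x u : sR x (idn (hsq B) u) = idn (hsq (funny A B)) (vR x u).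
Proof. exact: (f_idn (fun_hsq (bR b x))). Qed.
Lemma sR_vidn x k : sR x (idn (vsq B) k) = idn (vsq (funny A B)) (hR x k).
Proof. exact: (f_idn (fun_vsq (bR b x))). Qed.
Lemma sL_hidn U y : sL (idn (hsq A) U) y = idn (hsq (funny A B)) (vL U y).
Proof. exact: (f_idn (fun_hsq (bL b y))). Qed.
Lemma sL_vidn K y : sL (idn (vsq A) K) y = idn (vsq (funny A B)) (hL K y).
Proof. exact: (f_idn (fun_vsq (bL b y))). Qed.
Lemma sVH_hidn U y : sVH U (idn (hcat B) y) = idn (hsq (funny A B)) (vL U y).
Proof. exact: (f_idn (bVH_h b U)). Qed.
Lemma sVH_vidn x k : sVH (idn (vcat A) x) k = idn (vsq (funny A B)) (hR x k).
Proof. exact: (f_idn (bVH_v b k)). Qed.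
Lemma sHV_vidn K y : sHV K (idn (vcat B) y) = idn (vsq (funny A B)) (hL K y).
Proof. exact: (f_idn (bHV_v b K)). Qed.
Lemma sHV_hidn x u : sHV (idn (hcat A) x) u = idn (hsq (funny A B)) (vR x u).
Proof. exact: (f_idn (bHV_h b u)). Qed.
End GeneratorIdentities.

Definition idnE := (hR_idn, hL_idn, vR_idn, vL_idn, sR_hidn, sR_vidn, sL_hidn,
  sL_vidn, sVH_hidn, sVH_vidn, sHV_vidn, sHV_hidn).

Lemma lunitK (X : dblcat) :
  dblfun_comp (funny_inr (tt : ob terminal_dblcat)) (funny_lunit X)
  = dblfun_id _.
Proof.
apply: funny_ext; repeat case; move=> *; gens_unit; rewrite !idnE.
(* The arrow [tt] is convertible to the identity of the terminal double category, so the remaining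
   generators over it are instances of the identity laws read backwards. *)
- exact: (eq_sym (@hL_idn terminal_dblcat X tt _)).
- exact: (eq_sym (@vL_idn terminal_dblcat X tt _)).
- rewrite -(@vL_idn terminal_dblcat X tt).
  exact: (eq_sym (@sL_hidn terminal_dblcat X tt _)).
- exact: (eq_sym (@sVH_vidn terminal_dblcat X tt _)).
- exact: (eq_sym (@sHV_hidn terminal_dblcat X tt _)).
Qed.

Lemma inr_lunitK (X : dblcat) :
  dblfun_comp (funny_lunit X) (funny_inr (tt : ob terminal_dblcat))
  = dblfun_id _.
Proof. by apply: dblfun_eq => *; gens_unit. Qed.

Lemma lunit_natural (X X' : dblcat) (f : dblfun X X') :
  dblfun_comp (funny_lunit X') (dmap (dblfun_id terminal_dblcat) f)
  = dblfun_comp f (funny_lunit X).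
Proof.
apply: funny_ext => *; gens_unit.
- by rewrite (f_idn (fun_hcat f)).
- by rewrite (f_idn (fun_vcat f)).
- by rewrite (f_idn (fun_hsq f)) (f_idn (fun_vcat f)).
- by rewrite (f_idn (fun_vsq f)).
- by rewrite (f_idn (fun_hsq f)).
Qed.

Lemma runit_natural (X X' : dblcat) (f : dblfun X X') :
  dblfun_comp (funny_runit X') (dmap f (dblfun_id terminal_dblcat))
  = dblfun_comp f (funny_runit X).
Proof.
rewrite /funny_runit dblfun_compA sym_natural -dblfun_compA lunit_natural.
exact: dblfun_compA.
Qed.

Lemma funny_triangle (X Y : dblcat) :
  dblfun_comp (dmap (dblfun_id X) (funny_lunit Y))
    (funny_assoc X terminal_dblcat Y)
  = dmap (funny_runit X) (dblfun_id Y).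
Proof. by apply: funny_ext3 => *; gens_unit; rewrite ?idnE. Qed.

Lemma assoc_natural (X X' Y Y' Z Z' : dblcat) (f : dblfun X X')
    (g : dblfun Y Y') (h : dblfun Z Z') :
  dblfun_comp (funny_assoc X' Y' Z') (dmap (dmap f g) h)
  = dblfun_comp (dmap f (dmap g h)) (funny_assoc X Y Z).
Proof. by apply: funny_ext3 => *; gens_assoc. Qed.

(** [funny_ext3] treats [funny W X] as a single factor and leaves its cells arbitrary. These are
    reduced to generators in turn: cells [(- # y) # z] by restricting twice, and mixed squares by
    their functoriality in the cell of [funny W X]. *)
Lemma funny_pentagon (W X Y Z : dblcat) :
  dblfun_comp (funny_assoc W X (funny Y Z)) (funny_assoc (funny W X) Y Z)
  = dblfun_comp (dblfun_comp (dmap (dblfun_id W) (funny_assoc X Y Z))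
                             (funny_assoc W (funny X Y) Z))
      (dmap (funny_assoc W X Y) (dblfun_id Z)).
Proof.
set F := LHS; set G := RHS.
pose S := funny (funny (funny W X) Y) Z; pose T := funny W (funny X (funny Y Z)).
have eL y z : dblfun_comp (dblfun_comp F (funny_inl z)) (funny_inl y)
            = dblfun_comp (dblfun_comp G (funny_inl z)) (funny_inl y).
  by apply: funny_ext => *; rewrite /F /G; gens_assoc.
(* The four functors send a 1-cell of [funny W X] to the value of [H] on a mixed square. In [vh] and
   [hv] the square is mixed with [Z]; in the primed ones it is mixed with [Y] and then placed at an
   object of [Z]. *)
have vh (H : dblfun S T) y k :=
  functor_on_comp (fun_vsq H) (functor_on_comp
    (bVH_v (funny_bifun (funny (funny W X) Y) Z) k)
    (fun_vcat (@funny_inl (funny W X) Y y))).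
have hv (H : dblfun S T) y u :=
  functor_on_comp (fun_hsq H) (functor_on_comp
    (bHV_h (funny_bifun (funny (funny W X) Y) Z) u)
    (fun_hcat (@funny_inl (funny W X) Y y))).
have vh' (H : dblfun S T) k z :=
  functor_on_comp (fun_vsq (dblfun_comp H (funny_inl z)))
    (bVH_v (funny_bifun (funny W X) Y) k).
have hv' (H : dblfun S T) u z :=
  functor_on_comp (fun_hsq (dblfun_comp H (funny_inl z)))
    (bHV_h (funny_bifun (funny W X) Y) u).
apply: funny_ext3.
- by case=> *; rewrite /F /G; gens_assoc.
- by case=> *; rewrite /F /G; gens_assoc.
- by case=> *; rewrite /F /G; gens_assoc.
- by move=> K y z; have /(f_equal (fun H => fhor H K)) := eL y z.
- by case=> *; rewrite /F /G; gens_assoc.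
- by case=> *; rewrite /F /G; gens_assoc.
- by move=> U y z; have /(f_equal (fun H => fver H U)) := eL y z.
- by case=> *; rewrite /F /G; gens_assoc.
- by case=> *; rewrite /F /G; gens_assoc.
- by move=> a y z; have /(f_equal (fun H => fsq H a)) := eL y z.
- move=> U k z; move: U.
  by apply: (funny_ver_ext (vh' F k z) (vh' G k z)) => *; rewrite /F /G;
    gens_assoc.
- move=> K u z; move: K.
  by apply: (funny_hor_ext (hv' F u z) (hv' G u z)) => *; rewrite /F /G;
    gens_assoc.
- by case=> *; rewrite /F /G; gens_assoc.
- move=> U y k; move: U.
  by apply: (funny_ver_ext (vh F y k) (vh G y k)) => *; rewrite /F /G;
    gens_assoc.
- by case=> *; rewrite /F /G; gens_assoc.
- move=> K y u; move: K.
  by apply: (funny_hor_ext (hv F y u) (hv G y u)) => *; rewrite /F /G;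
    gens_assoc.
Qed.

(** * The adjunctions and the theorem *)

Definition dhom_functor (B : dblcat) : functor Dbl Dbl.
Proof.
refine (@Functor Dbl Dbl (dhom B) (fun C D h => post B h) _ _).
- move=> C; apply: dblfun_eq => [F|a|a|a].
  + exact: dblfun_eq.
  + by apply: htrans_eq => //; apply: dblfun_eq.
  + by apply: vtrans_eq => //; apply: dblfun_eq.
  + by apply: tsq_eq => //; (apply: htrans_eq || apply: vtrans_eq) => //;
      apply: dblfun_eq.
- move=> C D E g f; apply: dblfun_eq => [F|a|a|a].
  + exact: dblfun_eq.
  + by apply: htrans_eq => //; apply: dblfun_eq.
  + by apply: vtrans_eq => //; apply: dblfun_eq.
  + by apply: tsq_eq => //; (apply: htrans_eq || apply: vtrans_eq) => //;
      apply: dblfun_eq.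
Defined.

Definition funny_adjunction_right (B : dblcat) :
  adjunction (tensor_right funny_tensor B) (dhom_functor B).
Proof.
refine (@Adjunction Dbl Dbl (tensor_right funny_tensor B) (dhom_functor B)
  (fun A C h => @curry A B C h) (fun A C h => @uncurry A B C h)
  (fun A C => @curryK A B C) (fun A C => @uncurryK A B C) _).
move=> A A' C C' f h g.
(* The tensor functor is built from the transparent [funny_map]; displaying it lets [dmapE] restore
   the sealed [dmap]. *)
change (curry (dblfun_comp (dblfun_comp g h) (funny_map f (dblfun_id B)))
        = dblfun_comp (dblfun_comp (post B g) (curry h)) f).
by rewrite -dmapE curry_natural.
Defined.

Definition funny_adjunction_left (B : dblcat) :
  adjunction (tensor_left funny_tensor B) (dhom_functor B).
Proof.
refine (@Adjunction Dbl Dbl (tensor_left funny_tensor B) (dhom_functor B)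
  (fun A C h => @curry A B C (dblfun_comp h (sym A B)))
  (fun A C h => dblfun_comp (@uncurry A B C h) (sym B A)) _ _ _).
- by move=> A C h; rewrite curryK dblfun_compA symK dblfun_idr.
- by move=> A C h; rewrite dblfun_compA symK dblfun_idr uncurryK.
- move=> A A' C C' f h g; change (curry (dblfun_comp (dblfun_comp (dblfun_comp
    g h)
                  (funny_map (dblfun_id B) f)) (sym A' B))
    (* Naturality of the symmetry moves [f] from the second factor to the first, which leaves
       [curry_natural]. *)
    = dblfun_comp (dblfun_comp (post B g) (curry (dblfun_comp h (sym A B)))) f).
  rewrite -dmapE dblfun_compA -sym_natural -dblfun_compA (dblfun_compA g).
  by rewrite curry_natural.
Defined.

Definition funny_monoidal : monoidal_structure funny_tensor terminal_dblcat.
Proof.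
refine (@MonoidalStructure Dbl funny_tensor terminal_dblcat
  funny_assoc funny_lunit funny_runit _ _ _ _ _ _ _ _).
- by move=> X Y Z; exists (assoc_inv X Y Z); split;
    [exact: assocK | exact: assoc_invK].
- move=> X; exists (funny_inr (tt : ob terminal_dblcat)).
  by split; [exact: lunitK | exact: inr_lunitK].
- move=> X; exists (dblfun_comp (sym terminal_dblcat X) (funny_inr (tt : ob
    terminal_dblcat))).
  rewrite /= /funny_runit; split.
    by rewrite dblfun_compA -(dblfun_compA (funny_inr _)) lunitK dblfun_idl
      symK.
  by rewrite dblfun_compA -(dblfun_compA (sym _ _)) symK dblfun_idl inr_lunitK.
- move=> X X' Y Y' Z Z' f g h; have := assoc_natural f g h.
  by rewrite !dmapE.
- by move=> X X' f; have := lunit_natural f; rewrite !dmapE.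
- by move=> X X' f; have := runit_natural f; rewrite !dmapE.
- by move=> W X Y Z; have := funny_pentagon W X Y Z; rewrite !dmapE.
- by move=> X Y; have := funny_triangle X Y; rewrite !dmapE.
Qed.

Theorem theorem5p30 :
  inhabited (monoidal_structure funny_tensor terminal_dblcat)
  /\ biclosed funny_tensor.
Proof.
split; first by constructor; apply: funny_monoidal.
split=> B; exists (dhom_functor B); constructor.
  exact: funny_adjunction_right.
exact: funny_adjunction_left.
Qed.
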